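(* Let $1\le l\le m$ be integers, $1<p,p_1,\dots,p_m<\infty$ and $1\le q,q_1,\dots,q_m<\infty$ with $\frac1p=\sum_{i=1}^m\frac1{p_i}$ and $\frac1q=\sum_{i=1}^m\frac1{q_i}$, and let $0\le\lambda<n$ with $\frac\lambda n<\min\{\frac{q_1}{p_1},\dots,\frac{q_m}{p_m},\frac qp\}$. Suppose that $\vec b=(b_1,\dots,b_l)\in\mathrm{BMO}^l$ and that the iterated commutator $\mathcal{T}_{\vec b}$ (acting in the first $l$ variables) of an $m$-linear operator $\mathcal{T}$ satisfies the pointwise sparse domination hypothesis. Then $$\|\mathcal{T}_{\vec b}(\vec f)\|_{\mathcal{R}^{(p,q,\lambda)}}\le C\|\vec b\|_{\mathrm{BMO}}\prod_{i=1}^m\|f_i\|_{\mathcal{R}^{(p_i,q_i,\lambda)}}.$$ In particular, when $p_i=q_i$ for $i=1,\dots,m$ (hence $p=q$), $$\|\mathcal{T}_{\vec b}(\vec f)\|_{L^{q,\lambda}(\mathbb{R}^n)}\le C\|\vec b\|_{\mathrm{BMO}}\prod_{i=1}^m\|f_i\|_{L^{q_i,\lambda}(\mathbb{R}^n)}.$$ Here $C$ is independent of $\vec f$ and $\vec b$.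
   Context: Notation. $Q$ denotes cubes in $\mathbb{R}^n$, $\langle f\rangle_Q=\frac1{|Q|}\int_Q f$, $B(x,r)$ is the open ball. $\|b\|_{\mathrm{BMO}}=\sup_Q\frac1{|Q|}\int_Q|b-\langle b\rangle_Q|$ and $\|\vec b\|_{\mathrm{BMO}}=\prod_i\|b_i\|_{\mathrm{BMO}}$. Sparse families. For a cube $Q_0$, $\mathcal{D}(Q_0)$ is the collection of dyadic subcubes of $Q_0$. A dyadic lattice $\mathscr{D}$ is a collection of cubes such that (i) $Q\in\mathscr{D}$ implies $\mathcal{D}(Q)\subset\mathscr{D}$; (ii) any $Q',Q''\in\mathscr{D}$ lie in $\mathcal{D}(Q)$ for some $Q\in\mathscr{D}$; (iii) every compact set is contained in some $Q\in\mathscr{D}$. A family $\mathcal{S}\subset\mathscr{D}$ is $\eta$-sparse ($0<\eta<1$) if $|\bigcup_{Q'\in\mathcal{S},Q'\subsetneq Q}Q'|\le(1-\eta)|Q|$ for all $Q\in\mathcal{S}$; ''sparse'' means $\eta$-sparse for a fixed $\eta\in(0,1)$ not depending on the functions. Iterated commutator and sparse domination hypothesis. For an $m$-linear operator $\mathcal{T}$ with kernel representation $\mathcal{T}(\vec f)(x)=\int_{\mathbb{R}^{nm}}K(x,\vec y)\prod_{s=1}^m f_s(y_s)\,d\vec y$, $$\mathcal{T}_{\vec b}(\vec f)(x)=\int_{\mathbb{R}^{nm}}\prod_{s=1}^l(b_s(x)-b_s(y_s))K(x,\vec y)\prod_{s=1}^m f_s(y_s)\,d\vec y;$$ in general $\mathcal{T}_{\vec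 b}=[b_1,\cdots[b_l,\mathcal{T}]_l\cdots]_1$ with $[b_s,\mathcal{T}]_s(\vec f)=b_s\mathcal{T}(\vec f)-\mathcal{T}(f_1,\dots,b_sf_s,\dots,f_m)$. Put $\mathcal{T}(b,f,Q,1)=|b-\langle b\rangle_Q|\langle|f|\rangle_Q$ (a function of $x$) and $\mathcal{T}(b,f,Q,2)=\langle|(b-\langle b\rangle_Q)f|\rangle_Q$. The pointwise sparse domination hypothesis: there is $C$ such that for all bounded compactly supported $f_1,\dots,f_m$ there exist $3^n$ sparse collections $\mathcal{S}_1,\dots,\mathcal{S}_{3^n}$ with, for a.e. $x$, $$|\mathcal{T}_{\vec b}(\vec f)(x)|\le C\sum_{j=1}^{3^n}\sum_{\vec\gamma\in\{1,2\}^l}\sum_{Q\in\mathcal{S}_j}\Big(\prod_{s=1}^l\mathcal{T}(b_s,f_s,Q,\gamma_s)\Big)\Big(\prod_{s=l+1}^m\langle|f_s|\rangle_Q\Big)\chi_Q(x).$$ Spaces. $L^{p,q}(\mathbb{R}^n)$ is the Lorentz space with $\|f\|_{L^{p,q}}=(\int_0^\infty(t^{1/p}f^*(t))^q\frac{dt}t)^{1/q}$ for $q<\infty$, $f^*$ being the decreasing rearrangement. The Morrey-Lorentz space has norm $\|f\|_{\mathcal{R}^{(p,q,\lambda)}}=\sup_{x\in\mathbb{R}^n,r>0}\frac1{r^{\lambda/q}}\|f\chi_{B(x,r)}\|_{L^{p,q}(\mathbb{R}^n)}$. The classical Morrey space has norm $\|f\|_{L^{q,\lambda}(\mathbb{R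}^n)}=\sup_{x\in\mathbb{R}^n,r>0}\frac1{r^{\lambda/q}}\|f\chi_{B(x,r)}\|_{L^q(\mathbb{R}^n)}$.
   Formalization: The estimates are proved for bounded, compactly supported (real-valued, measurable) f_1,…,f_m, the class on which the sparse domination hypothesis controls T_b; for arbitrary f in the Morrey–Lorentz spaces they can fail for a general m-linear operator. *)

(* Defs.v *)
From HB Require Import structures.
From mathcomp Require Import all_boot all_order all_algebra.
From mathcomp Require Import all_classical all_reals all_analysis.

Set Implicit Arguments.
Unset Strict Implicit.
Unset Printing Implicit Defensive.

Import Order.TTheory GRing.Theory Num.Theory.
Import numFieldNormedType.Exports.

Local Open Scope classical_set_scope.
Local Open Scope ring_scope.

(* Points of R^n are tuples, which carry the product Borel sigma-algebra. *)
Notation Rn R n := (n.-tuple (measurableTypeR R)).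

Lemma product_sigma_finite d1 d2 (T1 : measurableType d1)
    (T2 : measurableType d2) (R : realType)
    (m1 : {sigma_finite_measure set T1 -> \bar R})
    (m2 : {sigma_finite_measure set T2 -> \bar R}) :
  sigma_finite setT (m1 \x m2)%E.
Proof.
have /sigma_finiteP[F [TF ndF Foo]] := sigma_finiteT m1.
have /sigma_finiteP[G [TG ndG Goo]] := sigma_finiteT m2.
exists (fun n => F n `*` G n).
  rewrite -setXTT TF TG predeqE => -[x y]; split.
    move=> [/= [n _ Fnx] [k _ Gky]]; exists (maxn n k) => //; split.
    - by move: x Fnx; exact/subsetPset/ndF/leq_maxl.
    - by move: y Gky; exact/subsetPset/ndG/leq_maxr.
  by move=> [n _ []/= ? ?]; split; exists n.
move=> k; have [? ?] := Foo k; have [? ?] := Goo k.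
split; first exact: measurableX.
by rewrite product_measure1E// lte_mul_pinfty// ge0_fin_numE.
Qed.

Section LebesgueStep.
Context (R : realType) (n : nat)
  (mu : {sigma_finite_measure set (Rn R n) -> \bar R}).

Definition tuple_cons (z : measurableTypeR R * Rn R n) : Rn R n.+1 :=
  [tuple of z.1 :: z.2].

Lemma measurable_tuple_cons : measurable_fun [set: _] tuple_cons.
Proof.
exact: (measurable_cons (@measurable_fst _ _ _ _) (@measurable_snd _ _ _ _)).
Qed.

Definition lebesgue_step : set (Rn R n.+1) -> \bar R :=
  pushforward (@lebesgue_measure R \x mu)%E tuple_cons.

Let step0 : lebesgue_step set0 = 0%E.
Proof. by rewrite /lebesgue_step /pushforward preimage_set0 measure0. Qed.

Let step_ge0 A : (0 <= lebesgue_step A)%E.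
Proof. by rewrite /lebesgue_step /pushforward; exact: measure_ge0. Qed.

Let step_sigma_additive : semi_sigma_additive lebesgue_step.
Proof.
move=> F mF tF mUF; rewrite /lebesgue_step /pushforward preimage_bigcup.
apply: measure_semi_sigma_additive.
- by move=> k; rewrite -[X in measurable X]setTI; exact: measurable_tuple_cons.
- apply/trivIsetP => /= i j _ _ ij; rewrite -preimage_setI.
  by move/trivIsetP : tF => /(_ _ _ _ _ ij) ->//; rewrite preimage_set0.
- rewrite -preimage_bigcup -[X in measurable X]setTI.
  exact: measurable_tuple_cons.
Qed.

HB.instance Definition _ := isMeasure.Build _ _ _
  lebesgue_step step0 step_ge0 step_sigma_additive.

Let step_sigma_finite : sigma_finite setT lebesgue_step.
Proof.
have [F FT Foo] := product_sigma_finite (@lebesgue_measure R) mu.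
pose g (y : Rn R n.+1) : measurableTypeR R * Rn R n :=
  (thead y, [tuple of behead y]).
have mg : measurable_fun [set: _] g.
  apply/measurable_fun_pair; first exact: measurable_tnth.
  exact: measurable_behead.
exists (fun k => g @^-1` F k).
  by rewrite -preimage_bigcup -FT preimage_setT.
move=> k; have [mFk Fk] := Foo k; split.
  by rewrite -[X in measurable X]setTI; exact: mg.
rewrite /= /lebesgue_step /pushforward -comp_preimage.
rewrite (_ : g \o tuple_cons = id) ?preimage_id//.
apply/funext => -[x t]; rewrite /g /tuple_cons /=; congr pair.
exact: val_inj.
Qed.

HB.instance Definition _ := Measure_isSigmaFinite.Build _ _ _
  lebesgue_step step_sigma_finite.

End LebesgueStep.

(* n-fold product of the one-dimensional Lebesgue measure. *)
Fixpoint lebesgue_Rn (R : realType) (n : nat) :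
    {sigma_finite_measure set (Rn R n) -> \bar R} :=
  if n is k.+1 then
    [the {sigma_finite_measure set (Rn R k.+1) -> \bar R} of
      lebesgue_step (lebesgue_Rn R k)]
  else
    [the {sigma_finite_measure set (Rn R 0) -> \bar R} of
      @dirac _ (Rn R 0) [tuple] R].

Section Cubes.
Context {R : realType} {n : nat}.
Local Notation mu := (lebesgue_Rn R n).

Definition eball (x : Rn R n) (r : R) : set (Rn R n) :=
  [set y | Num.sqrt (\sum_(i < n) (tnth y i - tnth x i) ^+ 2) < r].

(* Compactness for the usual topology of R^n, borrowed from row vectors. *)
Definition compact_Rn (K : set (Rn R n)) : Prop :=
  compact ((fun x => \row_(i < n) (tnth x i : R)) @` K : set 'rV[R]_n).

(* A half-open cube is given by its lower corner and its positive side. *)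
Definition cube := {Q : Rn R n * R | 0 < Q.2}.
Definition corner (Q : cube) : Rn R n := (val Q).1.
Definition side (Q : cube) : R := (val Q).2.
Definition cube_set (Q : cube) : set (Rn R n) :=
  [set x | forall i,
    (tnth (corner Q) i : R) <= tnth x i < (tnth (corner Q) i : R) + side Q].

Definition dyadic_subcubes (Q0 : cube) : set cube :=
  [set Q | exists (k : nat) (a : 'I_n -> nat),
    [/\ (forall i, (a i < 2 ^ k)%N),
        side Q = side Q0 / 2 ^+ k &
        (forall i, tnth (corner Q) i
                   = tnth (corner Q0) i + (a i)%:R * side Q)]].

Definition dyadic_lattice (D : set cube) : Prop :=
  [/\ (forall Q, D Q -> dyadic_subcubes Q `<=` D),
      (forall Q1 Q2, D Q1 -> D Q2 ->
        exists Q, [/\ D Q, dyadic_subcubes Q Q1 & dyadic_subcubes Q Q2]) &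
      (forall K, compact_Rn K -> exists Q, D Q /\ K `<=` cube_set Q)].

Definition sparse (eta : R) (S : set cube) : Prop :=
  exists D, [/\ dyadic_lattice D, S `<=` D &
    (forall Q, S Q ->
      (mu (\bigcup_(Q' in S `&` [set Q' | cube_set Q' `<` cube_set Q])
             cube_set Q')
       <= (1 - eta)%:E * mu (cube_set Q))%E)].

Definition mean (Q : cube) (f : Rn R n -> R) : R :=
  (fine (mu (cube_set Q)))^-1 * \int[mu]_(x in cube_set Q) f x.

Definition average_abs (Q : cube) (f : Rn R n -> R) : \bar R :=
  (((fine (mu (cube_set Q)))^-1)%:E *
   \int[mu]_(x in cube_set Q) `|(f x)%:E|)%E.

Definition bmo_norm (b : Rn R n -> R) : \bar R :=
  ereal_sup [set average_abs Q (fun x => b x - mean Q b) | Q in [set: cube]].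

Definition BMO (b : Rn R n -> R) : Prop :=
  [/\ measurable_fun [set: Rn R n] b,
      (forall Q : cube, mu.-integrable (cube_set Q) (EFin \o b)) &
      (bmo_norm b < +oo)%E].

Definition bounded_compact_support (f : Rn R n -> R) : Prop :=
  [/\ measurable_fun [set: Rn R n] f,
      (exists M : R, forall x, `|f x| <= M) &
      (exists K, compact_Rn K /\ forall x, ~ K x -> f x = 0)].

Section Lorentz.
Local Open Scope ereal_scope.
Implicit Types f : Rn R n -> R.

Definition distribution_function f (s : R) : \bar R :=
  mu [set x | (s < `|f x|)%R].

Definition rearrangement f (t : R) : \bar R :=
  ereal_inf [set s%:E | s in
    [set s : R | (0 <= s)%R /\ distribution_function f s <= t%:E]].

Definition lorentz_norm (p q : R) f : \bar R :=
  (\int[@lebesgue_measure R]_(t in `]0%R, +oo[)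
     (((t `^ p^-1)%:E * rearrangement f t) `^ q * (t^-1)%:E)) `^ q^-1.

Definition morrey_lorentz_norm (p q lam : R) f : \bar R :=
  ereal_sup [set ((z.2 `^ (lam / q))^-1)%:E *
                 lorentz_norm p q (fun y => (f y * \1_(eball z.1 z.2) y)%R)
            | z in [set z : Rn R n * R | (0 < z.2)%R]].

Definition morrey_norm (q lam : R) f : \bar R :=
  ereal_sup [set ((z.2 `^ (lam / q))^-1)%:E *
                 Lnorm mu q%:E (fun y => (f y * \1_(eball z.1 z.2) y)%:E)
            | z in [set z : Rn R n * R | (0 < z.2)%R]].

End Lorentz.

Section Operators.
Context {m : nat}.

Definition operator : Type := ('I_m -> Rn R n -> R) -> Rn R n -> R.

(* V is the domain on which the operator acts, in each of its m arguments;
   its values outside V are irrelevant. Linearity is only required almost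
   everywhere. *)
Definition multilinear_operator (V : set (Rn R n -> R)) (T : operator) : Prop :=
  [/\ (forall f, V f -> measurable_fun [set: Rn R n] f),
      (forall f, bounded_compact_support f -> V f),
      (forall (a : R) f g, V f -> V g -> V (fun x => a * f x + g x)),
      (forall fs, (forall i, V (fs i)) -> measurable_fun [set: Rn R n] (T fs)) &
      forall fs (i : 'I_m) (a : R) f g,
        (forall j, V (fs j)) -> V f -> V g ->
        {ae mu, forall x,
          T [eta fs with i |-> fun y => a * f y + g y] x
          = a * T [eta fs with i |-> f] x + T [eta fs with i |-> g] x}].

Definition commutator (b : Rn R n -> R) (s : 'I_m) (T : operator) : operator :=
  fun fs x => b x * T fs x - T [eta fs with s |-> fun y => b y * fs s y] x.

Definition iterated_commutator (l : nat) (hlm : (l <= m)%N)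
    (b : 'I_l -> Rn R n -> R) (T : operator) : operator :=
  foldr (fun s U => commutator (b s) (widen_ord hlm s) U) T (enum 'I_l).

(* The two factors T(b,f,Q,1) (for g = false) and T(b,f,Q,2) (for g = true). *)
Definition sparse_factor (b f : Rn R n -> R) (Q : cube) (g : bool)
    (x : Rn R n) : \bar R :=
  if g then average_abs Q (fun y => (b y - mean Q b) * f y)
  else (`|(b x - mean Q b)%R%:E| * average_abs Q f)%E.

Definition sparse_domination (C eta : R) (l : nat) (hlm : (l <= m)%N)
    (b : 'I_l -> Rn R n -> R) (Tb : operator) : Prop :=
  forall fs, (forall i, bounded_compact_support (fs i)) ->
  exists S : 'I_(3 ^ n) -> set cube,
    (forall j, sparse eta (S j)) /\
    {ae mu, forall x,
      (`|(Tb fs x)%:E| <=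
       C%:E * \sum_(j < 3 ^ n) \sum_(g : {ffun 'I_l -> bool})
         esum (S j) (fun Q =>
           (\prod_(s < l) sparse_factor (b s) (fs (widen_ord hlm s)) Q (g s) x)
           * (\prod_(s < m | (l <= s)%N) average_abs Q (fs s))
           * (\1_(cube_set Q) x)%:E))%E}.

End Operators.

End Cubes.

Arguments cube R n : clear implicits.
Arguments operator R n m : clear implicits.

(* Main.v *)
(* Fix a ball [B] of radius [r] and a level [2 ^ k]. Up to John-Nirenberg, each sparse sum is a sum over a
   sparse family of [c_Q * w_Q * 1_Q], where [c_Q] is the product of the means
   [<|f_i| ^ rho>_Q ^ (1 / rho)], with [rho] slightly above 1, and the weight [w_Q], a product of
   normalized oscillations of the [b_s], has tails of arbitrary polynomial order on [Q]. The cubes of side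
   at most [r] only see the [f_i] near [B]; organised by the size of [c_Q] and by generation, they give,
   outside a set of measure O(2 ^ k), at most a constant times
   [Lam k = sup_j 2 ^ j * prod_i G_i (k + N j)], where [G_i] is a maximal-function version of the
   rearrangement of [f_i]. For the larger cubes the Morrey norms bound [c_Q] by [side Q ^ (lam/q - n/p)],
   which decays, and the scales sum up. Hence the rearrangement of [1_B * T_b f] at [2 ^ k] is bounded by
   [Lam k] plus an explicit power of [r ^ n / 2 ^ k]; taking the [q]-th power with weight [2 ^ (k q / p)]
   and summing over the integers [k], Hoelder's and Hardy's inequalities conclude. The Lorentz norm, and
   for [p = q] the Lebesgue norm, is comparable with such a discrete sum. *)

Require Import Defs.
From mathcomp Require Import all_boot all_order all_algebra.
From mathcomp Require Import all_classical all_reals all_analysis.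
From mathcomp Require Import measurable_realfun.
From mathcomp Require Import zify ring lra.

Set Implicit Arguments.
Unset Strict Implicit.
Unset Printing Implicit Defensive.

Import Order.TTheory GRing.Theory Num.Theory.
Import numFieldNormedType.Exports.

Local Open Scope classical_set_scope.
Local Open Scope ring_scope.

(** * Countable unions and unordered sums *)

(** The factors [|b_s x - mean Q b_s|] depend on [x] and are unbounded, so they cannot be absorbed
    into averages over [Q]: their large values are paid for by exceptional sets, whose total measure
    must stay [O(2 ^ k)] over infinitely many layers. This fixes the exponents. One takes
    [1 / p_i < kap < 1 / rho]: the first inequality makes the Hardy sums over the rearrangement of
    [f_i] converge, the second the sums over its level sets; there is room because
    [1 / p_i <= 1 / p < 1]. The supremum [Lam], where [2 ^ j] meets the scale [k + N j], is
    controlled when [N > p]. The layers of index [j] have measure about [2 ^ (k + N j)], and a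
    threshold [2 ^ (j / 2)] for the weight beats this growth when [a > 2 N]; for the large cubes the
    same balance reads [a delta / 2 > n], where [delta = n / p - lam / q] is positive by the
    condition relating [lam / n] and [q / p]. Exceptional sets of measure [O(2 ^ k)] only force the
    rearrangement to be evaluated at [2 ^ (k + k0)], which costs a constant. Oscillations are
    divided by BMO norms, so a vanishing BMO norm is a separate case. *)

Section CountableUnions.
Context d (T : measurableType d) (R : realType) (mu : {measure set T -> \bar R}).
Context (U : choiceType).

Lemma countable_bigcup_measurable (D : set U) (F : U -> set T) :
  countable D -> (forall i, D i -> measurable (F i)) ->
  measurable (\bigcup_(i in D) F i).
Proof.
move=> /countable_injP[f finj] mF.
have -> : \bigcup_(i in D) F i = \bigcup_k \bigcup_(i in D `&` f @^-1` [set k]) F i.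
  apply/seteqP; split=> [x [i Di Fix]|x [k _ [i [Di _] Fix]]]; last by exists i.
  by exists (f i) => //; exists i.
apply: bigcupT_measurable => k.
have [->|/set0P[i0 [Di0 fi0]]] := eqVneq (D `&` f @^-1` [set k]) set0.
  by rewrite bigcup_set0.
rewrite (_ : D `&` _ = [set i0]); first by rewrite bigcup_set1; exact: mF.
apply/seteqP; split=> [i [Di fi]|_ ->]//=.
by apply: finj; rewrite ?inE// fi0.
Qed.

Let cover_split (D : set U) (f : U -> nat) (finj : {in D &, injective f}) k :
  D `&` f @^-1` [set k] = set0 \/ exists2 i0, D i0 & D `&` f @^-1` [set k] = [set i0].
Proof.
have [->|/set0P[i0 [Di0 fi0]]] := eqVneq (D `&` f @^-1` [set k]) set0; first by left.
right; exists i0 => //; apply/seteqP; split=> [i [Di fi]|_ ->]//=.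
by apply: finj; rewrite ?inE// fi0.
Qed.

(** The lemmas below apply it with [f] injective: each group then has at most one index, by
    [cover_split], and statements on sequences of sets transfer to countable families. *)
Let esum_split (D : set U) (f : U -> nat) (a : U -> \bar R) : (forall i, 0 <= a i)%E ->
  (\esum_(i in D) a i = \sum_(0 <= k <oo) \esum_(i in D `&` f @^-1` [set k]) a i)%E.
Proof.
move=> a0; rewrite -nneseries_sum_bigcup//; last first.
  by apply/trivIsetP => i j _ _ ij; rewrite setIACA setIid; apply/seteqP; split=> // x [_ /= [xi xj]]; move: ij; rewrite -xi -xj eqxx.
congr (esum _ _); apply/seteqP; split=> [i Di|i [k _ []]]//.
by exists (f i).
Qed.

Lemma measure_bigcup_le_esum (D : set U) (F : U -> set T) :
  countable D -> (forall i, D i -> measurable (F i)) ->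
  (mu (\bigcup_(i in D) F i) <= \esum_(i in D) mu (F i))%E.
Proof.
move=> cD mF; have mFD := countable_bigcup_measurable cD mF.
have /countable_injP[f finj] := cD.
rewrite (esum_split _ f)//.
pose G k := \bigcup_(i in D `&` f @^-1` [set k]) F i.
have mG k : measurable (G k).
  by apply: countable_bigcup_measurable => [|i [Di _]]; [apply: sub_countable cD; exact: subset_card_le|exact: mF].
apply: (@le_trans _ _ (\sum_(0 <= k <oo) mu (G k))%E).
  apply: measure_sigma_subadditive => //.
  by move=> x [i Di Fix]; exists (f i) => //; exists i.
apply: lee_nneseries => // k _.
rewrite /G; have [->|[i0 _ ->]] := cover_split finj k.
  by rewrite bigcup_set0 measure0 esum_set0.
by rewrite bigcup_set1 esum_set1.
Qed.

Lemma ge0_integral_bigcup_esum (D : set U) (F : U -> set T) (f : T -> \bar R) :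
  countable D -> (forall i, D i -> measurable (F i)) ->
  trivIset D F -> measurable_fun [set: T] f -> (forall x, 0 <= f x)%E ->
  (\int[mu]_(x in \bigcup_(i in D) F i) f x = \esum_(i in D) \int[mu]_(x in F i) f x)%E.
Proof.
move=> cD mF tF mf f0; have /countable_injP[g ginj] := cD.
rewrite (esum_split _ g); last by move=> i; exact: integral_ge0.
pose G k := \bigcup_(i in D `&` g @^-1` [set k]) F i.
have mG k : measurable (G k).
  by apply: countable_bigcup_measurable => [|i [Di _]]; [apply: sub_countable cD; exact: subset_card_le|exact: mF].
have -> : \bigcup_(i in D) F i = \bigcup_k G k.
  apply/seteqP; split=> [x [i Di Fix]|x [k _ [i [Di _] Fix]]]; last by exists i.
  by exists (g i) => //; exists i.
rewrite ge0_integral_bigcup//; last 2 first.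
- exact: measurable_funS mf.
- apply/trivIsetP => i j _ _ ij; apply/seteqP; split=> // x [[a [Da ga] Fa] [b [Db gb] Fb]].
  move: ij; rewrite -ga -gb; apply/negP; rewrite negbK; apply/eqP; congr g.
  by apply: (tF _ _ Da Db); exists x.
apply: eq_eseriesr => k _.
rewrite /G; have [->|[i0 _ ->]] := cover_split ginj k.
  by rewrite bigcup_set0 integral_set0 esum_set0.
by rewrite bigcup_set1 esum_set1//; exact: integral_ge0.
Qed.

Lemma measure_bigcup_esum (D : set U) (F : U -> set T) :
  countable D -> (forall i, D i -> measurable (F i)) -> trivIset D F ->
  (mu (\bigcup_(i in D) F i) = \esum_(i in D) mu (F i))%E.
Proof.
move=> cD mF tF; have mFD := countable_bigcup_measurable cD mF.
transitivity (\int[mu]_(x in \bigcup_(i in D) F i) 1)%E.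
  by rewrite integral_cst// mul1e.
rewrite (ge0_integral_bigcup_esum (f := fun=> 1%E))//.
by apply: eq_esum => i Di; rewrite integral_cst ?mul1e//; exact: mF.
Qed.

End CountableUnions.

(** Choosing for each nonzero term a dominating index [v] is injective, since [L v] holds for at
    most one nonzero term. Its main use is at a fixed point, with [V] a set of layers of disjoint
    cubes: a sum over cubes becomes a sum over layers. *)
Lemma esum_countable_le (R : realType) (U V : choiceType) (S : set U)
    (phi : U -> \bar R) (psi : V -> \bar R) (L : V -> set U) :
  (forall i, S i -> 0 <= phi i)%E -> (forall v, 0 <= psi v)%E ->
  (forall i, S i -> phi i != 0%E -> exists2 v, L v i & (phi i <= psi v)%E) ->
  (forall v i j, S i -> S j -> phi i != 0%E -> phi j != 0%E -> L v i -> L v j -> i = j) ->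
  (\esum_(i in S) phi i <= \esum_(v in [set: V]) psi v)%E.
Proof.
move=> phi0 psi0 ex uniq.
pose S' := S `&` [set i | phi i != 0%E].
have -> : (\esum_(i in S) phi i = \esum_(i in S') phi i)%E.
  rewrite esum_mkcondr; apply: eq_esum => i Si; case: ifPn => //.
  by rewrite notin_setE/= => /negP; rewrite negbK => /eqP.
have [S'0|/set0P[i0 S'i0]] := eqVneq S' set0.
  by rewrite S'0 esum_set0 esum_ge0.
have [v0 _ _] := ex _ S'i0.1 S'i0.2.
have /choice[g gP] i : exists v, S' i -> L v i /\ (phi i <= psi v)%E.
  have [[Si pi0]|nS] := pselect (S' i); last by exists v0.
  by have [v] := ex _ Si pi0; exists v.
apply: (@le_trans _ _ (\esum_(i in S') psi (g i))%E).
  by apply: le_esum => i /gP[].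
rewrite -(@esum_image _ _ _ S' g psi); last first.
  move=> i j; rewrite !inE => S'i S'j gij.
  have [Li _] := gP _ S'i; have [Lj _] := gP _ S'j.
  by apply: (uniq (g i)); rewrite ?gij //; [case: S'i|case: S'j|case: S'i|case: S'j|rewrite -gij].
by rewrite esum_mkcond; apply: le_esum => v _; case: ifPn.
Qed.

Lemma esumZl (R : realType) (U : choiceType) (S : set U) (c : R) (a : U -> \bar R) :
  0 <= c -> (forall i, 0 <= a i)%E ->
  (\esum_(i in S) (c%:E * a i) = c%:E * \esum_(i in S) a i)%E.
Proof.
move=> c0 a0; rewrite /esum -ereal_supZl//; last first.
  by apply/set0P; exists 0%E; exists set0; [exact: fsets_set0|rewrite fsbig_set0].
congr ereal_sup; apply/seteqP; split=> [x [A SA <-]|x [_ [A SA <-] <-]].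
  by exists (\sum_(i \in A) a i)%E; [exists A|rewrite ge0_mule_fsumr].
by exists A => //; rewrite ge0_mule_fsumr.
Qed.

(** * Cubes and dyadic grids *)

Section LebesgueRn.
Context {R : realType}.

Definition box (n : nat) (a b : Rn R n) : set (Rn R n) :=
  [set x | forall i, (tnth a i : R) <= tnth x i < (tnth b i : R)].

Lemma measurable_box n (a b : Rn R n) : measurable (box a b).
Proof.
rewrite (_ : box a b = \bigcap_(i in [set: 'I_n]) ((@tnth _ _)^~ i) @^-1` `[(tnth a i : R), (tnth b i : R)[); last first.
  apply/seteqP; split=> x /= xab i; first by move=> _ /=; rewrite in_itv/=; exact: xab.
  by have := xab i Logic.I; rewrite /= in_itv.
apply: fin_bigcap_measurable => [|i _]; first exact: finite_finset.
by rewrite -[X in measurable X]setTI; apply: (measurable_tnth i) => //; exact: measurable_itv.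
Qed.

(** Induction on the dimension: [tuple_cons] pulls a box back to the product of an interval and a
    box. In dimension 0 the measure is a Dirac mass and the empty product is 1. *)
Lemma lebesgue_box n (a b : Rn R n) : (forall i, (tnth a i : R) <= tnth b i) ->
  lebesgue_Rn R n (box a b) = (\prod_(i < n) ((tnth b i : R) - tnth a i))%:E.
Proof.
elim: n a b => [a b _|n IH a b ab].
  rewrite big_ord0/= diracE mem_set//=.
  by case.
rewrite [LHS]/= /lebesgue_step /pushforward.
pose a' : Rn R n := [tuple of behead a]; pose b' : Rn R n := [tuple of behead b].
have ta i : tnth a' i = tnth a (lift ord0 i) by rewrite tnth_behead; congr tnth; apply/val_inj; rewrite /= inordK// ltnS.
have tb i : tnth b' i = tnth b (lift ord0 i) by rewrite tnth_behead; congr tnth; apply/val_inj; rewrite /= inordK// ltnS.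
rewrite (_ : _ @^-1` _ = `[(tnth a ord0 : R), (tnth b ord0 : R)[%classic `*` box a' b').
  have mI : measurable (`[(tnth a ord0 : R), (tnth b ord0 : R)[%classic : set (measurableTypeR R)) by exact: measurable_itv.
  rewrite (product_measure1E _ _ mI (measurable_box a' b')).
  rewrite [X in (X * _)%E](_ : _ = lebesgue_measure `[(tnth a ord0 : R), (tnth b ord0 : R)[%classic)//.
  rewrite lebesgue_measure_itv/= IH; last by move=> i; rewrite ta tb.
  rewrite big_ord_recl/= EFinM; congr (_ * _)%E; last by congr (_%:E); apply: eq_bigr => i _; rewrite ta tb.
  rewrite lte_fin; case: ltP => // ba; have /eqP -> : tnth a ord0 == tnth b ord0 :> R by rewrite eq_le ab ba.
  by rewrite subrr.
apply/seteqP; split=> [[z x]/= H|[z x] /= [Hz Hx] i].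
  split; first by have := H ord0; rewrite /tuple_cons /= in_itv.
  by move=> i; have := H (lift ord0 i); rewrite -ta -tb /tuple_cons tnthS.
have [->|i0] := eqVneq i ord0; first by move: Hz; rewrite /= in_itv.
have [j ->] : exists j, i = lift ord0 j.
  by case: (unliftP ord0 i) => [j ->|i00]; [exists j|rewrite i00 eqxx in i0].
by have := Hx j; rewrite ta tb /tuple_cons tnthS.
Qed.

Context {n : nat}.
Local Notation mu := (lebesgue_Rn R n).

Lemma cube_setE (Q : cube R n) :
  cube_set Q = box (corner Q) [tuple (tnth (corner Q) i : R) + side Q | i < n].
Proof. by apply/seteqP; split=> x /= + i => /(_ i); rewrite tnth_mktuple. Qed.

Lemma side_gt0 (Q : cube R n) : 0 < side Q.
Proof. exact: (valP Q). Qed.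

Lemma measurable_cube (Q : cube R n) : measurable (cube_set Q).
Proof. by rewrite cube_setE; exact: measurable_box. Qed.

Lemma lebesgue_cube (Q : cube R n) : mu (cube_set Q) = (side Q ^+ n)%:E.
Proof.
rewrite cube_setE lebesgue_box => [|i]; last first.
  by rewrite tnth_mktuple lerDl ltW// side_gt0.
rewrite (eq_bigr (fun=> side Q)); last by move=> i _; rewrite tnth_mktuple addrAC subrr add0r.
by rewrite prodr_const card_ord.
Qed.

Lemma measurable_eball (x : Rn R n) (r : R) : measurable (eball x r).
Proof.
pose f (y : Rn R n) : R := Num.sqrt (\sum_(i < n) (tnth y i - tnth x i) ^+ 2).
have mf : measurable_fun [set: Rn R n] f.
  apply: (@measurableT_comp _ _ _ _ _ _ (@Num.sqrt R)); first exact: (continuous_measurable_fun (@sqrt_continuous R)).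
  apply: (@measurable_sum _ _ _ _ _ _ (fun i (y : Rn R n) => (tnth y i - tnth x i) ^+ 2)) => i.
  apply: measurable_funX; apply: measurable_funB; first exact: measurable_tnth.
  exact: measurable_cst.
rewrite (_ : eball x r = f @^-1` `]-oo, r[); last by apply/seteqP; split=> y /=; rewrite in_itv.
by rewrite -[X in measurable X]setTI; apply: mf => //; exact: measurable_itv.
Qed.

Lemma eball_coord (x y : Rn R n) (r : R) i : eball x r y -> `|(tnth y i : R) - tnth x i| < r.
Proof.
rewrite /eball/= => /(le_lt_trans _); apply.
rewrite -sqrtr_sqr ler_sqrt ?sumr_ge0// => [|j _]; last exact: sqr_ge0.
by rewrite (bigD1 i)//= lerDl sumr_ge0// => j _; exact: sqr_ge0.
Qed.

(** The Euclidean norm is at most [sqrt n] times the sup norm; the cruder factor [n + 1] makes the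
    inequality strict. *)
Lemma coord_eball (x y : Rn R n) (r : R) : 0 < r ->
  (forall i, `|(tnth y i : R) - tnth x i| <= r) -> eball x (n.+1%:R * r) y.
Proof.
move=> r0 H; rewrite /eball/=.
have nr0 : 0 <= n.+1%:R * r by rewrite mulr_ge0// ltW.
rewrite -(ger0_norm nr0) -sqrtr_sqr ltr_sqrt; last by rewrite exprn_gt0// mulr_gt0.
apply: (@le_lt_trans _ _ (\sum_(i < n) r ^+ 2)).
  apply: ler_sum => i _; rewrite -real_normK ?num_real// lerXn2r// ?nnegrE//; first exact: ltW.
rewrite sumr_const card_ord -[_ ^+ 2 *+ n]mulr_natl exprMn ltr_pM2r ?exprn_gt0//.
by rewrite -natrX ltr_nat -mulnn; lia.
Qed.

Lemma cube_around_subproof (x : Rn R n) (r : {posnum R}) :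
  0 < ([tuple (tnth x i : R) - r%:num | i < n] : Rn R n, 2 * r%:num).2.
Proof. by rewrite /= mulr_gt0. Qed.

Definition cube_around (x : Rn R n) (r : {posnum R}) : cube R n :=
  exist _ ([tuple (tnth x i : R) - r%:num | i < n], 2 * r%:num) (cube_around_subproof x r).

Lemma cube_aroundP (x y : Rn R n) (r : {posnum R}) :
  (forall i, `|(tnth y i : R) - tnth x i| < r%:num) -> cube_set (cube_around x r) y.
Proof.
move=> H i; rewrite /cube_around /corner /side/= tnth_mktuple.
have := H i; rewrite ltr_norml => /andP[h1 h2]; apply/andP; split; lra.
Qed.

Lemma lebesgue_supball_le (x : Rn R n) (r : R) (A : set (Rn R n)) : 0 < r -> measurable A ->
  (forall y i, A y -> `|(tnth y i : R) - tnth x i| < r) -> (mu A <= ((2 * r) ^+ n)%:E)%E.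
Proof.
move=> r0 mA H; rewrite -[in leRHS](_ : side (cube_around x (PosNum r0)) = 2 * r)// -lebesgue_cube.
apply: le_measure; rewrite ?inE//; first exact: measurable_cube.
by move=> y Ay; apply: cube_aroundP => i; exact: H.
Qed.

Lemma cube_coord (Q : cube R n) x y i : cube_set Q x -> cube_set Q y ->
  `|(tnth x i : R) - tnth y i| < side Q.
Proof. by move=> /(_ i)/andP[? ?] /(_ i)/andP[? ?]; rewrite ltr_norml; apply/andP; split; lra. Qed.

Lemma corner_in (Q : cube R n) : cube_set Q (corner Q).
Proof. by move=> i; rewrite lexx ltrDl side_gt0. Qed.

End LebesgueRn.

Section Grids.
Context {R : realType} {n : nat}.
Hypothesis n_gt0 : (0 < n)%N.
Local Notation mu := (lebesgue_Rn R n).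
Implicit Types (F G : set (cube R n)) (P Q : cube R n).

(** What the proof retains of a dyadic lattice. Unlike the lattice axioms it passes to subfamilies,
    and it also holds for the dyadic subcubes of a single cube. *)
Definition grid F := forall Q Q', F Q -> F Q' ->
  exists P, dyadic_subcubes P Q /\ dyadic_subcubes P Q'.

Lemma grid_sub F G : F `<=` G -> grid G -> grid F.
Proof. by move=> FG gG Q Q' /FG GQ /FG GQ'; exact: gG. Qed.

Lemma grid_lattice D : dyadic_lattice D -> grid D.
Proof. by move=> [_ h _] Q Q' DQ DQ'; have [P [_ ? ?]] := h _ _ DQ DQ'; exists P. Qed.

Lemma grid_dyadic P : grid (dyadic_subcubes P).
Proof. by move=> Q Q' PQ PQ'; exists P. Qed.

Lemma cube_eqP Q Q' : side Q = side Q' ->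
  (forall i, tnth (corner Q) i = tnth (corner Q') i :> R) -> Q = Q'.
Proof.
move=> sQ cQ; apply: val_inj; move: sQ cQ; rewrite /side /corner.
case: (val Q) (val Q') => [x r] [y s] /= -> h; congr pair.
exact: eq_from_tnth.
Qed.

Lemma cube_sub_side Q Q' : cube_set Q `<=` cube_set Q' -> side Q <= side Q'.
Proof.
move=> QQ'; have : (mu (cube_set Q) <= mu (cube_set Q'))%E.
  by apply: le_measure; rewrite ?inE//; exact: measurable_cube.
by rewrite !lebesgue_cube lee_fin ler_pXn2r// nnegrE ltW// side_gt0.
Qed.

Lemma cube_set_inj Q Q' : cube_set Q = cube_set Q' -> Q = Q'.
Proof.
move=> QQ'; apply: cube_eqP.
  by apply/eqP; rewrite eq_le !cube_sub_side// QQ'.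
move=> i; have := corner_in Q; rewrite QQ' => /(_ i)/andP[h _].
have := corner_in Q'; rewrite -QQ' => /(_ i)/andP[h' _].
by apply/eqP; rewrite eq_le h h'.
Qed.

Lemma dyadic_side P Q : dyadic_subcubes P Q -> side Q <= side P.
Proof.
move=> [k [a [_ -> _]]]; rewrite ler_pdivrMr ?exprn_gt0// ler_peMr ?(ltW (side_gt0 _))//.
by rewrite exprn_ege1// ler1n.
Qed.

Lemma dyadic_sub P Q : dyadic_subcubes P Q -> cube_set Q `<=` cube_set P.
Proof.
move=> [k [a [ak sQ cQ]]] x Qx i; have := Qx i; rewrite cQ sQ => /andP[h1 h2].
have s0 : 0 < side P / 2 ^+ k by rewrite divr_gt0 ?side_gt0 ?exprn_gt0.
have a0 : 0 <= (a i)%:R * (side P / 2 ^+ k) by rewrite mulr_ge0// ltW.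
apply/andP; split; first by lra.
apply: (lt_le_trans h2); rewrite -addrA lerD2l -{2}[_ / _]mul1r -mulrDl.
rewrite mulrCA ler_piMr ?(ltW (side_gt0 _))// ler_pdivrMr ?exprn_gt0// mul1r.
by rewrite natr1 -natrX ler_nat.
Qed.

(** In units of [side Q], the corners relative to that of [P] are integers and [Q'] has side
    [2 ^ (k - k')]. A common point gives strict inequalities between integers, which sharpen by one
    to the inclusion. *)
Lemma dyadic_nested P Q Q' x : dyadic_subcubes P Q -> dyadic_subcubes P Q' ->
  cube_set Q x -> cube_set Q' x -> side Q <= side Q' -> cube_set Q `<=` cube_set Q'.
Proof.
move=> [k [a [_ sQ cQ]]] [k' [a' [_ sQ' cQ']]] Qx Q'x.
rewrite sQ sQ' ler_pM2l ?side_gt0// lef_pV2 ?posrE ?exprn_gt0//.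
rewrite ler_eXn2l ?ltr1n// => kk'.
have e : side Q' = side Q * 2 ^+ (k - k').
  by rewrite sQ sQ' -mulrA; congr (_ * _); rewrite exprB// ?unitfE// mulrA mulVf ?mul1r// expf_neq0.
have s0 : 0 < side Q := side_gt0 Q.
move=> y Qy i; have := Qx i; have := Q'x i; have := Qy i.
rewrite cQ cQ' e => /andP[y1 y2] /andP[x1 x2] /andP[x3 x4].
set c := (tnth (corner P) i : R) in y1 y2 x1 x2 x3 x4 *.
set s := side Q in s0 e y1 y2 x1 x2 x3 x4 *; set d := (k - k')%N in e x1 x2 *.
have h1 : (a' i * 2 ^ d < (a i).+1)%N.
  rewrite -(ltr_nat R) natrM natrX -[(a i).+1%:R]natr1 -(ltr_pM2r s0).
  by rewrite -mulrA [2 ^+ d * s]mulrC mulrDl mul1r; lra.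
have h2 : (a i < (a' i).+1 * 2 ^ d)%N.
  rewrite -(ltr_nat R) natrM natrX -[(a' i).+1%:R]natr1 -(ltr_pM2r s0).
  by rewrite -mulrA [2 ^+ d * s]mulrC mulrDl mul1r; lra.
have h3 : (a' i)%:R * (s * 2 ^+ d) <= (a i)%:R * s.
  by rewrite [s * _]mulrC mulrA ler_pM2r// -natrX -natrM ler_nat -ltnS.
have h4 : (a i)%:R * s + s <= (a' i)%:R * (s * 2 ^+ d) + s * 2 ^+ d.
  have -> : (a i)%:R * s + s = (a i).+1%:R * s by rewrite -natr1 mulrDl mul1r.
  have -> : (a' i)%:R * (s * 2 ^+ d) + s * 2 ^+ d = ((a' i).+1 * 2 ^ d)%:R * s.
    by rewrite natrM natrX -[(a' i).+1%:R]natr1; ring.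
  by rewrite ler_pM2r// ler_nat.
by apply/andP; split; lra.
Qed.

Lemma grid_nested F Q Q' x : grid F -> F Q -> F Q' ->
  cube_set Q x -> cube_set Q' x -> side Q <= side Q' -> cube_set Q `<=` cube_set Q'.
Proof. by move=> gF FQ FQ'; have [P [PQ PQ']] := gF _ _ FQ FQ'; exact: dyadic_nested PQ PQ'. Qed.

Lemma grid_side F Q Q' : grid F -> F Q -> F Q' -> side Q <= side Q' ->
  exists k, side Q' = side Q * 2 ^+ k.
Proof.
move=> gF FQ FQ'; have [P [[k [a [_ sQ _]]] [k' [a' [_ sQ' _]]]]] := gF _ _ FQ FQ'.
rewrite sQ sQ' ler_pM2l ?side_gt0// lef_pV2 ?posrE ?exprn_gt0//.
rewrite ler_eXn2l ?ltr1n// => kk'; exists (k - k')%N.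
by rewrite -mulrA; congr (_ * _); rewrite exprB// ?unitfE// mulrA mulVf ?mul1r// expf_neq0.
Qed.

(** Relative to a fixed [Q0], a cube is determined by the level and offset of [Q0] in a common
    ancestor [P] together with its own level and offset there, since [P] can be recovered from the
    first two. *)
Lemma grid_countable F : grid F -> countable F.
Proof.
move=> gF; have [->|/set0P[Q0 FQ0]] := eqVneq F set0; first exact: countable0.
pose A := (nat * {ffun 'I_n -> nat} * nat * {ffun 'I_n -> nat})%type.
pose s (z : A) := side Q0 * 2 ^+ z.1.1.1 / 2 ^+ z.1.2.
have s0 z : 0 < s z by rewrite /s !(mulr_gt0, invr_gt0, exprn_gt0, side_gt0).
pose f (z : A) : cube R n := exist _ (
  [tuple ((tnth (corner Q0) i : R) - (z.1.1.2 i)%:R * side Q0 + (z.2 i)%:R * s z) | i < n] : Rn R n, s z) (s0 z).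
have : countable (f @` [set: A]).
  by apply: card_le_trans (card_image_le f _) _; exact: countableP.
apply: sub_countable; apply: subset_card_le => Q FQ.
have [P [[k0 [a0 [_ s1 c1]]] [k [a [_ s2 c2]]]]] := gF _ _ FQ0 FQ.
exists (k0, finfun a0, k, finfun a) => //.
have ss : side Q = s (k0, finfun a0, k, finfun a).
  by rewrite /s/= s2 s1 divfK// expf_neq0.
apply: cube_eqP; first by rewrite ss.
by move=> i; rewrite [X in tnth X]/corner/= tnth_mktuple -ss /= !ffunE c2 c1 addrK.
Qed.

Definition maxcubes F : set (cube R n) :=
  [set Q | F Q /\ forall Q', F Q' -> cube_set Q `<=` cube_set Q' -> Q' = Q].

Lemma maxcubes_sub F : maxcubes F `<=` F. Proof. by move=> Q []. Qed.

Lemma maxcubes_eq F Q Q' x : grid F -> maxcubes F Q -> maxcubes F Q' ->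
  cube_set Q x -> cube_set Q' x -> Q = Q'.
Proof.
move=> gF [FQ mQ] [FQ' mQ'] Qx Q'x; have [QQ'|/ltW Q'Q] := leP (side Q) (side Q').
  by apply/esym/mQ => //; apply: grid_nested gF _ _ Qx Q'x _.
by apply/mQ' => //; apply: grid_nested gF _ _ Q'x Qx _.
Qed.

Lemma trivIset_maxcubes F : grid F -> trivIset (maxcubes F) (@cube_set R n).
Proof. by move=> gF Q Q' mQ mQ' [x [Qx Q'x]]; exact: maxcubes_eq gF mQ mQ' Qx Q'x. Qed.

(** A cube of the grid containing [Q] has side [side Q * 2 ^ k], and the bound [M] on the sides
    bounds [k]; the largest [k] gives a maximal cube. *)
Lemma maxcubes_ex F Q (M : R) : grid F -> (forall Q', F Q' -> side Q' <= M) -> F Q ->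
  exists2 Q', maxcubes F Q' & cube_set Q `<=` cube_set Q'.
Proof.
move=> gF FM FQ.
pose p k := `[< exists Q', [/\ F Q', cube_set Q `<=` cube_set Q' & side Q' = side Q * 2 ^+ k] >].
have exp : exists k, p k by exists 0%N; apply/asboolP; exists Q; split=> //; rewrite expr0 mulr1.
have bnd : exists K, forall k, p k -> (k <= K)%N.
  exists (Num.bound (M / side Q)) => k /asboolP[Q' [/FM FQ' _ sQ']].
  have : 2 ^+ k <= M / side Q by rewrite ler_pdivlMr ?side_gt0// mulrC -sQ'.
  move=> h; have : (k%:R : R) <= M / side Q by apply: le_trans h; rewrite -natrX ler_nat ltnW// ltn_expl.
  have M0 : 0 <= M / side Q by apply: le_trans h; rewrite exprn_ge0.
  move=> /le_lt_trans /(_ (archi_boundP M0)); rewrite ltr_nat; exact: ltnW.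
have [K bK] := bnd.
have [k /asboolP[Q' [FQ' QQ' sQ']] kmax] := ex_maxnP exp bK.
exists Q' => //; split=> // Q'' FQ'' Q'Q''.
apply: cube_set_inj; apply/seteqP; split => //.
have cQ := corner_in Q.
have [k'' sQ''] : exists k'', side Q'' = side Q * 2 ^+ k''.
  by apply: (grid_side gF) => //; apply: cube_sub_side; exact: subset_trans Q'Q''.
have k''k : (k'' <= k)%N.
  by apply: kmax; apply/asboolP; exists Q''; split=> //; exact: subset_trans Q'Q''.
apply: (grid_nested gF FQ'' FQ' (x := corner Q)); [by apply/Q'Q''/QQ'|exact: QQ'|].
by rewrite sQ'' sQ' ler_pM2l ?side_gt0// ler_weXn2l// ler1n.
Qed.

Lemma bigcup_maxcubes F (M : R) : grid F -> (forall Q', F Q' -> side Q' <= M) ->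
  \bigcup_(Q in maxcubes F) cube_set Q = \bigcup_(Q in F) cube_set Q.
Proof.
move=> gF FM; apply/seteqP; split=> [x [Q [FQ _] Qx]|x [Q FQ Qx]]; first by exists Q.
by have [Q' mQ' QQ'] := maxcubes_ex gF FM FQ; exists Q' => //; exact: QQ'.
Qed.

Lemma countable_maxcubes F : grid F -> countable (maxcubes F).
Proof. by move=> gF; apply: grid_countable; apply: grid_sub gF; exact: maxcubes_sub. Qed.

Lemma measurable_bigcup_cubes F : grid F -> measurable (\bigcup_(Q in F) cube_set Q).
Proof. by move=> /grid_countable cF; apply: countable_bigcup_measurable => // Q _; exact: measurable_cube. Qed.

Lemma lebesgue_bigcup_maxcubes F (M : R) : grid F -> (forall Q', F Q' -> side Q' <= M) ->
  mu (\bigcup_(Q in F) cube_set Q) = (\esum_(Q in maxcubes F) mu (cube_set Q))%E.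
Proof.
move=> gF FM; rewrite -(bigcup_maxcubes gF FM) measure_bigcup_esum//.
- exact: countable_maxcubes.
- by move=> Q _; exact: measurable_cube.
- exact: trivIset_maxcubes.
Qed.

Lemma ge0_integral_bigcup_maxcubes F (M : R) (f : Rn R n -> \bar R) :
  grid F -> (forall Q', F Q' -> side Q' <= M) ->
  measurable_fun [set: Rn R n] f -> (forall x, 0 <= f x)%E ->
  (\int[mu]_(x in \bigcup_(Q in F) cube_set Q) f x =
   \esum_(Q in maxcubes F) \int[mu]_(x in cube_set Q) f x)%E.
Proof.
move=> gF FM mf f0; rewrite -(bigcup_maxcubes gF FM) ge0_integral_bigcup_esum//.
- exact: countable_maxcubes.
- by move=> Q _; exact: measurable_cube.
- exact: trivIset_maxcubes.
Qed.

End Grids.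

(** * Differentiation along dyadic cubes *)

Lemma measure_vanish d (T : measurableType d) (R : realType) (mu : {measure set T -> \bar R})
    (F : (set T)^nat) (e : R) : (mu (F 0%N) < +oo)%E -> (forall k, measurable (F k)) ->
  (forall k, F k.+1 `<=` F k) -> \bigcap_k F k = set0 -> 0 < e ->
  exists k, (mu (F k) <= e%:E)%E.
Proof.
move=> F0 mF ndF capF e0.
have nd : {homo F : k m / (k <= m)%N >-> (m <= k)%O}.
  apply: homo_leq => [?//|? ? ? h1 h2|k]; last exact/subsetPset/ndF.
  by apply: le_trans h2 h1.
have := @nonincreasing_cvg_mu _ _ _ mu F F0 mF _ nd.
rewrite capF measure0 => /(_ measurable0) h.
have [//|nex] := pselect (exists k, (mu (F k) <= e%:E)%E).
have : (e%:E <= lim (mu (F k) @[k --> \oo]))%E.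
  apply: lime_ge; first by apply/cvg_ex; exists 0%E.
  by near=> k; apply: ltW; rewrite ltNge; apply/negP => Fk; apply: nex; exists k.
by rewrite (cvg_lim _ h)// lee_fin leNgt e0.
Unshelve. all: by end_near. Qed.

Section Regularity.
Context {R : realType} {n : nat}.
Hypothesis n_gt0 : (0 < n)%N.
Local Notation mu := (lebesgue_Rn R n).
Variable P : cube R n.

(** These sets replace the open sets in the outer regularity below. They are the unions of dyadic
    subcubes of [P], to which arguments with maximal cubes apply directly. *)
Definition dyadic_open (O : set (Rn R n)) := forall x, O x ->
  exists Q, [/\ dyadic_subcubes P Q, cube_set Q x & cube_set Q `<=` O].

Lemma dyadic_openE O : dyadic_open O ->
  O = \bigcup_(Q in dyadic_subcubes P `&` [set Q | cube_set Q `<=` O]) cube_set Q.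
Proof.
move=> oO; apply/seteqP; split=> [x /oO[Q [PQ Qx QO]]|x [Q [_ QO] /QO]//].
by exists Q.
Qed.

Lemma measurable_dyadic_open O : dyadic_open O -> measurable O.
Proof.
move=> /dyadic_openE ->; apply: measurable_bigcup_cubes.
by apply: (grid_sub _ (@grid_dyadic _ _ P)) => Q [].
Qed.

Lemma dyadic_open_bigcup (I : Type) (O : I -> set (Rn R n)) :
  (forall i, dyadic_open (O i)) -> dyadic_open (\bigcup_i O i).
Proof.
move=> oO x [i _ /oO[Q [PQ Qx QO]]]; exists Q; split=> //.
by apply: subset_trans QO _ => y Oy; exists i.
Qed.

Lemma dyadic_openI O O' : dyadic_open O -> dyadic_open O' -> dyadic_open (O `&` O').
Proof.
move=> oO oO' x [/oO[Q [PQ Qx QO]] /oO'[Q' [PQ' Qx' QO']]].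
have [QQ'|/ltW Q'Q] := leP (side Q) (side Q').
- exists Q; split=> // y Qy; split; first exact: QO.
  by apply: QO'; exact: (dyadic_nested PQ PQ' Qx Qx' QQ').
- exists Q'; split=> // y Qy; split; last exact: QO'.
  by apply: QO; exact: (dyadic_nested PQ' PQ Qx' Qx Q'Q).
Qed.

Lemma dyadic_refl : dyadic_subcubes P P.
Proof. by exists 0%N, (fun=> 0%N); split=> // [|i]; rewrite ?expr0 ?divr1 // mul0r addr0. Qed.

Lemma dyadic_openT : dyadic_open (cube_set P).
Proof. by move=> x Px; exists P; split=> //; exact: dyadic_refl. Qed.

Lemma dyadic_level k x : cube_set P x ->
  exists Q, [/\ dyadic_subcubes P Q, cube_set Q x & side Q = side P / 2 ^+ k].
Proof.
move=> Px; pose s := side P / 2 ^+ k.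
have s0 : 0 < s by rewrite divr_gt0 ?side_gt0 ?exprn_gt0.
pose a i := Num.truncn (((tnth x i : R) - tnth (corner P) i) / s).
have aP i : (a i)%:R * s <= (tnth x i : R) - tnth (corner P) i < (a i)%:R * s + s.
  have /andP[Pi _] := Px i.
  have /truncn_itv/andP[h1 h2] : 0 <= ((tnth x i : R) - tnth (corner P) i) / s.
    by rewrite divr_ge0 ?subr_ge0// ltW.
  rewrite ler_pdivlMr in h1 => //; rewrite h1/=.
  by rewrite ltr_pdivrMr// -natr1 mulrDl mul1r in h2.
pose Q : cube R n := exist _ ([tuple (tnth (corner P) i : R) + (a i)%:R * s | i < n] : Rn R n, s) s0.
exists Q; split => //.
- exists k, a; split=> // i; last by rewrite /corner/= tnth_mktuple.
  rewrite -(ltr_nat R) natrX -(ltr_pM2r s0) [2 ^+ k * s]mulrC divfK ?expf_neq0//.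
  by have /andP[? ?] := aP i; have /andP[? ?] := Px i; lra.
- move=> i; rewrite /corner/side/= tnth_mktuple.
  by have /andP[? ?] := aP i; apply/andP; split; lra.
Qed.

Let muP_fin : (mu (cube_set P) < +oo)%E.
Proof. by rewrite lebesgue_cube ltry. Qed.

Definition outer_regular (A : set (Rn R n)) := measurable A /\ forall e : R, 0 < e ->
  exists O, [/\ dyadic_open O, A `&` cube_set P `<=` O & (mu (O `&` ~` A) <= e%:E)%E].

Lemma dyadic_open_regular A : measurable A -> dyadic_open (A `&` cube_set P) -> outer_regular A.
Proof.
move=> mA oA; split=> // e e0; exists (A `&` cube_set P); split=> //.
by rewrite setIAC setICr set0I measure0 lee_fin ltW.
Qed.

Lemma outer_regular_bigcup (A : (set (Rn R n))^nat) :
  (forall k, outer_regular (A k)) -> outer_regular (\bigcup_k A k).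
Proof.
move=> rA; split; first by apply: bigcupT_measurable => k; case: (rA k).
move=> e e0.
have h k : exists O, [/\ dyadic_open O, A k `&` cube_set P `<=` O & (mu (O `&` ~` A k) <= (e / (2 ^ k.+1)%:R)%:E)%E].
  by apply: (rA k).2; rewrite divr_gt0.
have [U UP] := choice h; exists (\bigcup_k U k); split.
- by apply: dyadic_open_bigcup => k; case: (UP k).
- by move=> x [[k _ Akx] Px]; exists k => //; have [_ + _] := UP k; apply.
apply: (@le_trans _ _ (\sum_(0 <= k <oo) mu (U k `&` ~` A k))%E).
  apply: measure_sigma_subadditive.
  - move=> k; apply: measurableI; last by apply: measurableC; case: (rA k).
    by apply: measurable_dyadic_open; case: (UP k).
  - apply: measurableI; last by apply: measurableC; apply: bigcupT_measurable => k; case: (rA k).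
    by apply: bigcupT_measurable => k; apply: measurable_dyadic_open; case: (UP k).
  - by move=> x [[k _ Okx] nA]; exists k => //; split=> // Akx; apply: nA; exists k.
apply: (@le_trans _ _ (\sum_(0 <= k <oo) (e / (2 ^ k.+1)%:R)%:E)%E).
  by apply: lee_nneseries => // k _; case: (UP k).
have := @epsilon_trick R (fun=> 0%E) e xpredT (fun=> lexx _) (ltW e0).
rewrite (eq_eseriesr (g := fun k => (e / (2 ^ k.+1)%:R)%:E)) => [|k _]; last by rewrite add0e.
by rewrite [X in (_ <= X + _)%E -> _]eseries0// add0e.
Qed.

(** The countable intersection is replaced by a finite one: the points of [P] lying in some [A j],
    but in none of the first [k], form sets decreasing to the empty set, hence of small measure for
    some [k] because [P] has finite measure. *)
Lemma outer_regular_setC_bigcup (A : (set (Rn R n))^nat) :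
  (forall k, measurable (A k)) ->
  (forall k, outer_regular (~` A k)) -> outer_regular (~` \bigcup_k A k).
Proof.
move=> mA rA; split; first by apply: measurableC; exact: bigcupT_measurable.
move=> e e0; have e20 : 0 < e / 2 by rewrite divr_gt0.
have h k : exists O, [/\ dyadic_open O, ~` A k `&` cube_set P `<=` O & (mu (O `&` A k) <= (e / 2 / (2 ^ k.+1)%:R)%:E)%E].
  have [|U [oU AU muU]] := (rA k).2 (e / 2 / (2 ^ k.+1)%:R); first by rewrite divr_gt0.
  by exists U; split=> //; rewrite -[A k]setCK.
have [U UP] := choice h.
pose B k := cube_set P `&` (\bigcup_j A j `\` \bigcup_(j in `I_k) A j).
have mB k : measurable (B k).
  apply: measurableI; first exact: measurable_cube.
  by apply: measurableD; [exact: bigcupT_measurable|exact: bigcup_measurable].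
have [|||k Bk] := @measure_vanish _ _ _ mu B (e / 2) _ mB _ _ e20.
- apply: le_lt_trans muP_fin; apply: le_measure; rewrite ?inE//; [exact: measurable_cube|by move=> x []].
- by move=> k x [Px [Ax nA]]; split=> //; split=> // -[j jk Ajx]; apply: nA; exists j => //=; apply: ltnW.
- apply/seteqP; split=> // x BI; have [_ [[j _ Ajx] _]] := BI 0%N Logic.I.
  by have [_ [_]] := BI j.+1 Logic.I; apply; exists j => /=.
pose V := cube_set P `&` \bigcap_(j in `I_k) U j.
have oV : dyadic_open V.
  rewrite /V; elim: (k) => [|k' IH]; first by rewrite II0 bigcap_set0 setIT; exact: dyadic_openT.
  rewrite IIS bigcap_setU bigcap_set1 setIA; apply: dyadic_openI => //; by case: (UP k').
exists V; split=> // [x [nA Px]|].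
  split=> // j _; have [_ + _] := UP j; apply; split=> // Ajx.
  by apply: nA; exists j.
rewrite setCK.
have mOA j : measurable (U j `&` A j) by apply: measurableI => //; apply: measurable_dyadic_open; case: (UP j).
apply: (@le_trans _ _ (mu (B k) + mu (\bigcup_j (U j `&` A j)))%E).
  apply: (@le_trans _ _ (mu (B k `|` \bigcup_j (U j `&` A j)))).
    apply: le_measure; rewrite ?inE.
    - by apply: measurableI; [exact: measurable_dyadic_open|exact: bigcupT_measurable].
    - by apply: measurableU => //; exact: bigcupT_measurable.
    move=> x [[Px Ox] [j _ Ajx]].
    have [[i ik Aix]|nA] := pselect ((\bigcup_(j in `I_k) A j) x); last by left; split=> //; split=> //; exists j.
    by right; exists i => //; split=> //; exact: Ox.
  by apply: measureU2 => //; exact: bigcupT_measurable.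
rewrite [e]splitr EFinD; apply: leeD => //.
apply: (@le_trans _ _ (\sum_(0 <= k <oo) mu (U k `&` A k))%E).
  by apply: measure_sigma_subadditive => //; exact: bigcupT_measurable.
apply: (@le_trans _ _ (\sum_(0 <= k <oo) (e / 2 / (2 ^ k.+1)%:R)%:E)%E).
  by apply: lee_nneseries => // j _; case: (UP j).
have := @epsilon_trick R (fun=> 0%E) (e / 2) xpredT (fun=> lexx _) (ltW e20).
rewrite (eq_eseriesr (g := fun k => (e / 2 / (2 ^ k.+1)%:R)%:E)) => [|j _]; last by rewrite add0e.
by rewrite [X in (_ <= X + _)%E -> _]eseries0// add0e.
Qed.

(** Within [P] the open half-space is itself a union of dyadic cubes. Its complement is enlarged to
    [c - 1 / (k + 1) < x_i], and the strips added inside [P] decrease to the empty set. *)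
Lemma outer_regular_halfspace (i : 'I_n) (c : R) :
  let H := [set x : Rn R n | (tnth x i : R) < c] in outer_regular H /\ outer_regular (~` H).
Proof.
move=> H.
have mH c' : measurable [set x : Rn R n | (tnth x i : R) < c'].
  rewrite (_ : mkset _ = ((@tnth _ _)^~ i) @^-1` `]-oo, c'[); last by apply/seteqP; split=> x /=; rewrite in_itv.
  by rewrite -[X in measurable X]setTI; apply: (measurable_tnth i) => //; exact: measurable_itv.
have mH' c' : measurable [set x : Rn R n | c' < (tnth x i : R)].
  rewrite (_ : mkset _ = ((@tnth _ _)^~ i) @^-1` `]c', +oo[); last by apply/seteqP; split=> x /=; rewrite in_itv/= andbT.
  by rewrite -[X in measurable X]setTI; apply: (measurable_tnth i) => //; exact: measurable_itv.
have small e : 0 < e -> exists k, side P / 2 ^+ k < e.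
  move=> e0; exists (Num.bound (side P / e)); rewrite ltr_pdivrMr ?exprn_gt0// mulrC -ltr_pdivrMr//.
  apply: (lt_le_trans (archi_boundP _)); first by rewrite divr_ge0// ltW// side_gt0.
  by rewrite -natrX ler_nat ltnW// ltn_expl.
split.
  apply: dyadic_open_regular; first exact: mH.
  move=> x [/= Hx Px]; have [k kx] := small (c - tnth x i) (eq_ind_r is_true Hx (subr_gt0 _ _)).
  have [Q [PQ Qx sQ]] := dyadic_level k Px; exists Q; split=> // y Qy; split; last exact: dyadic_sub PQ _ Qy.
  by have := cube_coord i Qy Qx; rewrite /H/= ltr_norml sQ => /andP[_ ?]; lra.
split; first by apply: measurableC; exact: mH.
move=> e e0.
pose F k := cube_set P `&` ([set x : Rn R n | c - k.+1%:R^-1 < (tnth x i : R)] `&` H).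
have mF k : measurable (F k) by apply: measurableI; [exact: measurable_cube|apply: measurableI; [exact: mH'|exact: mH]].
have [|||k Fk] := @measure_vanish _ _ _ mu F e _ mF _ _ e0.
- apply: le_lt_trans muP_fin; apply: le_measure; rewrite ?inE//; [exact: measurable_cube|by move=> x []].
- move=> k x [Px [/= h ?]]; split=> //; split=> //=; apply: le_lt_trans h.
  by rewrite lerD2l lerN2 lef_pV2 ?posrE// ler_nat.
- apply/seteqP; split=> // x FI; have [Px [_ /= Hx]] := FI 0%N Logic.I.
  pose k := Num.bound ((c - (tnth x i : R))^-1).
  have cx : 0 < c - tnth x i by rewrite subr_gt0.
  have [_ [/= h _]] := FI k Logic.I.
  have h' : (c - tnth x i)^-1 < k.+1%:R by apply: (lt_trans (archi_boundP _)); rewrite ?ltr_nat// invr_ge0 ltW.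
  have : k.+1%:R^-1 < c - tnth x i by rewrite -[ltRHS]invrK ltf_pV2 ?posrE ?invr_gt0.
  by move=> hh; have := ltrD h hh; rewrite subrK [_ + (c - _)]addrC subrK ltxx.
exists (cube_set P `&` [set x : Rn R n | c - k.+1%:R^-1 < (tnth x i : R)]); split.
- move=> x [Px /= cx].
  have [j jx] := small ((tnth x i : R) - (c - k.+1%:R^-1)) (eq_ind_r is_true cx (subr_gt0 _ _)).
  have [Q [PQ Qx sQ]] := dyadic_level j Px; exists Q; split=> // y Qy; split; first exact: dyadic_sub PQ _ Qy.
  have := cube_coord i Qy Qx; rewrite /= ltr_norml sQ => /andP[+ _]; move: jx.
  by set z := c - _; set w := side P / _ => ? ?; lra.
- move=> x [/= /negP]; rewrite -leNgt => cx Px; split=> //=; apply: lt_le_trans cx.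
  by rewrite ltrBlDr ltrDl invr_gt0.
- by rewrite setCK -setIA.
Qed.

Lemma measurable_outer_regular A : measurable A -> outer_regular A.
Proof.
(* Regularity is required of a set together with its complement, to have stability under
   complements; this class is a sigma-algebra containing the coordinate half-spaces, which
   generate. *)
pose G := [set A | outer_regular A /\ outer_regular (~` A)].
suff : @measurable _ (Rn R n) `<=` G by move=> h /h[].
have sG : sigma_algebra setT G.
  split.
  - split; first by apply: dyadic_open_regular => //; rewrite set0I => x [].
    by rewrite setC0; apply: dyadic_open_regular => //; rewrite setTI; exact: dyadic_openT.
  - by move=> B [rB rCB]; rewrite setTD; split=> //; rewrite setCK.
  - move=> B GB; split; first by apply: outer_regular_bigcup => k; case: (GB k).
    by apply: outer_regular_setC_bigcup => k; [case: (GB k) => -[]|case: (GB k)].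
apply: smallest_sub => //.
rewrite -bigcup_seq => B [i _ [C mC <-]]; rewrite setTI.
pose G1 := [set C : set (measurableTypeR R) | G (((@tnth n _)^~ i) @^-1` C)].
suff : @measurable _ (measurableTypeR R) `<=` G1 by apply.
rewrite (@RGenInftyO.measurableE R).
apply: smallest_sub.
  split.
  - by rewrite /G1/= preimage_set0; case: sG.
  - by move=> B' GB'; rewrite setTD /G1/= preimage_setC -setTD; case: sG => _ + _; exact.
  - by move=> B' GB'; rewrite /G1/= preimage_bigcup; case: sG => _ _; exact.
move=> _ [c ->]; rewrite /G1/G/=.
rewrite (_ : _ @^-1` _ = [set x : Rn R n | (tnth x i : R) < c]); last by apply/seteqP; split=> x /=; rewrite in_itv.
exact: outer_regular_halfspace.
Qed.

(* [W] is the union of the stopping cubes: averages are controlled only on the cubes not inside it. *)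
Lemma dyadic_differentiation (g : Rn R n -> R) (c : R) (W : set (Rn R n)) :
  measurable_fun [set: Rn R n] g -> measurable W -> 0 <= c ->
  (forall Q, dyadic_subcubes P Q -> ~ (cube_set Q `<=` W) ->
     (\int[mu]_(x in cube_set Q) `|(g x)%:E| <= c%:E * mu (cube_set Q))%E) ->
  mu (cube_set P `&` ~` W `&` [set x | c < `|g x|]) = 0%E.
Proof.
move=> mg mW c0 H.
have mgg (r : R) : measurable [set x : Rn R n | r < `|g x|].
  rewrite (_ : mkset _ = (Num.norm \o g) @^-1` `]r, +oo[); last by apply/seteqP; split=> x /=; rewrite in_itv/= andbT.
  by rewrite -[X in measurable X]setTI; apply: (measurableT_comp _ mg) => //; exact: measurable_itv.
have mPW : measurable (cube_set P `&` ~` W).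
  by apply: measurableI; [exact: measurable_cube|exact: measurableC].
have mag : measurable_fun [set: Rn R n] (fun x => `|(g x)%:E|%E).
  by apply: measurableT_comp => //; exact/measurable_EFinP.
(* The margin [d] provides a contradiction: covering the set by cubes whose averages are at most [c]
   will give [(c + d) mu E <= c (mu E + e)] for every [e > 0]. *)
suff null d : 0 < d -> mu (cube_set P `&` ~` W `&` [set x | c + d < `|g x|]) = 0%E.
  rewrite (_ : _ `&` _ = \bigcup_k (cube_set P `&` ~` W `&` [set x | c + k.+1%:R^-1 < `|g x|])).
    apply/eqP; rewrite eq_le measure_ge0 andbT.
    have := @measure_bigcup_le_esum _ _ _ mu nat [set: nat] (fun k => cube_set P `&` ~` W `&` [set x | c + k.+1%:R^-1 < `|g x|]).
    move=> /(_ (countableP _) (fun k _ => measurableI _ _ mPW (mgg _))) /le_trans; apply.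
    by rewrite esum1// => k _; apply: null; rewrite invr_gt0.
  apply/seteqP; split=> [x [Px /= cx]|x [k _ [Px /= cx]]]; last first.
    by split=> //=; apply: lt_trans cx; rewrite ltrDl invr_gt0.
  have gc : 0 < `|g x| - c by rewrite subr_gt0.
  exists (Num.bound ((`|g x| - c)^-1)) => //; split=> //=.
  rewrite -ltrBrDl -[ltRHS]invrK ltf_pV2 ?posrE ?invr_gt0//.
  by apply: (lt_trans (archi_boundP _)); rewrite ?ltr_nat// invr_ge0 ltW.
move=> d0; set E := _ `&` _.
have mE : measurable E by exact: measurableI.
have Efin : (mu E < +oo)%E.
  by apply: le_lt_trans muP_fin; apply: le_measure; rewrite ?inE//; [exact: measurable_cube|move=> x [[]]].
have main e : 0 < e -> ((c + d)%:E * mu E <= c%:E * (mu E + e%:E))%E.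
  move=> e0; have [_ /(_ e e0)[U [oU EU mU]]] := measurable_outer_regular mE.
  (* A point of [E] is outside [W], so no cube containing it is inside [W]: the averages over all
     cubes used for the covering are controlled. *)
  pose F := [set Q | [/\ dyadic_subcubes P Q, cube_set Q `<=` U & ~ (cube_set Q `<=` W)]].
  have gF : grid F by apply: (grid_sub _ (@grid_dyadic _ _ P)) => Q [].
  have FP Q : F Q -> side Q <= side P by case=> /dyadic_side.
  pose U' := \bigcup_(Q in F) cube_set Q.
  have mU' : measurable U' by exact: measurable_bigcup_cubes.
  have EU' : E `<=` U'.
    move=> x Ex; have [[Px nWx] _] := Ex.
    have [Q [PQ Qx QU]] := oU _ (EU _ (conj Ex Px)).
    by exists Q => //; split=> // QW; apply: nWx; exact: QW.
  apply: (@le_trans _ _ (\int[mu]_(x in U') `|(g x)%:E|)%E).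
    apply: (@le_trans _ _ (\int[mu]_(x in E) `|(g x)%:E|)%E).
      rewrite -integral_cst//; apply: ge0_le_integral => //.
      - by move=> x _; rewrite lee_fin addr_ge0// ltW.
      - exact: measurable_funS mag.
      - by move=> x [_ /= /ltW]; rewrite lee_fin.
    by apply: ge0_subset_integral => //; exact: measurable_funS mag.
  rewrite (ge0_integral_bigcup_maxcubes n_gt0 gF FP mag)//.
  apply: (@le_trans _ _ (\esum_(Q in maxcubes F) (c%:E * mu (cube_set Q)))%E).
    by apply: le_esum => Q [[PQ QU QW] _]; exact: H.
  rewrite esumZl//.
  rewrite -(lebesgue_bigcup_maxcubes n_gt0 gF FP) lee_wpmul2l ?lee_fin//.
  apply: (@le_trans _ _ (mu U)).
    apply: le_measure; rewrite ?inE//; first exact: measurable_dyadic_open oU.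
    by move=> x [Q [_ QU _] /QU].
  have mU2 := measurable_dyadic_open oU.
  rewrite (measureDI mu mU2 mE) addeC leeD//.
    by apply: le_measure; rewrite ?inE//; exact: measurableI.
have [m mE0] : exists m, mu E = m%:E by exists (fine (mu E)); rewrite fineK// ge0_fin_numE.
have m0 : 0 <= m by rewrite -lee_fin -mE0.
rewrite mE0; congr (_%:E); apply/eqP; rewrite eq_le m0 andbT leNgt; apply/negP => m_gt0.
(* With this value [c * e <= d * m / 2 < d * m]. *)
have e0 : 0 < d * m / (c + 1) / 2 by rewrite !divr_gt0 ?mulr_gt0// ltr_wpDl.
have := main _ e0; rewrite mE0 -EFinD -!EFinM lee_fin leNgt => /negP; apply.
rewrite mulrDl mulrDr ltrD2l.
have h : c * (d * m / (c + 1) / 2) = (c / (c + 1)) * (d * m / 2) by field; rewrite gt_eqF// ltr_wpDl.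
have dm : 0 < d * m by exact: mulr_gt0.
rewrite h; apply: (@le_lt_trans _ _ (1 * (d * m / 2))); last by lra.
by rewrite ler_wpM2r//; [rewrite divr_ge0// ltW|rewrite ler_pdivrMr ?mul1r ?lerDl// ltr_wpDl].
Qed.

End Regularity.

(** * The John-Nirenberg inequality *)

Section Series.
Context {R : realType}.

Lemma esum_ge_term (U : choiceType) (S : set U) (a : U -> \bar R) i :
  (forall i, 0 <= a i)%E -> S i -> (a i <= \esum_(j in S) a j)%E.
Proof.
move=> a0 Si; apply: esum_ge; exists [set i]; last by rewrite fsbig_set1.
by split; [exact: finite_set1|move=> _ ->].
Qed.

Lemma esum_geometric_le (c q : R) : 0 <= c -> 0 <= q < 1 ->
  (\esum_(j in [set: nat]) (c * q ^+ j)%:E <= (c / (1 - q))%:E)%E.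
Proof.
move=> c0 /andP[q0 q1]; have q1' : 0 < 1 - q by rewrite subr_gt0.
have cq j : (0 <= (c * q ^+ j)%:E)%E by rewrite lee_fin mulr_ge0// exprn_ge0.
rewrite -nneseries_esumT//; apply: lime_le; first exact: is_cvg_nneseries.
apply: nearW => k; rewrite sumEFin lee_fin big_mkord -mulr_sumr ler_wpM2l//.
have -> : \sum_(i < k) q ^+ i = (1 - q ^+ k) / (1 - q).
  have q1n : 1 - q != 0 by rewrite gt_eqF.
  elim: k => [|k IHk]; first by rewrite big_ord0 expr0 subrr mul0r.
  by rewrite big_ord_recr/= IHk exprSr; field.
by rewrite ler_pdivrMr// mulVf ?gt_eqF// gerBl exprn_ge0.
Qed.

(** Induction on [a]: [r ^ j] is split into two factors [sqrt r ^ j]. One absorbs the power [a] by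
    induction, the other a single factor [j + 1] by Bernoulli's inequality. *)
Lemma poly_le_exp (a : nat) (r : R) : 1 < r ->
  exists2 C : R, 0 < C & forall j, j.+1%:R ^+ a <= C * r ^+ j.
Proof.
elim: a r => [|a IH] r r1.
  exists 1 => // j; rewrite expr0 mul1r exprn_ege1// ltW//.
have r0 : 0 < r by apply: lt_trans r1.
have s1 : 1 < Num.sqrt r by rewrite -[ltLHS]sqrtr1 ltr_sqrt.
have [C C0 HC] := IH _ s1.
pose C1 : R := (Num.sqrt r - 1)^-1 + 1.
have C10 : 0 < C1 by rewrite addr_gt0// invr_gt0 subr_gt0.
exists (C1 * C); first exact: mulr_gt0.
move=> j; rewrite exprS.
have -> : C1 * C * r ^+ j = (C1 * Num.sqrt r ^+ j) * (C * Num.sqrt r ^+ j).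
  by rewrite mulrACA -expr2 -exprM mulnC exprM sqr_sqrtr// ltW.
apply: ler_pM => //.
have : 1 + j%:R * (Num.sqrt r - 1) <= Num.sqrt r ^+ j.
  elim: j => [|j IHj]; first by rewrite mul0r addr0.
  rewrite exprS -natr1.
  apply: (@le_trans _ _ (Num.sqrt r * (1 + j%:R * (Num.sqrt r - 1)))); last first.
    by rewrite ler_wpM2l// ltW// (lt_trans _ s1).
  have : 0 <= j%:R * (Num.sqrt r - 1) * (Num.sqrt r - 1) by rewrite !mulr_ge0// subr_ge0 ltW.
  lra.
move=> h; apply: (@le_trans _ _ (C1 * (1 + j%:R * (Num.sqrt r - 1)))); last by rewrite ler_pM2l.
rewrite /C1 mulrDl mul1r mulrDr mulr1 mulrCA mulVf ?subr_eq0 ?gt_eqF// mulr1 -natr1.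
have : 0 <= (Num.sqrt r - 1)^-1 by rewrite invr_ge0 subr_ge0 ltW.
have : 0 <= j%:R * (Num.sqrt r - 1) by rewrite mulr_ge0// subr_ge0 ltW.
lra.
Qed.

End Series.

Section JohnNirenberg.
Context {R : realType} {n : nat}.
Hypothesis n_gt0 : (0 < n)%N.
Local Notation mu := (lebesgue_Rn R n).
Variables (b : Rn R n -> R) (B : R).
Hypothesis mb : measurable_fun [set: Rn R n] b.
Hypothesis ib : forall Q : cube R n, mu.-integrable (cube_set Q) (EFin \o b).
Hypothesis B_gt0 : 0 < B.
Hypothesis bmoB : forall Q : cube R n, (average_abs Q (fun x => (b x - mean Q b)%R) <= B%:E)%E.

Lemma average_abs_le (Q : cube R n) f (c : R) : (average_abs Q f <= c%:E)%E <->
  (\int[mu]_(x in cube_set Q) `|(f x)%:E| <= c%:E * mu (cube_set Q))%E.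
Proof.
rewrite /average_abs lebesgue_cube/=.
have s0 : 0 < side Q ^+ n by rewrite exprn_gt0// side_gt0.
by rewrite lee_pdivrMl// muleC.
Qed.

Lemma mean_sub_le (Q : cube R n) (c : R) :
  (`|mean Q b - c|%:E * mu (cube_set Q) <= \int[mu]_(x in cube_set Q) `|(b x - c)%:E|)%E.
Proof.
have s0 : 0 < side Q ^+ n by rewrite exprn_gt0// side_gt0.
have mQ := measurable_cube Q.
have ic : mu.-integrable (cube_set Q) (EFin \o cst c).
  apply/integrableP; split; first by apply/measurable_EFinP; exact: measurable_cst.
  rewrite (_ : (fun x => _) = cst `|c%:E|%E)//; rewrite integral_cst//.
  by rewrite [X in (_ * X)%E](_ : _ = (side Q ^+ n)%:E) -?EFinM ?ltry//; exact: lebesgue_cube.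
have e : mean Q b - c = (side Q ^+ n)^-1 * \int[mu]_(x in cube_set Q) (b x - c).
  have cc : \int[mu]_(x in cube_set Q) c = c * side Q ^+ n.
    by rewrite Rintegral_cst//; congr (_ * _); have /(congr1 fine) := lebesgue_cube Q.
  by rewrite /mean RintegralB// cc lebesgue_cube/= mulrBr [c * _]mulrC mulKf ?gt_eqF.
have ibc : mu.-integrable (cube_set Q) (EFin \o (fun x => b x - c)).
  by have := integrableB mQ (ib Q) ic; apply: eq_integrable => // x _ /=; rewrite EFinB.
rewrite e normrM ger0_norm ?invr_ge0 ?(ltW s0)// lebesgue_cube -EFinM mulrAC mulVf ?gt_eqF// mul1r.
rewrite /Rintegral -[X in (X <= _)%E]/(`|(fine (\int[mu]_(x in cube_set Q) (EFin \o (fun x => (b x - c)%R)) x)%E)%:E|)%E.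
rewrite fineK; first by apply: le_abse_integral => //; case/integrableP: ibc.
exact: integrable_fin_num.
Qed.

Lemma dyadic_parent (P Q : cube R n) : dyadic_subcubes P Q -> Q <> P ->
  exists P', [/\ dyadic_subcubes P P', cube_set Q `<=` cube_set P' & side P' = 2 * side Q].
Proof.
move=> PQ QP; have [[|k] [a [ak sQ cQ]]] := PQ.
  exfalso; apply: QP; apply: cube_eqP; first by rewrite sQ expr0 divr1.
  by move=> i; rewrite cQ; have := ak i; rewrite expn0 ltnS leqn0 => /eqP ->; rewrite mul0r addr0.
have [P' [PP' P'c sP']] := dyadic_level k (dyadic_sub PQ (corner_in Q)).
have e : side P' = 2 * side Q by rewrite sP' sQ exprS; field; rewrite expf_neq0.
exists P'; split=> //.
by apply: (dyadic_nested PQ PP' (corner_in Q) P'c); rewrite e ler_peMl ?ler1n// ltW// side_gt0.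
Qed.

Lemma measurable_gt_norm (g : Rn R n -> R) (r : R) : measurable_fun [set: Rn R n] g ->
  measurable [set x : Rn R n | r < `|g x|].
Proof.
move=> mg.
rewrite (_ : mkset _ = (Num.norm \o g) @^-1` `]r, +oo[); last by apply/seteqP; split=> x /=; rewrite in_itv/= andbT.
by rewrite -[X in measurable X]setTI; apply: (measurableT_comp _ mg) => //; exact: measurable_itv.
Qed.

Lemma measurable_osc (c : R) : measurable_fun [set: Rn R n] (fun x => b x - c).
Proof. by apply: measurable_funB => //; exact: measurable_cst. Qed.

(** Calderon-Zygmund stopping at height [2 B], by induction on [j]. The maximal stopping cubes have
    total measure at most half that of [P], and off them the oscillation is at most [2 B] almost
    everywhere by differentiation. The parent of a maximal stopping cube [Q] is not stopping, so the
    means over [Q] and [P] differ by at most [2 ^ (n + 1) B]. With the inductive hypothesis inside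
    the stopping cubes, each step thus costs [2 ^ (n + 1) B] in height and gains a factor [1 / 2] in
    measure. *)
Lemma john_nirenberg (j : nat) (P : cube R n) :
  (mu (cube_set P `&` [set x | (j%:R * (2 ^+ n.+1 * B) < `|b x - mean P b|)%R])
   <= ((2^-1) ^+ j)%:E * mu (cube_set P))%E.
Proof.
have mE (r c : R) (Q : cube R n) : measurable (cube_set Q `&` [set x | (r < `|b x - c|)%R]).
  apply: measurableI; first exact: measurable_cube.
  exact: (measurable_gt_norm _ (measurable_osc c)).
elim: j P => [|j IH] P.
  rewrite expr0 mul1e; apply: le_measure; rewrite ?inE//; first exact: measurable_cube.
set g := fun x => b x - mean P b.
have mg : measurable_fun [set: Rn R n] g by exact: measurable_osc.
have mag : measurable_fun [set: Rn R n] (fun x => `|(g x)%:E|%E).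
  by apply: measurableT_comp => //; exact/measurable_EFinP.
pose I Q : \bar R := (\int[mu]_(x in cube_set Q) `|(g x)%:E|)%E.
pose F := [set Q | dyadic_subcubes P Q /\ ((2 * B)%:E * mu (cube_set Q) < I Q)%E].
have gF : grid F by apply: (grid_sub _ (@grid_dyadic _ _ P)) => Q [].
have FP Q : F Q -> side Q <= side P by case=> /dyadic_side.
pose W := \bigcup_(Q in F) cube_set Q.
have mW : measurable W by exact: measurable_bigcup_cubes.
have IP : (I P <= B%:E * mu (cube_set P))%E by apply/average_abs_le; exact: bmoB.
have I0 Q : (0 <= I Q)%E by apply: integral_ge0.
have muW : (mu W <= (2^-1)%:E * mu (cube_set P))%E.
  have h : ((2 * B)%:E * mu W <= B%:E * mu (cube_set P))%E.
    apply: le_trans IP.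
    rewrite /W (lebesgue_bigcup_maxcubes n_gt0 gF FP) -esumZl//; last by rewrite mulr_ge0// ltW.
    apply: (@le_trans _ _ (\esum_(Q in maxcubes F) I Q)%E).
      by apply: le_esum => Q [[_ /ltW]].
    rewrite -(ge0_integral_bigcup_maxcubes n_gt0 gF FP mag)//.
    apply: ge0_subset_integral => //; first exact: measurable_cube.
      exact: measurable_funS mag.
    by move=> x [Q [/dyadic_sub + _]]; exact.
  have -> : ((2^-1)%:E = ((2 * B)^-1)%:E * B%:E :> \bar R)%E.
    by rewrite -EFinM; congr (_%:E); field; rewrite gt_eqF.
  by rewrite -muleA lee_pdivlMl// mulr_gt0.
have null : mu (cube_set P `&` ~` W `&` [set x | 2 * B < `|g x|]) = 0%E.
  apply: dyadic_differentiation => //; first by rewrite mulr_ge0// ltW.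
  move=> Q PQ nQW; rewrite leNgt; apply/negP => h; apply: nQW => x Qx.
  by exists Q.
have close Q : maxcubes F Q -> `|mean Q b - mean P b| <= 2 ^+ n.+1 * B.
  move=> [[PQ FQ] maxQ].
  have QP : Q <> P.
    move=> QP; move: FQ; rewrite QP ltNge => /negP; apply; apply: (le_trans IP).
    by rewrite lee_wpmul2r// lee_fin ler_peMl ?ler1n// ltW.
  have [P' [PP' QP' sP']] := dyadic_parent PQ QP.
  have nFP' : (I P' <= (2 * B)%:E * mu (cube_set P'))%E.
    rewrite leNgt; apply/negP => FP'; have P'Q := maxQ P' (conj PP' FP') QP'.
    by move: sP'; rewrite P'Q => /eqP; rewrite eq_sym -subr_eq0 mulr_natl mulr2n addrK gt_eqF// side_gt0.
  have IQP' : (I Q <= I P')%E.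
    apply: ge0_subset_integral => //; try exact: measurable_cube.
    exact: measurable_funS mag.
  have := mean_sub_le Q (mean P b).
  move=> /le_trans/(_ IQP')/le_trans/(_ nFP'); rewrite !lebesgue_cube -!EFinM lee_fin sP' exprMn mulrA.
  by rewrite ler_pM2r ?exprn_gt0 ?side_gt0// exprS mulrAC.
pose E Q := cube_set Q `&` [set x | j%:R * (2 ^+ n.+1 * B) < `|b x - mean Q b|].
apply: (@le_trans _ _ (mu ((cube_set P `&` ~` W `&` [set x | (2 * B < `|g x|)%R]) `|` \bigcup_(Q in maxcubes F) E Q))).
  apply: le_measure; rewrite ?inE//.
    apply: measurableU; last by apply: countable_bigcup_measurable => [|Q _]; [exact: countable_maxcubes|exact: mE].
    rewrite setIAC; apply: measurableI; last exact: measurableC.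
    exact: mE.
  have K2 : 2 * B <= 2 ^+ n.+1 * B by rewrite ler_pM2r// exprS ler_peMr// exprn_ege1// ler1n.
  move=> x [Px /= gx]; have [Wx|nWx] := pselect (W x).
    right; move: Wx; rewrite /W -(bigcup_maxcubes n_gt0 gF FP) => -[Q mQ Qx]; exists Q => //; split=> //=.
    have h1 := close _ mQ.
    have h2 : `|b x - mean P b| <= `|b x - mean Q b| + `|mean Q b - mean P b|.
      by rewrite (_ : b x - mean P b = (b x - mean Q b) + (mean Q b - mean P b)) ?ler_normD//; ring.
    by move: gx; rewrite -natr1 mulrDl mul1r; lra.
  left; split=> //=; apply: le_lt_trans gx; apply: (le_trans K2).
  by rewrite ler_peMl ?ler1n// mulr_ge0// ?exprn_ge0// ltW.
apply: (le_trans (measureU2 _ _ _)).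
- by rewrite setIAC; apply: measurableI; [exact: mE|exact: measurableC].
- by apply: countable_bigcup_measurable => [|Q _]; [exact: countable_maxcubes|exact: mE].
rewrite [X in (X + _)%E](_ : _ = 0%E) ?add0e; last exact: null.
apply: (le_trans (measure_bigcup_le_esum _ _ _)) => [|Q _|]; [exact: countable_maxcubes|exact: mE|].
apply: (@le_trans _ _ (\esum_(Q in maxcubes F) (((2^-1) ^+ j)%:E * mu (cube_set Q)))%E).
  by apply: le_esum => Q _; exact: IH.
rewrite esumZl ?exprn_ge0// -(lebesgue_bigcup_maxcubes n_gt0 gF FP) exprSr EFinM -muleA.
by rewrite lee_wpmul2l// lee_fin exprn_ge0.
Qed.

End JohnNirenberg.

Lemma bmo_osc_power (R : realType) (n : nat) (n_gt0 : (0 < n)%N) (a : nat) : (0 < a)%N ->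
  exists2 C : R, 0 < C & forall (b : Rn R n -> R) (B : R),
  measurable_fun [set: Rn R n] b ->
  (forall Q : cube R n, (lebesgue_Rn R n).-integrable (cube_set Q) (EFin \o b)) ->
  0 < B ->
  (forall Q : cube R n, (average_abs Q (fun x => (b x - mean Q b)%R) <= B%:E)%E) ->
  forall Q : cube R n,
  (\int[lebesgue_Rn R n]_(x in cube_set Q) ((`|b x - mean Q b| / B) ^+ a)%:E
    <= C%:E * lebesgue_Rn R n (cube_set Q))%E.
Proof.
(* A base between 1 and 2: polynomial growth is absorbed by [(3 / 2) ^ j], and multiplying by the
   decay [2 ^ (- j)] of the level sets leaves [(3 / 4) ^ j]. *)
move=> a0; have r1 : 1 < (3 / 2 : R) by lra.
have [C C0 HC] := poly_le_exp a r1.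
pose K : R := 2 ^+ n.+1; have K0 : 0 < K by rewrite exprn_gt0.
exists (K ^+ a * C / (1 - 3 / 4)); first by rewrite divr_gt0 ?mulr_gt0 ?exprn_gt0//; lra.
move=> b B mb ib B0 HB Q; set mu := lebesgue_Rn R n.
pose E j := cube_set Q `&` [set x | j%:R * (2 ^+ n.+1 * B) < `|b x - mean Q b|].
have mQ := measurable_cube Q.
have mo := measurable_osc mb (mean Q b).
have mE j : measurable (E j) by apply: measurableI => //; exact: measurable_gt_norm.
pose t j : R := (j.+1%:R * K) ^+ a.
have t0 j : 0 <= t j by rewrite exprn_ge0// mulr_ge0// ltW.
have mt j : measurable_fun (cube_set Q) (fun x => (t j)%:E * (\1_(E j) x)%:E)%E.
  by apply: emeasurable_funM; [exact: measurable_cst|apply/measurable_EFinP; exact: measurable_indic].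
have tp j x : (0 <= (t j)%:E * (\1_(E j) x)%:E)%E by rewrite mule_ge0// lee_fin.
apply: (@le_trans _ _ (\int[mu]_(x in cube_set Q) \sum_(0 <= j <oo) ((t j)%:E * (\1_(E j) x)%:E))%E).
  apply: ge0_le_integral => //.
  - by move=> x _; rewrite lee_fin exprn_ge0// divr_ge0// ltW.
  - apply: measurable_funS (_ : measurable_fun [set: Rn R n] _) => //.
    apply/measurable_EFinP; apply: measurable_funX; apply: measurable_funM; last exact: measurable_cst.
    exact: measurableT_comp mo.
  - exact: ge0_emeasurable_sum.
  - move=> x Qx; rewrite nneseries_esumT//.
    have [z0|z0] := eqVneq (`|b x - mean Q b|) 0.
      by rewrite z0 mul0r expr0n gtn_eqF//= esum_ge0.
    pose y := `|b x - mean Q b| / (K * B).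
    have y0 : 0 < y by rewrite divr_gt0 ?mulr_gt0// lt_neqAle eq_sym z0 /=.
    (* The least [j] with [y <= j + 1] also satisfies [j < y], for [j = 0] because [y > 0]. So [x]
       lies in [E j], and the term of index [j] alone dominates. *)
    have exj : exists j, y <= j.+1%:R.
      by exists (Num.bound y); rewrite ltW// (lt_le_trans (archi_boundP (ltW y0)))// ler_nat.
    have [j yj jmin] := ex_minnP exj.
    apply: le_trans (esum_ge_term (i := j) _ _) => //.
    have Ej : E j x.
      split=> //=; rewrite -ltr_pdivlMr ?mulr_gt0//.
      rewrite -/y; case: j yj jmin => [//|j] yj jmin; rewrite ltNge; apply/negP => /jmin.
      by rewrite ltnn.
    rewrite indicE mem_set// mule1 lee_fin lerXn2r ?nnegrE ?divr_ge0 ?mulr_ge0// ?(ltW B0) ?(ltW K0)//.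
    by rewrite ler_pdivrMr// -mulrA -ler_pdivrMr ?mulr_gt0.
rewrite integral_nneseries//.
apply: (@le_trans _ _ (\sum_(0 <= j <oo) ((K ^+ a * C * (3 / 4) ^+ j)%:E * mu (cube_set Q)))%E).
  apply: lee_nneseries => [j _ _|j _].
    by apply: integral_ge0.
  rewrite ge0_integralZl_EFin//; last by apply/measurable_EFinP; exact: measurable_indic.
  rewrite integral_indic// setIidl; last by move=> x [].
  apply: (@le_trans _ _ ((t j)%:E * (((2^-1) ^+ j)%:E * mu (cube_set Q)))%E).
    by rewrite lee_wpmul2l ?lee_fin//; exact: john_nirenberg.
  rewrite muleA -EFinM lee_wpmul2r// lee_fin /t exprMn.
  rewrite [_ * K ^+ a]mulrC -!mulrA ler_wpM2l ?exprn_ge0 ?(ltW K0)//.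
  apply: (@le_trans _ _ (C * (3 / 2) ^+ j * (2^-1) ^+ j)); first by rewrite ler_wpM2r ?exprn_ge0.
  by rewrite -mulrA -exprMn (_ : 3 / 2 * 2^-1 = 3 / 4 :> R)//; lra.
rewrite nneseries_esumT; last by move=> j; rewrite mule_ge0// lee_fin !mulr_ge0 ?exprn_ge0// ?(ltW K0) ?(ltW C0)//; lra.
rewrite lebesgue_cube.
under eq_esum do rewrite muleC.
rewrite esumZl ?exprn_ge0 ?(ltW (side_gt0 _))//; last first.
  by move=> j; rewrite lee_fin !mulr_ge0 ?exprn_ge0// ?(ltW K0) ?(ltW C0)//; lra.
rewrite muleC lee_wpmul2r ?lee_fin ?exprn_ge0 ?(ltW (side_gt0 _))//.
apply: esum_geometric_le; last by apply/andP; split; lra.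
by rewrite mulr_ge0 ?exprn_ge0 ?(ltW K0) ?(ltW C0).
Qed.

(** * Rearrangements and averages over cubes *)

Section PowerOfTwo.
Context {R : realType}.

(** A real exponent lets integer scales, shifts and quotients such as [k / p] be combined linearly
    under one function. *)
Definition e2 (x : R) : R := 2 `^ x.

Lemma e2_gt0 x : 0 < e2 x. Proof. exact: powR_gt0. Qed.
Lemma e2_ge0 x : 0 <= e2 x. Proof. exact: powR_ge0. Qed.
Lemma e2D x y : e2 (x + y) = e2 x * e2 y.
Proof. by rewrite /e2 powRD//; apply/implyP. Qed.
Lemma e20 : e2 0 = 1. Proof. exact: powRr0. Qed.
Lemma e21 : e2 1 = 2. Proof. by rewrite /e2 powRr1. Qed.
Lemma e2N x : e2 (- x) = (e2 x)^-1. Proof. exact: powRN. Qed.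
Lemma e2M x y : e2 (x * y) = e2 x `^ y. Proof. exact: powRrM. Qed.
Lemma e2Mn x (k : nat) : e2 (x * k%:R) = e2 x ^+ k.
Proof. by rewrite e2M powR_mulrn// e2_ge0. Qed.
Lemma ler_e2 x y : (e2 x <= e2 y) = (x <= y).
Proof.
rewrite /e2 /powR !gt_eqF// ler_expR ler_pM2r//.
by rewrite ln_gt0// ltr1n.
Qed.
Lemma ltr_e2 x y : (e2 x < e2 y) = (x < y).
Proof. by rewrite !ltNge ler_e2. Qed.

Lemma le_poweR (r : R) (x y : \bar R) : (0 <= r)%R -> (0 <= x)%E -> (x <= y)%E ->
  (x `^ r <= y `^ r)%E.
Proof.
move=> r0 x0 xy; apply: gt0_ler_poweR => //; rewrite in_itv/= leey andbT//.
exact: le_trans xy.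
Qed.

End PowerOfTwo.

Section Rearrangement.
Context {R : realType} {n : nat}.
Local Notation mu := (lebesgue_Rn R n).
Local Open Scope ereal_scope.
Variable f : Rn R n -> R.
Hypothesis mf : measurable_fun [set: Rn R n] f.

Lemma distribution_ge0 s : 0 <= distribution_function f s.
Proof. exact: measure_ge0. Qed.

Lemma distribution_antitone (s s' : R) : (s <= s')%R ->
  distribution_function f s' <= distribution_function f s.
Proof.
move=> ss'; apply: le_measure; rewrite ?inE; try exact: measurable_gt_norm.
by move=> x /=; exact: le_lt_trans.
Qed.

Lemma rearrangement_ge0 t : 0 <= rearrangement f t.
Proof. by apply: le_ereal_inf_tmp => _ [s [s0 _] <-]; rewrite lee_fin. Qed.

(** The infimum defining the rearrangement is attained, because the distribution function is
    continuous from the right. Rearrangement and distribution function thus form a Galois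
    connection. *)
Lemma rearrangement_le (s t : R) : (0 <= s)%R ->
  (rearrangement f t <= s%:E) = (distribution_function f s <= t%:E).
Proof.
move=> s0; apply/idP/idP => [h|h]; last by apply: ereal_inf_lbound; exists s.
rewrite leNgt; apply/negP => ts.
pose A k := [set x : Rn R n | (s + k.+1%:R^-1 < `|f x|)%R].
have mA k : measurable (A k) by exact: measurable_gt_norm.
have AE : [set x : Rn R n | (s < `|f x|)%R] = \bigcup_k A k.
  apply/seteqP; split=> [x /= sx|x [k _ /=]]; last by apply: lt_trans; rewrite ltrDl invr_gt0.
  have gs : (0 < `|f x| - s)%R by rewrite subr_gt0.
  exists (Num.bound ((`|f x| - s)^-1)%R) => //; rewrite /A/=.
  rewrite -ltrBrDl -[ltRHS]invrK ltf_pV2 ?posrE ?invr_gt0//.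
  by apply: (lt_trans (archi_boundP _)); rewrite ?ltr_nat// invr_ge0 ltW.
have cA : mu (A k) @[k --> \oo] --> distribution_function f s.
  rewrite /distribution_function AE; apply: nondecreasing_cvg_mu => //.
    exact: bigcupT_measurable.
  move=> k k' kk'; apply/subsetPset => x /=; apply: le_lt_trans.
  by rewrite lerD2l lef_pV2 ?posrE// ler_nat.
have [[k Ak]|nk] := pselect (exists k, t%:E < mu (A k)).
  have : (s + k.+1%:R^-1)%:E <= rearrangement f t.
    apply: le_ereal_inf_tmp => _ [s' [s'0 ds'] <-]; rewrite lee_fin leNgt; apply/negP => s's.
    move: Ak; rewrite ltNge => /negP; apply; apply: le_trans ds'.
    exact: distribution_antitone (ltW s's).
  move=> /le_trans/(_ h); rewrite lee_fin leNgt => /negP; apply.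
  by rewrite ltrDl invr_gt0.
have : lim (mu (A k) @[k --> \oo]) <= t%:E.
  apply: lime_le; first by apply/cvg_ex; eexists; exact: cA.
  by near=> k; rewrite leNgt; apply/negP => h'; apply: nk; exists k.
by rewrite (cvg_lim _ cA)// leNgt ts.
Unshelve. all: by end_near. Qed.

Lemma rearrangement_gt (s t : R) : (0 <= s)%R ->
  (s%:E < rearrangement f t) = (t%:E < distribution_function f s).
Proof. by move=> s0; rewrite !ltNge rearrangement_le. Qed.

Lemma rearrangement_antitone (t t' : R) : (t <= t')%R -> rearrangement f t' <= rearrangement f t.
Proof.
move=> tt'; apply: le_ereal_inf_tmp => _ [s [s0 ds] <-].
by rewrite rearrangement_le// (le_trans ds)// lee_fin.
Qed.

Lemma measurable_rearrangement_level (t : R) :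
  measurable [set x | rearrangement f t < `|f x|%:E].
Proof.
have := rearrangement_ge0 t; case: (rearrangement f t) => [r r0||//].
  rewrite (_ : mkset _ = [set x | (r < `|f x|)%R]); first exact: measurable_gt_norm.
  by apply/seteqP; split=> x /=; rewrite lte_fin.
by move=> _; rewrite (_ : mkset _ = set0)//; apply/seteqP; split=> x //=; rewrite ltNge leey.
Qed.

Lemma mu_rearrangement_level (t : R) : (0 <= t)%R ->
  mu [set x | rearrangement f t < `|f x|%:E] <= t%:E.
Proof.
move=> t0; have := rearrangement_ge0 t; case E : (rearrangement f t) => [r||//] r0.
  rewrite (_ : mkset _ = [set x | (r < `|f x|)%R]); first by rewrite -[X in X <= _]/(distribution_function f r) -rearrangement_le ?E.
  by apply/seteqP; split=> x /=; rewrite lte_fin.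
by rewrite (_ : mkset _ = set0) ?measure0 ?lee_fin//; apply/seteqP; split=> x //=; rewrite ltNge leey.
Qed.

(* [gtail kap k] plays the role of [(|f|^rho)^{**}(2^k)^{1/rho}], with a slightly larger power. *)
Definition gtail (kap k : R) : \bar R :=
  ereal_sup (range (fun u : nat => (e2 (- (u%:R * kap)))%:E * rearrangement f (e2 (k - u%:R)))).

Lemma gtail_ge0 kap k : 0 <= gtail kap k.
Proof.
apply: le_ereal_sup_tmp; exists ((e2 (- (0%:R * kap)))%:E * rearrangement f (e2 (k - 0%:R))); first by exists 0%N.
by rewrite mule_ge0 ?lee_fin ?e2_ge0// rearrangement_ge0.
Qed.

Lemma rearrangement_le_gtail kap k (u : nat) :
  rearrangement f (e2 (k - u%:R)) <= (e2 (u%:R * kap))%:E * gtail kap k.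
Proof.
have : (e2 (- (u%:R * kap)))%:E * rearrangement f (e2 (k - u%:R)) <= gtail kap k.
  by apply: ereal_sup_ubound; exists u.
by rewrite e2N lee_pdivrMl ?e2_gt0.
Qed.

Lemma measurable_powR_norm (rho : R) :
  measurable_fun [set: Rn R n] (fun x => ((`|f x| `^ rho)%R)%:E).
Proof.
apply/measurable_EFinP.
apply: (@measurableT_comp _ _ _ _ _ _ (fun y : R => (y `^ rho)%R)); first exact: measurable_powR.
exact: measurableT_comp mf.
Qed.

(** The sum of the geometric series with first term [2 ^ (kap rho)] and ratio
    [2 ^ (kap rho - 1)]. *)
Definition level_const (rho kap : R) : R := (e2 (kap * rho) / (1 - e2 (kap * rho - 1)))%R.

Lemma level_const_gt0 (rho kap : R) : (kap * rho < 1)%R -> (0 < level_const rho kap)%R.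
Proof.
move=> kr; rewrite divr_gt0 ?e2_gt0// subr_gt0 -[ltRHS]e20 ltr_e2; lra.
Qed.

(** Between the levels of indices [u] and [u + 1] the function is at most [2 ^ ((u + 1) kap)] times
    [gtail], on a set of measure at most [2 ^ (k - u)]; the [rho]-th powers sum geometrically
    because [kap * rho < 1]. *)
Lemma integral_level_le (rho kap k : R) : (0 < rho)%R -> (kap * rho < 1)%R ->
  \int[mu]_(x in [set x | (rearrangement f (e2 k) < `|f x|%:E)%E]) ((`|f x| `^ rho)%R)%:E
  <= (level_const rho kap * e2 k)%:E * gtail kap k `^ rho.
Proof.
move=> rho0 kr.
have C0 := level_const_gt0 kr.
have [->|Gfin] := eqVneq (gtail kap k) +oo.
  by rewrite poweRyr ?gt_eqF// gt0_muley ?leey// lte_fin mulr_gt0// e2_gt0.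
pose a u : \bar R := rearrangement f (e2 (k - u%:R)).
pose T u := [set x | a u < `|f x|%:E].
have mT u : measurable (T u) by exact: measurable_rearrangement_level.
have muT u : mu (T u) <= (e2 (k - u%:R))%:E by apply: mu_rearrangement_level; exact: e2_ge0.
have aG u : a u <= (e2 (u%:R * kap))%:E * gtail kap k by exact: rearrangement_le_gtail.
have a0 u : 0 <= a u by exact: rearrangement_ge0.
have Gf : gtail kap k \is a fin_num by rewrite ge0_fin_numE ?gtail_ge0// ltey.
rewrite (_ : mkset _ = T 0%N); last by rewrite /T /a subr0.
have mpow := measurable_powR_norm rho.
pose h u x : \bar R := (a u.+1 `^ rho) * (\1_(T u) x)%:E.
have h0 u x : 0 <= h u x by rewrite mule_ge0 ?poweR_ge0// lee_fin.
have mh u : measurable_fun (T 0%N) (h u).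
  by apply: emeasurable_funM; [exact: measurable_cst|apply/measurable_EFinP; exact: measurable_indic].
apply: (@le_trans _ _ (\int[mu]_(x in T 0%N) \sum_(0 <= u <oo) h u x)).
  apply: ae_ge0_le_integral => //.
  - exact: measurable_funS mpow.
  - by move=> x _; rewrite nneseries_esumT// esum_ge0.
  - exact: ge0_emeasurable_sum.
  (* Points above all levels belong to no shell. They form a null set, since [T u] has measure at
     most [2 ^ (k - u)]. *)
  exists (\bigcap_u T u); split.
  - exact: bigcapT_measurable.
  - apply/eqP; rewrite eq_le measure_ge0 andbT; apply/lee_addgt0Pr => e e0; rewrite add0e.
    have [u hu] : exists u : nat, (e2 k / 2 ^+ u < e)%R.
      exists (Num.bound (e2 k / e)%R); rewrite ltr_pdivrMr ?exprn_gt0// mulrC -ltr_pdivrMr//.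
      apply: (lt_le_trans (archi_boundP _)); first by rewrite divr_ge0// ?ltW// e2_gt0.
      by rewrite -natrX ler_nat ltnW// ltn_expl.
    apply: (@le_trans _ _ (mu (T u))).
      by apply: le_measure; rewrite ?inE//; [exact: bigcapT_measurable|move=> x; exact].
    apply: (le_trans (muT u)); rewrite lee_fin e2D e2N -[u%:R]mul1r e2Mn e21; exact: ltW.
  - move=> x /= nle; rewrite -[X in X x]setCK => nT; apply: nle => T0x.
    have ex : exists u, `[< ~ T u x >].
      apply: contrapT => ne; apply: nT => u _; apply: contrapT => nu; apply: ne; exists u.
      exact/asboolP.
    have [[|u] /asboolP nTu umin] := ex_minnP ex; first by [].
    have Tu : T u x.
      apply: contrapT => nTu'; have := umin u; rewrite ltnn => /(_ _)/negP; apply.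
        exact/asboolP. by [].
    rewrite nneseries_esumT; last by move=> u'; exact: h0.
    apply: (@le_trans _ _ (h u x)); last by apply: (@esum_ge_term _ _ _ (h^~ x)) => // i; exact: h0.
    rewrite /h indicE (mem_set Tu) mule1 -[X in X <= _]poweR_EFin; apply: le_poweR; first exact: ltW.
      by rewrite lee_fin.
    by rewrite leNgt; apply/negP.
rewrite integral_nneseries//.
pose r : R := e2 (kap * rho - 1).
apply: (@le_trans _ _ (\sum_(0 <= u <oo) ((e2 k * e2 (kap * rho) * r ^+ u)%:E * gtail kap k `^ rho))).
  apply: lee_nneseries => [u _ _|u _]; first exact: integral_ge0.
  rewrite ge0_integralZl//; [|by apply/measurable_EFinP; exact: measurable_indic|exact: poweR_ge0].
  rewrite integral_indic//.
  apply: (@le_trans _ _ (((e2 (u.+1%:R * kap))%:E * gtail kap k) `^ rho * (e2 (k - u%:R))%:E)).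
    apply: lee_pmul; rewrite ?poweR_ge0 ?measure_ge0//.
      by apply: le_poweR => //; exact: ltW.
    apply: le_trans (muT u); apply: le_measure; [by rewrite inE; exact: measurableI|by rewrite inE|exact: subIsetl].
  rewrite poweRM ?gtail_ge0 ?lee_fin ?e2_ge0// poweR_EFin muleAC -EFinM lee_wpmul2r ?poweR_ge0//.
  rewrite lee_fin -e2M -e2Mn -!e2D ler_e2 -[u.+1%:R]natr1; lra.
rewrite nneseries_esumT; last first.
  by move=> u; rewrite mule_ge0 ?poweR_ge0// lee_fin !mulr_ge0 ?exprn_ge0 ?e2_ge0.
under eq_esum do rewrite muleC.
rewrite -(fineK (fin_num_poweR _ Gf)) esumZl; last 2 first.
- by apply: fine_ge0; exact: poweR_ge0.
- by move=> u; rewrite lee_fin !mulr_ge0 ?exprn_ge0 ?e2_ge0.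
rewrite muleC lee_wpmul2r ?lee_fin//; first by apply: fine_ge0; exact: poweR_ge0.
have -> : (level_const rho kap * e2 k = e2 k * e2 (kap * rho) / (1 - r))%R.
  by rewrite /level_const /r; ring.
apply: esum_geometric_le; first by rewrite mulr_ge0 ?e2_ge0.
by rewrite e2_ge0/= /r -[ltRHS]e20 ltr_e2; lra.
Qed.

End Rearrangement.

Section Averages.
Context {R : realType} {n : nat}.
Hypothesis n_gt0 : (0 < n)%N.
Local Notation mu := (lebesgue_Rn R n).
Local Open Scope ereal_scope.

Definition power_mean (rho : R) (f : Rn R n -> R) (Q : cube R n) : \bar R :=
  (((fine (mu (cube_set Q)))^-1)%:E * \int[mu]_(x in cube_set Q) ((`|f x| `^ rho)%R)%:E) `^ rho^-1.

Lemma power_mean_ge0 rho f Q : 0 <= power_mean rho f Q.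
Proof. exact: poweR_ge0. Qed.

Lemma cube_vol_gt0 (Q : cube R n) : (0 < side Q ^+ n)%R.
Proof. by rewrite exprn_gt0// side_gt0. Qed.

Lemma power_mean_le rho f Q (g : \bar R) : (0 < rho)%R -> 0 <= g ->
  (power_mean rho f Q <= g) =
  (\int[mu]_(x in cube_set Q) ((`|f x| `^ rho)%R)%:E <= g `^ rho * mu (cube_set Q)).
Proof.
move=> rho0 g0; rewrite /power_mean lebesgue_cube/=.
set I := \int[mu]_(x in _) _.
have I0 : 0 <= I by apply: integral_ge0 => x _; rewrite lee_fin powR_ge0.
have V0 := cube_vol_gt0 Q.
have VI0 : 0 <= (side Q ^- n)%:E * I by rewrite mule_ge0// lee_fin invr_ge0 ltW.
have rK (y : \bar R) : 0 <= y -> (y `^ rho^-1) `^ rho = y.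
  by move=> y0; rewrite -poweRrM mulVf ?gt_eqF// poweRe1.
have Kr (y : \bar R) : 0 <= y -> (y `^ rho) `^ rho^-1 = y.
  by move=> y0; rewrite -poweRrM mulfV ?gt_eqF// poweRe1.
apply/idP/idP => h.
- have := le_poweR (ltW rho0) (poweR_ge0 _ _) h.
  by rewrite rK// lee_pdivrMl// muleC.
- rewrite -[leRHS]Kr//; apply: le_poweR => //; first by rewrite invr_ge0 ltW.
  by rewrite lee_pdivrMl// muleC.
Qed.

Section Level.
Variables (f : Rn R n -> R) (rho kap : R).
Hypothesis mf : measurable_fun [set: Rn R n] f.
Hypothesis rho_gt0 : (0 < rho)%R.
Hypothesis kr : (kap * rho < 1)%R.

(** Under the root, the summand 1 accounts for the part of [f] below its rearrangement at [2 ^ k].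
    The other accounts for the part above it, doubled because [2 ^ k] may be as large as twice the
    volume of the cube. *)
Definition mean_const : R := ((1 + 2 * level_const rho kap) `^ rho^-1)%R.

Lemma mean_const_gt0 : (0 < mean_const)%R.
Proof. by rewrite powR_gt0// addr_gt0// mulr_gt0// level_const_gt0. Qed.

Lemma mean_constX : (mean_const `^ rho = 1 + 2 * level_const rho kap)%R.
Proof.
have h : (0 < 1 + 2 * level_const rho kap)%R by rewrite addr_gt0// mulr_gt0// level_const_gt0.
by rewrite /mean_const -powRrM mulVf ?gt_eqF// powRr1// ltW.
Qed.

Let T k := [set x : Rn R n | rearrangement f (e2 k) < `|f x|%:E].
Let mT k : measurable (T k). Proof. exact: measurable_rearrangement_level. Qed.
Let mpow : measurable_fun [set: Rn R n] (fun x => ((`|f x| `^ rho)%R)%:E).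
Proof. exact: measurable_powR_norm. Qed.

Lemma rearrangement_le_gtail0 (k : R) : rearrangement f (e2 k) <= gtail f kap k.
Proof. by have := rearrangement_le_gtail f kap k 0; rewrite subr0 mul0r e20 mul1e. Qed.

Lemma integral_cube_le (Q : cube R n) (k : R) :
  \int[mu]_(x in cube_set Q) ((`|f x| `^ rho)%R)%:E <=
  gtail f kap k `^ rho * mu (cube_set Q) +
  \int[mu]_(x in cube_set Q `&` T k) ((`|f x| `^ rho)%R)%:E.
Proof.
have mQ := measurable_cube Q.
have p0 x : 0 <= ((`|f x| `^ rho)%R)%:E by rewrite lee_fin powR_ge0.
rewrite -{1}[cube_set Q](setUIDK _ (T k)) setUC ge0_integral_setU//; last 4 first.
- exact: measurableD.
- exact: measurableI.
- exact: measurable_funS mpow.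
- by rewrite disj_set2E; apply/eqP/seteqP; split=> x// [[_ nT] [_ Tx]].
rewrite leeD2r//.
apply: (@le_trans _ _ (\int[mu]_(x in cube_set Q `\` T k) (cst (gtail f kap k `^ rho) x))).
  apply: ge0_le_integral => //.
  - exact: measurableD.
  - exact: measurable_funS mpow.
  - move=> x [_ nT] /=; rewrite -[X in X <= _]poweR_EFin; apply: le_poweR; [exact: ltW|by rewrite lee_fin|].
    by apply: le_trans (rearrangement_le_gtail0 k); rewrite leNgt; apply/negP.
rewrite integral_cst//; last exact: measurableD.
rewrite lee_wpmul2l ?poweR_ge0//; apply: le_measure; rewrite ?inE//; first exact: measurableD.
Qed.

Lemma integral_sub_level_le (A : set (Rn R n)) (k : R) : measurable A ->
  \int[mu]_(x in A `&` T k) ((`|f x| `^ rho)%R)%:E <=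
  (level_const rho kap * e2 k)%:E * gtail f kap k `^ rho.
Proof.
move=> mA; apply: le_trans (integral_level_le mf k rho_gt0 kr).
apply: ge0_subset_integral => //; [exact: measurableI|exact: mT|exact: measurable_funS mpow].
Qed.

Lemma power_mean_large (Q : cube R n) (k : R) : (e2 k)%:E <= 2%:E * mu (cube_set Q) ->
  power_mean rho f Q <= mean_const%:E * gtail f kap k.
Proof.
move=> kQ; have L0 := level_const_gt0 kr.
rewrite power_mean_le// ?mule_ge0 ?lee_fin ?(ltW mean_const_gt0) ?gtail_ge0//.
rewrite poweRM ?lee_fin ?(ltW mean_const_gt0) ?gtail_ge0// poweR_EFin mean_constX.
apply: (le_trans (integral_cube_le Q k)).
apply: (@le_trans _ _ (gtail f kap k `^ rho * mu (cube_set Q) + (2 * level_const rho kap)%:E * gtail f kap k `^ rho * mu (cube_set Q))).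
  apply: leeD => //; apply: (le_trans (integral_sub_level_le k (measurable_cube Q))).
  rewrite muleAC lee_wpmul2r ?poweR_ge0//.
  move: kQ; rewrite lebesgue_cube -!EFinM !lee_fin => kQ.
  have -> : (2 * level_const rho kap * side Q ^+ n = level_const rho kap * (2 * side Q ^+ n))%R by ring.
  by rewrite ler_wpM2l// ltW.
have L20 : (0 <= 2 * level_const rho kap)%R by rewrite mulr_ge0// ltW.
rewrite -[X in X * _ + _]mul1e -ge0_muleDl ?mule_ge0 ?poweR_ge0 ?lee_fin ?L20//.
by rewrite -ge0_muleDl ?lee_fin ?L20 ?lee01// -EFinD.
Qed.

(* Weak-type estimate for the dyadic maximal operator, in rearrangement form. *)
Lemma power_mean_maximal (F : set (cube R n)) (M k : R) : grid F ->
  (forall Q, F Q -> (side Q <= M)%R) ->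
  (forall Q, F Q -> mean_const%:E * gtail f kap k < power_mean rho f Q) ->
  mu (\bigcup_(Q in F) cube_set Q) <= (e2 k)%:E.
Proof.
move=> gF FM FQ; have L0 := level_const_gt0 kr.
have [Gy|Gy] := eqVneq (gtail f kap k) +oo.
  have -> : F = set0.
    apply/seteqP; split=> // Q /FQ; rewrite Gy gt0_muley ?lte_fin ?mean_const_gt0//.
    by rewrite ltNge leey.
  by rewrite bigcup_set0 measure0 lee_fin e2_ge0.
have Gf : gtail f kap k \is a fin_num by rewrite ge0_fin_numE ?gtail_ge0// ltey.
have Gpf := fin_num_poweR rho Gf.
have p0 x : 0 <= ((`|f x| `^ rho)%R)%:E by rewrite lee_fin powR_ge0.
set g := gtail f kap k `^ rho in Gpf.
have g0 : 0 <= g by exact: poweR_ge0.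
(* Once the possible contribution of [f] below the level is subtracted, each selected cube carries a
   fixed share, per unit of volume, of the integral above the level. Summing over the disjoint
   maximal cubes bounds their volume. *)
have key Q : F Q -> (level_const rho kap)%:E * g * mu (cube_set Q) <
    \int[mu]_(x in cube_set Q `&` T k) ((`|f x| `^ rho)%R)%:E.
  move=> /FQ; rewrite ltNge power_mean_le// ?mule_ge0 ?lee_fin ?(ltW mean_const_gt0) ?gtail_ge0//.
  rewrite -ltNge poweRM ?lee_fin ?(ltW mean_const_gt0) ?gtail_ge0// poweR_EFin mean_constX -/g.
  move=> h; have := lt_le_trans h (integral_cube_le Q k); rewrite -/g.
  rewrite lebesgue_cube -(fineK Gpf) -!EFinM => h2.
  rewrite -(@lteD2lE _ (fine g * side Q ^+ n)%:E)//; apply: le_lt_trans h2.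
  rewrite -EFinD lee_fin.
  have : (0 <= level_const rho kap * fine g * side Q ^+ n)%R.
    rewrite mulr_ge0 ?(ltW (cube_vol_gt0 _))// mulr_ge0 ?(ltW L0)//.
    exact: fine_ge0.
  lra.
have [g00|gn0] := eqVneq g 0.
  have -> : F = set0.
    apply/seteqP; split=> // Q /key; rewrite g00 mule0 mul0e ltNge => /negP; apply.
    apply: (le_trans (integral_sub_level_le k (measurable_cube Q))).
    by rewrite -/g g00 mule0.
  by rewrite bigcup_set0 measure0 lee_fin e2_ge0.
have gp : (0 < fine g)%R by rewrite fine_gt0// lt_neqAle eq_sym gn0 g0/= ltey_eq Gpf.
have : (level_const rho kap * fine g)%:E * mu (\bigcup_(Q in F) cube_set Q) <=
   (level_const rho kap * e2 k)%:E * g.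
  rewrite (lebesgue_bigcup_maxcubes n_gt0 gF FM) -esumZl ?(mulr_ge0 (ltW L0) (ltW gp))//.
  pose pf : Rn R n -> \bar R := (fun x => ((`|f x| `^ rho)%R)%:E) \_ (T k).
  apply: (@le_trans _ _ (\esum_(Q in maxcubes F) \int[mu]_(x in cube_set Q) pf x)).
    apply: le_esum => Q [/key/ltW h _]; rewrite EFinM fineK//.
    by rewrite -integral_mkcondr.
  rewrite -(ge0_integral_bigcup_maxcubes n_gt0 gF FM); last 2 first.
  - apply/(measurable_restrictT _ (mT k)); exact: measurable_funS mpow.
  - by move=> x; rewrite /pf patchE; case: ifP.
  rewrite -integral_mkcondr.
  exact: integral_sub_level_le (measurable_bigcup_cubes gF).
rewrite -(fineK Gpf) -EFinM => h.
have lg : (0 < level_const rho kap * fine g)%R by rewrite mulr_gt0.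
rewrite -(@lee_pmul2l _ (level_const rho kap * fine g)%:E) ?lte_fin//.
by apply: (le_trans h); rewrite -EFinM lee_fin mulrAC.
Qed.

End Level.

(** The exponents are conjugate. Without the usual constants it is enough to distinguish
    [y <= x ^ a], where the first summand dominates, from [x ^ a < y], where the second does. *)
Lemma young_product (a : nat) (x y : R) : (0 < a)%N -> (0 <= x)%R -> (0 <= y)%R ->
  (x * y <= x ^+ a.+1 + y `^ (1 + a%:R^-1))%R.
Proof.
move=> a0 x0 y0; have [yx|xy] := leP y (x ^+ a)%R.
  by rewrite exprS ler_wpDr ?powR_ge0// ler_wpM2l.
rewrite ler_wpDl ?exprn_ge0// -mulr_powRB1//.
rewrite mulrC ler_wpM2l// addrAC subrr add0r.
have -> : (x = (x ^+ a) `^ a%:R^-1)%R.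
  by rewrite -powR_mulrn// -powRrM mulfV ?powRr1// pnatr_eq0 -lt0n.
by apply: ge0_ler_powR; rewrite ?nnegrE ?invr_ge0 ?exprn_ge0// ltW.
Qed.

(** Hoelder's inequality with exponents [a + 1] and [1 + 1 / a], obtained from Young's inequality
    for [|beta| / B] and [|f| / g], with [g] any positive bound of the power mean; when that mean is
    zero, [g] tends to 0. *)
Lemma average_abs_mul_le (a : nat) (f beta : Rn R n -> R) (B C : R) (Q : cube R n) :
  (0 < a)%N -> measurable_fun [set: Rn R n] f -> measurable_fun [set: Rn R n] beta ->
  (0 < B)%R -> (0 < C)%R ->
  \int[mu]_(x in cube_set Q) (((`|beta x| / B) ^+ a.+1)%R)%:E <= C%:E * mu (cube_set Q) ->
  average_abs Q (fun x => (beta x * f x)%R) <=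
    ((C + 1) * B)%:E * power_mean (1 + a%:R^-1) f Q.
Proof.
move=> a0 mf mb B0 C0 intb; set rho := (1 + _)%R.
have rho0 : (0 < rho)%R by rewrite addr_gt0// invr_gt0 ltr0n.
have CB : (0 < (C + 1) * B)%R by rewrite mulr_gt0// addr_gt0.
have mQ := measurable_cube Q.
have main (g : R) : (0 < g)%R -> power_mean rho f Q <= g%:E ->
    average_abs Q (fun x => (beta x * f x)%R) <= ((C + 1) * B * g)%:E.
  move=> g0; rewrite power_mean_le ?lee_fin ?(ltW g0)// => intf.
  apply/average_abs_le.
  have mu1 : measurable_fun (cube_set Q) (fun x => (((`|beta x| / B) ^+ a.+1)%R)%:E).
    apply: measurable_funS (_ : measurable_fun [set: Rn R n] _) => //.
    apply/measurable_EFinP; apply: measurable_funX; apply: measurable_funM; last exact: measurable_cst.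
    exact: measurableT_comp mb.
  have mu2 : measurable_fun (cube_set Q) (fun x => ((`|f x| `^ rho / g `^ rho)%R)%:E).
    apply: measurable_funS (_ : measurable_fun [set: Rn R n] _) => //.
    apply/measurable_EFinP; apply: measurable_funM; last exact: measurable_cst.
    by have /measurable_EFinP := measurable_powR_norm mf rho.
  have u1 x : 0 <= (((`|beta x| / B) ^+ a.+1)%R)%:E by rewrite lee_fin exprn_ge0// divr_ge0// ltW.
  have u2 x : 0 <= ((`|f x| `^ rho / g `^ rho)%R)%:E by rewrite lee_fin divr_ge0// powR_ge0.
  have int2 : \int[mu]_(x in cube_set Q) ((`|f x| `^ rho / g `^ rho)%R)%:E <= mu (cube_set Q).
    under eq_integral do rewrite EFinM.
    rewrite ge0_integralZr//; [|by apply: measurable_funS (measurable_powR_norm mf rho)|by rewrite lee_fin invr_ge0 powR_ge0].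
    by rewrite muleC lee_pdivrMl ?powR_gt0.
  apply: (@le_trans _ _ (\int[mu]_(x in cube_set Q) ((B * g)%:E * ((((`|beta x| / B) ^+ a.+1)%R)%:E + ((`|f x| `^ rho / g `^ rho)%R)%:E)))).
    apply: ge0_le_integral => //.
    - apply: measurable_funS (_ : measurable_fun [set: Rn R n] _) => //.
      apply: measurableT_comp => //; apply/measurable_EFinP; exact: measurable_funM.
    - by apply: emeasurable_funM; [exact: measurable_cst|exact: emeasurable_funD].
    - move=> x _; rewrite -EFinD -EFinM lee_fin normrM.
      have -> : (`|beta x| * `|f x| = B * g * ((`|beta x| / B) * (`|f x| / g)))%R.
        by field; rewrite !gt_eqF.
      rewrite ler_wpM2l ?mulr_ge0 ?(ltW B0) ?(ltW g0)//.
      apply: (le_trans (young_product a0 _ _)); [by rewrite divr_ge0// ltW|by rewrite divr_ge0// ltW|].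
      by rewrite lerD2l powRM ?invr_ge0 ?(ltW g0)// -/rho -powR_inv1 ?(ltW g0)// -powRrM mulN1r powRN.
  rewrite ge0_integralZl_EFin ?mulr_ge0 ?(ltW B0) ?(ltW g0)//; [|by move=> x _; exact: adde_ge0|exact: emeasurable_funD].
  rewrite ge0_integralD//.
  apply: (@le_trans _ _ ((B * g)%:E * (C%:E * mu (cube_set Q) + mu (cube_set Q)))).
    by rewrite lee_wpmul2l ?lee_fin ?mulr_ge0 ?(ltW B0) ?(ltW g0)// leeD.
  apply: (@le_trans _ _ ((B * g)%:E * (C%:E * (side Q ^+ n)%:E + (side Q ^+ n)%:E))).
    by rewrite -(lebesgue_cube Q).
  by rewrite lebesgue_cube -(EFinM C) -EFinD -!EFinM lee_fin; lra.
have := power_mean_ge0 rho f Q; case E : (power_mean rho f Q) => [g||//] g0; last first.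
  by rewrite gt0_muley ?leey.
have [g00|gp] := eqVneq g 0%R.
  apply/lee_addgt0Pr => e e0; rewrite g00 mule0 add0e.
  have h : (0 < e / ((C + 1) * B))%R by rewrite divr_gt0.
  apply: le_trans (main _ h _) _; first by rewrite E g00 lee_fin ltW.
  by rewrite lee_fin mulrC divfK ?gt_eqF.
by rewrite -EFinM; apply: main; rewrite ?E// lt_neqAle eq_sym gp -lee_fin.
Qed.

Lemma average_abs_le_power_mean (a : nat) (f : Rn R n -> R) (Q : cube R n) :
  (0 < a)%N -> measurable_fun [set: Rn R n] f ->
  average_abs Q f <= 2%:E * power_mean (1 + a%:R^-1) f Q.
Proof.
move=> a0 mf; have := @average_abs_mul_le a f (fun=> 1%R) 1 1 Q a0 mf (measurable_cst _) ltr01 ltr01.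
rewrite mulr1 (_ : (1 + 1 = 2 :> R)%R)//.
rewrite (_ : (fun x => (1 * f x)%R) = f); last by apply/funext => x; rewrite mul1r.
apply; rewrite normr1 divr1 expr1n integral_cst//; exact: measurable_cube.
Qed.

End Averages.

(** * Discretized Lorentz norms *)

Section EsumTools.
Context {R : realType}.
Local Open Scope ereal_scope.

Lemma esum_exchange (U V : choiceType) (a : U -> V -> \bar R) :
  (forall u v, 0 <= a u v) ->
  \esum_(u in [set: U]) \esum_(v in [set: V]) a u v =
  \esum_(v in [set: V]) \esum_(u in [set: U]) a u v.
Proof.
move=> a0; rewrite !esum_esum//.
rewrite (reindex_esum ([set: V] `*`` (fun=> [set: U])) ([set: U] `*`` (fun=> [set: V])) (fun z => (z.2, z.1)))//.
by split=> [x _|[x y] [z t] _ _ [-> ->]|[x y] _]//=; exists (y, x).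
Qed.

Lemma esum_pickle (U : countType) (a : U -> \bar R) : (forall u, 0 <= a u) ->
  \esum_(u in [set: U]) a u = \sum_(0 <= k <oo) (if @pickle_inv U k is Some u then a u else 0).
Proof.
move=> a0; have -> : [set: U] = \bigcup_k [set u | pickle u = k].
  by apply/seteqP; split=> // u _; exists (pickle u).
rewrite nneseries_sum_bigcup//; last first.
  by apply/trivIsetP => i j _ _ ij; apply/seteqP; split=> // u [/= ui uj]; move: ij; rewrite -ui -uj eqxx.
apply: eq_eseriesr => k _; have := @pickle_invK U k; case E : (pickle_inv k) => [u|] /= h.
  rewrite (_ : [set _ | _] = [set u]) ?esum_set1//.
  by apply/seteqP; split=> [v /= vk|v ->]//; apply: (pcan_inj (@pickleK U)); rewrite h.
rewrite (_ : [set _ | _] = set0) ?esum_set0//.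
by apply/seteqP; split=> // v /= vk; move: E; rewrite -vk pickleK_inv.
Qed.

Lemma integral_esum d (T : measurableType d) (mu : {measure set T -> \bar R}) (U : countType)
    (f : U -> T -> \bar R) :
  (forall u, measurable_fun [set: T] (f u)) -> (forall u x, 0 <= f u x) ->
  \int[mu]_x (\esum_(u in [set: U]) f u x) = \esum_(u in [set: U]) \int[mu]_x f u x.
Proof.
move=> mf f0; rewrite esum_pickle; last by move=> u; apply: integral_ge0.
under eq_integral do rewrite esum_pickle//.
rewrite integral_nneseries//.
- by apply: eq_eseriesr => k _; case: pickle_inv => [u//|]; rewrite integral0.
- by move=> k; case: pickle_inv => [u//|]; exact: measurable_cst.
- by move=> k x _; case: pickle_inv.
Qed.

Lemma measurable_esum d (T : measurableType d) (U : countType) (f : U -> T -> \bar R) :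
  (forall u, measurable_fun [set: T] (f u)) -> (forall u x, 0 <= f u x) ->
  measurable_fun [set: T] (fun x => \esum_(u in [set: U]) f u x).
Proof.
move=> mf f0; under eq_fun do rewrite esum_pickle//.
apply: ge0_emeasurable_sum => [k x _ _|k _]; case: pickle_inv => //.
Qed.

Lemma esum_shift (a : int -> \bar R) (c : int) :
  \esum_(k in [set: int]) a k = \esum_(k in [set: int]) a (k + c)%R.
Proof.
apply: reindex_esum; split => //.
- by move=> x y _ _; exact: addIr.
- by move=> y _; exists (y - c)%R => //; rewrite subrK.
Qed.

Lemma esum_le_sup (U : choiceType) (a : U -> \bar R) (q : R) : (0 < q)%R ->
  (forall u, 0 <= a u) ->
  ereal_sup (range a) `^ q <= \esum_(u in [set: U]) (a u `^ q).
Proof.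
move=> q0 a0; set S := \esum_(u in _) _.
have S0 : 0 <= S by apply: esum_ge0 => u _; exact: poweR_ge0.
have rK (y : \bar R) : 0 <= y -> (y `^ q^-1) `^ q = y.
  by move=> y0; rewrite -poweRrM mulVf ?gt_eqF// poweRe1.
have Kr (y : \bar R) : 0 <= y -> (y `^ q) `^ q^-1 = y.
  by move=> y0; rewrite -poweRrM mulfV ?gt_eqF// poweRe1.
have h : ereal_sup (range a) <= S `^ q^-1.
  apply: ge_ereal_sup => _ [u _ <-]; rewrite -(Kr (a u))//.
  apply: le_poweR; [by rewrite invr_ge0 ltW|exact: poweR_ge0|].
  by apply: (@esum_ge_term _ _ _ (fun u => a u `^ q)) => // i; exact: poweR_ge0.
have [[u]|nU] := pselect (inhabited U).
  rewrite -(rK S)//; apply: le_poweR => //; first exact: ltW.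
  by apply: le_ereal_sup_tmp; exists (a u) => //; exists u.
(* Over an empty index set the supremum is [-oo], whose [q]-th power is 0. *)
rewrite (_ : range a = set0) ?ereal_sup0; last first.
  by apply/seteqP; split=> [y [u _ _]|//]; case: nU; constructor.
by rewrite poweRNyr ?gt_eqF.
Qed.

Lemma prode_ge0 (I : Type) (r : seq I) (P : pred I) (F : I -> \bar R) :
  (forall i, P i -> 0 <= F i) -> 0 <= \prod_(i <- r | P i) F i.
Proof. by move=> F0; elim/big_ind: _ => //; exact: mule_ge0. Qed.

Lemma lee_prod (I : Type) (r : seq I) (P : pred I) (F G : I -> \bar R) :
  (forall i, P i -> 0 <= F i) -> (forall i, P i -> F i <= G i) ->
  \prod_(i <- r | P i) F i <= \prod_(i <- r | P i) G i.
Proof.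
move=> F0 FG; suff : 0 <= \prod_(i <- r | P i) F i <= \prod_(i <- r | P i) G i by case/andP.
elim/big_ind2: _ => [|a b c d /andP[a0 ab] /andP[c0 cd]|i Pi]; rewrite ?lexx ?lee01//.
  by rewrite mule_ge0//= lee_pmul.
by rewrite F0//= FG.
Qed.

Lemma prode_poweR (I : Type) (r : seq I) (F : I -> \bar R) (q : R) :
  (forall i, 0 <= F i) -> (\prod_(i <- r) F i) `^ q = \prod_(i <- r) (F i `^ q).
Proof.
move=> F0; elim: r => [|i r IH]; first by rewrite !big_nil poweR1r.
by rewrite !big_cons poweRM ?IH// prode_ge0.
Qed.

(** The inequality [1 + t <= expR t] at [t = ln (x i) - a], where [a] is the weighted mean of the
    logarithms, so that the linear terms cancel in the weighted sum. A vanishing [x i] makes the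
    product zero. *)
Lemma weighted_AMGM (m : nat) (theta x : 'I_m -> R) :
  (forall i, 0 < theta i)%R -> (\sum_i theta i = 1)%R -> (forall i, 0 <= x i)%R ->
  (\prod_i (x i `^ theta i) <= \sum_i theta i * x i)%R.
Proof.
move=> t0 t1 x0; have [xp|] := pselect (forall i, 0 < x i)%R; last first.
  move=> /existsNP[i /negP]; rewrite -leNgt => xi.
  have xi0 : x i = 0%R by apply/eqP; rewrite eq_le xi x0.
  rewrite (bigD1 i)//= xi0 powR0 ?gt_eqF// mul0r sumr_ge0// => j _.
  by rewrite mulr_ge0// ltW.
pose a := (\sum_i theta i * ln (x i))%R.
have -> : (\prod_i (x i `^ theta i) = expR a)%R.
  by rewrite /a expR_sum; apply: eq_bigr => i _; rewrite /powR gt_eqF.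
have e : (expR a = \sum_i theta i * (expR a * (1 + (ln (x i) - a))))%R.
  under eq_bigr do rewrite mulrCA. rewrite -mulr_sumr.
  under eq_bigr do rewrite mulrDr mulr1 mulrBr.
  by rewrite big_split/= t1 sumrB -mulr_suml t1 mul1r -/a subrr addr0 mulr1.
rewrite {}e; apply: ler_sum => i _; rewrite ler_wpM2l ?(ltW (t0 i))//.
rewrite [leRHS](_ : x i = expR a * expR (ln (x i) - a))%R; last by rewrite -expRD addrC subrK lnK// posrE.
by rewrite ler_wpM2l ?expR_ge0// expR_ge1Dx.
Qed.

(** After division by the sums [A i], the inequality of weighted means applies for each [u], and the
    weights add up to 1. Sums equal to 0 or [+oo] are set apart. *)
Lemma esum_hoelder (U : choiceType) (m : nat) (theta : 'I_m -> R) (a : 'I_m -> U -> \bar R) :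
  (forall i, 0 < theta i)%R -> (\sum_i theta i = 1)%R -> (forall i u, 0 <= a i u) ->
  \esum_(u in [set: U]) \prod_i (a i u `^ theta i) <=
  \prod_i ((\esum_(u in [set: U]) a i u) `^ theta i).
Proof.
move=> t0 t1 a0; pose A i := \esum_(u in [set: U]) a i u.
have A0 i : 0 <= A i by apply: esum_ge0.
have aA i u : a i u <= A i by apply: esum_ge_term.
have [[i Ai]|nA] := pselect (exists i, A i = 0).
  rewrite esum1 ?prode_ge0// => [i' _|u _]; first exact: poweR_ge0.
  have ai : a i u = 0 by apply/eqP; rewrite eq_le a0 -Ai aA.
  by rewrite (bigD1 i)//= ai poweR0r ?gt_eqF// mul0e.
have Ap i : 0 < A i by rewrite lt_neqAle A0 andbT; apply/eqP => Ai; apply: nA; exists i.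
have [[i Ai]|nAy] := pselect (exists i, A i = +oo).
  rewrite [leRHS](bigD1 i)//= -/(A i) Ai poweRyr ?gt_eqF// gt0_mulye ?leey//.
  by elim/big_ind: _ => [|x y|j _]; [by rewrite lte_fin|by move=> ? ?; exact: mule_gt0|by apply: poweR_gt0; exact: Ap].
have Af i : A i \is a fin_num.
  by rewrite ge0_fin_numE// ltey; apply/eqP => Ai; apply: nAy; exists i.
have af i u : a i u \is a fin_num.
  by rewrite ge0_fin_numE// (le_lt_trans (aA i u))// -ge0_fin_numE.
have fA i : (0 < fine (A i))%R by rewrite fine_gt0// Ap/= -ge0_fin_numE.
pose P := (\prod_i (fine (A i) `^ theta i))%R.
have P0 : (0 <= P)%R by apply: prodr_ge0 => i _; exact: powR_ge0.
have -> : \prod_i (A i `^ theta i) = P%:E.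
  rewrite /P -prodEFin; apply: eq_bigr => i _; by rewrite -poweR_EFin fineK.
apply: (@le_trans _ _ (\esum_(u in [set: U]) (P%:E * (\sum_i (theta i / fine (A i))%:E * a i u)))).
  apply: le_esum => u _.
  have -> : \prod_i (a i u `^ theta i) = (P * \prod_i ((fine (a i u) / fine (A i)) `^ theta i))%:E%R.
    rewrite /P -big_split/= -prodEFin; apply: eq_bigr => i _.
    rewrite -powRM ?fine_ge0 ?divr_ge0 ?fine_ge0//.
    by rewrite mulrC divfK ?gt_eqF// -poweR_EFin fineK.
  rewrite EFinM lee_wpmul2l ?lee_fin//.
  apply: (@le_trans _ _ (\sum_i theta i * (fine (a i u) / fine (A i)))%:E%R).
    by rewrite lee_fin; apply: weighted_AMGM => // i; rewrite divr_ge0 ?fine_ge0.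
  rewrite -sumEFin; apply: lee_sum => i _.
  by rewrite -[a i u]fineK// -EFinM lee_fin mulrA mulrAC.
rewrite esumZl//; last first.
  by move=> u; apply: sume_ge0 => i _; rewrite mule_ge0// lee_fin divr_ge0// ltW.
rewrite -[leRHS]mule1 lee_wpmul2l ?lee_fin//.
rewrite esum_sum; last by move=> u i _ _; rewrite mule_ge0// lee_fin divr_ge0// ltW.
apply: (@le_trans _ _ (\sum_i (theta i)%:E)); last by rewrite sumEFin t1.
apply: lee_sum => i _; rewrite esumZl ?(divr_ge0 (ltW (t0 i)) (ltW (fA i)))//.
rewrite (_ : \esum_(_ in _) _ = (fine (A i))%:E); last by rewrite fineK.
by rewrite -EFinM lee_fin divfK ?gt_eqF.
Qed.

End EsumTools.

Section Scales.
Context {R : realType}.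
Local Open Scope ereal_scope.

Lemma dyadic_scale (t : R) : (0 < t)%R -> exists k : int, (e2 k%:~R < t <= e2 (k + 1)%:~R)%R.
Proof.
move=> t0; pose y := (ln t / ln 2)%R.
have l2 : (0 < ln 2 :> R)%R by rewrite ln_gt0// ltr1n.
have ty : t = e2 y by rewrite /e2 /powR gt_eqF// /y divfK ?gt_eqF// lnK.
exists (Num.ceil y - 1)%R; rewrite subrK ty ltr_e2 ler_e2; exact: ceil_itv.
Qed.

Lemma dyadic_scale_lt (t : R) : (0 < t)%R -> exists k : int, (e2 k%:~R <= t < e2 (k + 1)%:~R)%R.
Proof.
move=> t0; have [k /andP[h1 h2]] := dyadic_scale t0.
have [h|h] := eqVneq t (e2 (k + 1)%:~R).
  by exists (k + 1)%R; rewrite h lexx/= ltr_e2 ltr_int ltrDl.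
by exists k; rewrite (ltW h1)/= lt_neqAle h.
Qed.

(* The discrete counterpart of [y ^ q]: the sum of [2 ^ (j q)] over the scales below [y]. *)
Definition scale_sum (q : R) (y : \bar R) : \bar R :=
  \esum_(j in [set: int]) (if (e2 j%:~R)%:E < y then (e2 (j%:~R * q))%:E else 0).

Lemma scale_sum_term_ge0 (q : R) (y : \bar R) (j : int) :
  0 <= (if (e2 j%:~R)%:E < y then (e2 (j%:~R * q))%:E else 0) :> \bar R.
Proof. by case: ifP; rewrite ?lee_fin ?e2_ge0. Qed.

Lemma e2_lt1 (x : R) : (x < 0)%R -> (e2 x < 1)%R.
Proof. by move=> x0; rewrite -[ltRHS]e20 ltr_e2. Qed.

Lemma esum_int_below (J : int) (q : R) : (0 < q)%R ->
  \esum_(j in [set: int]) (if (j <= J)%R then (e2 (j%:~R * q))%:E else 0) <=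
  ((1 - e2 (- q))^-1 * e2 (J%:~R * q))%:E.
Proof.
move=> q0.
apply: (@le_trans _ _ (\esum_(i in [set: nat]) (e2 (J%:~R * q) * e2 (- q) ^+ i)%:E)).
  apply: (esum_countable_le (L := fun i j => j = (J - i%:Z)%R)).
  - by move=> j _; case: ifP; rewrite ?lee_fin ?e2_ge0.
  - by move=> i; rewrite lee_fin mulr_ge0 ?exprn_ge0 ?e2_ge0.
  - move=> j _; case: ifPn => [jJ _|]; last by rewrite eqxx.
    have : (0 <= J - j)%R by rewrite subr_ge0.
    case E : (J - j)%R => [i|//] _; exists i; first by rewrite -E opprB addrC subrK.
    rewrite lee_fin -e2Mn -e2D ler_e2 (_ : j = J - i%:Z)%R; last by rewrite -E opprB addrC subrK.
    by rewrite intrB -pmulrn; lra.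
  - by move=> i j j' _ _ _ _ -> ->.
apply: (le_trans (esum_geometric_le _ _)); first exact: e2_ge0.
  by rewrite e2_ge0 e2_lt1// oppr_lt0.
by rewrite lee_fin mulrC.
Qed.

Lemma scale_sum_le (q : R) (y : \bar R) : (0 < q)%R -> 0 <= y ->
  scale_sum q y <= ((1 - e2 (- q))^-1)%:E * y `^ q.
Proof.
move=> q0; have c0 : (0 < (1 - e2 (- q))^-1)%R by rewrite invr_gt0 subr_gt0 e2_lt1// oppr_lt0.
case: y => [y y0|_|//]; last by rewrite poweRyr ?gt_eqF// gt0_muley ?leey.
have [y00|yn0] := eqVneq y 0%R.
  rewrite /scale_sum esum1 ?mule_ge0 ?poweR_ge0 ?lee_fin ?(ltW c0)// => j _.
  by rewrite lte_fin y00 ltNge e2_ge0.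
have yp : (0 < y)%R by rewrite lt_neqAle eq_sym yn0 -lee_fin.
have [J /andP[h1 h2]] := dyadic_scale yp.
apply: (@le_trans _ _ (\esum_(j in [set: int]) (if (j <= J)%R then (e2 (j%:~R * q))%:E else 0))).
  apply: le_esum => j _; rewrite lte_fin; case: ifPn => [jy|_]; last by case: ifP; rewrite ?lee_fin ?e2_ge0.
  by have := lt_le_trans jy h2; rewrite ltr_e2 ltr_int ltzD1 => ->.
apply: (le_trans (esum_int_below _ q0)); rewrite EFinM lee_wpmul2l ?lee_fin ?(ltW c0)//.
by rewrite ?poweR_EFin ?lee_fin e2M ge0_ler_powR ?nnegrE ?e2_ge0 ?(ltW q0) ?(ltW yp) ?(ltW h1).
Qed.

Lemma le_scale_sum (q : R) (y : \bar R) : (0 < q)%R -> 0 <= y ->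
  y `^ q <= (e2 q)%:E * scale_sum q y.
Proof.
move=> q0; have s0 y' : 0 <= scale_sum q y'.
  by apply: esum_ge0 => j _; exact: scale_sum_term_ge0.
have term (j : int) y' : (e2 j%:~R)%:E < y' -> (e2 (j%:~R * q))%:E <= scale_sum q y'.
  move=> jy; rewrite /scale_sum; apply: le_trans (esum_ge_term (i := j) _ _); rewrite ?jy//.
  by move=> i; exact: scale_sum_term_ge0.
case: y => [y y0|_|//]; last first.
  rewrite poweRyr ?gt_eqF// (_ : scale_sum q +oo = +oo) ?gt0_muley ?lte_fin ?e2_gt0//.
  apply/eqP; rewrite eq_le leey/= leNgt; apply/negP => h.
  have sf : scale_sum q +oo \is a fin_num by rewrite ge0_fin_numE.
  pose s := fine (scale_sum q +oo).
  have [j hj] : exists j : nat, (s < e2 (j%:R * q))%R.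
    have s1 : (0 < s + 1)%R by rewrite ltr_wpDl// fine_ge0.
    have [k /andP[_ hk]] := dyadic_scale s1.
    exists (Num.bound (`|(k + 1)%:~R / q|)%R); apply: (@lt_le_trans _ _ (s + 1)%R); first by rewrite ltrDl.
    apply: (le_trans hk); rewrite ler_e2 -ler_pdivrMr//.
    by apply: (le_trans (ler_norm _)); apply: ltW; exact: archi_boundP.
  have := term j%:Z +oo (ltry _); rewrite -(fineK sf) lee_fin -pmulrn leNgt => /negP; exact.
have [y00|yn0] := eqVneq y 0%R.
  by rewrite y00 poweR0r ?gt_eqF// mule_ge0 ?lee_fin ?e2_ge0.
have yp : (0 < y)%R by rewrite lt_neqAle eq_sym yn0 -lee_fin.
have [J /andP[h1 h2]] := dyadic_scale yp.
apply: (@le_trans _ _ ((e2 q)%:E * (e2 (J%:~R * q))%:E)).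
  rewrite -EFinM -e2D poweR_EFin lee_fin.
  rewrite (_ : q + _ = (J + 1)%:~R * q)%R; last by rewrite intrD; ring.
  by rewrite e2M ge0_ler_powR ?nnegrE ?e2_ge0 ?(ltW q0) ?(ltW yp).
by rewrite lee_wpmul2l ?lee_fin ?e2_ge0//; apply: term; rewrite lte_fin.
Qed.

End Scales.

Section DiscreteNorm.
Context {R : realType} {n : nat}.
Local Notation mu := (lebesgue_Rn R n).
Local Open Scope ereal_scope.

(** The [q]-th power of a norm rather than the norm itself: it is a plain sum over scales, and the
    return to Lorentz and Lebesgue norms takes the root. *)
Definition seqnorm (p q : R) (h : int -> \bar R) : \bar R :=
  \esum_(k in [set: int]) (((e2 (k%:~R / p))%:E * h k) `^ q).

Definition rearr (f : Rn R n -> R) (k : int) : \bar R := rearrangement f (e2 k%:~R).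

Lemma seqnorm_ge0 p q h : 0 <= seqnorm p q h.
Proof. by apply: esum_ge0 => k _; exact: poweR_ge0. Qed.

Section Compare.
Variable f : Rn R n -> R.
Hypothesis mf : measurable_fun [set: Rn R n] f.

Lemma measurable_rearrangement : measurable_fun [set: R] (fun t : R => rearrangement f t).
Proof.
apply: (measurability _ (@ErealGenOInfty.measurableE R)) => _ [_ [r ->] <-].
rewrite setTI (_ : _ @^-1` _ = [set t : R | r%:E < rearrangement f t]); last first.
  by apply/seteqP; split=> t /=; rewrite in_itv/= andbT.
have [r0|r0] := leP 0%R r; last first.
  rewrite (_ : mkset _ = setT)//; apply/seteqP; split=> // t _ /=.
  by apply: lt_le_trans (rearrangement_ge0 f t); rewrite lte_fin.
have := distribution_ge0 f r; case E : (distribution_function f r) => [d||//] d0.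
  rewrite (_ : mkset _ = `]-oo, d[%classic); first exact: measurable_itv.
  by apply/seteqP; split=> t /=; rewrite rearrangement_gt// E lte_fin in_itv.
rewrite (_ : mkset _ = setT)//; apply/seteqP; split=> // t _ /=.
by rewrite rearrangement_gt// E ltry.
Qed.

Definition lorentz_integral (p q : R) : \bar R :=
  \int[@lebesgue_measure R]_(t in `]0%R, +oo[)
     (((t `^ p^-1)%:E * rearrangement f t) `^ q * (t^-1)%:E).

Variables p q : R.
Hypotheses (p_gt0 : (0 < p)%R) (q_gt0 : (0 < q)%R).

(* [t `^ (-1)] rather than [t^-1]: they agree for [t > 0], and only the former has a measurability lemma. *)
Let g (t : R) : \bar R := ((t `^ p^-1)%:E * rearrangement f t) `^ q * (t `^ (-1))%:E.
Let I (k : int) : set R := [set` `]e2 k%:~R, e2 (k + 1)%:~R]].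

Let mI k : measurable (I k). Proof. exact: measurable_itv. Qed.

Let mg : measurable_fun [set: R] g.
Proof.
apply: emeasurable_funM; last by apply/measurable_EFinP; exact: measurable_powR.
apply: (@measurableT_comp _ _ _ _ _ _ (fun y : \bar R => y `^ q)); first exact: measurable_poweR.
apply: emeasurable_funM; last exact: measurable_rearrangement.
apply/measurable_EFinP; exact: measurable_powR.
Qed.

Let lorentz_integral_split :
  lorentz_integral p q = \esum_(k in [set: int]) \int[@lebesgue_measure R]_(t in I k) g t.
Proof.
have D : `]0%R, +oo[%classic = \bigcup_(k in [set: int]) I k.
  apply/seteqP; split=> [t /=|t [k _ /=]]; rewrite !in_itv/= ?andbT => h.
    have [k hk] := dyadic_scale h; by exists k => //=; rewrite in_itv.
  by have /andP[h1 _] := h; rewrite (lt_trans _ h1)// e2_gt0.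
have mD : measurable (`]0%R, +oo[%classic : set R) by exact: measurable_itv.
have Ik k : I k `<=` `]0%R, +oo[%classic by rewrite D => t It; exists k.
transitivity (\int[@lebesgue_measure R]_(t in `]0%R, +oo[) (g \_ `]0%R, +oo[) t).
  apply: eq_integral => t /[!inE] Dt; rewrite patchE mem_set// /g powR_inv1//.
  by move: Dt; rewrite /= in_itv/= andbT => /ltW.
rewrite [in LHS]D ge0_integral_bigcup_esum//.
- apply: eq_esum => k _; apply: eq_integral => t /[!inE] ?; rewrite patchE mem_set//; by exists k.
- exact: countableP.
- by move=> i _; exact: mI.
- move=> k l _ _ [t []]; rewrite /I /= !in_itv/= => /andP[h1 h2] /andP[h3 h4].
  have := lt_le_trans h1 h4; have := lt_le_trans h3 h2; rewrite !ltr_e2 !ltr_int !ltzD1 => ? ?.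
  by apply/eqP; rewrite eq_le; apply/andP.
- by rewrite -D; apply/(measurable_restrictT _ mD); exact: measurable_funS mg.
- move=> t; rewrite patchE; rewrite -D; case: ifP => // _.
  by rewrite mule_ge0 ?poweR_ge0// lee_fin powR_ge0.
Qed.

Let leb_I k : lebesgue_measure (I k) = (e2 k%:~R)%:E.
Proof.
rewrite /I lebesgue_measure_itv/= lte_fin ltr_e2 ltr_int ltrDl ltr01.
rewrite -EFinD intrD e2D e21; congr (_%:E); rewrite [(_ * 2)%R]mulr_natr mulr2n addrK//.
Qed.

Let integral_I (c : \bar R) k : \int[@lebesgue_measure R]_(t in I k) c = c * (e2 k%:~R)%:E.
Proof. by rewrite integral_cst; [congr (_ * _); exact: leb_I|exact: mI]. Qed.

Lemma lorentz_integral_le :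
  lorentz_integral p q <= (e2 (q / p))%:E * seqnorm p q (rearr f).
Proof.
rewrite lorentz_integral_split -esumZl ?e2_ge0//; last by move=> k; exact: poweR_ge0.
apply: le_esum => k _; set c := _ `^ q.
have c0 : 0 <= c by exact: poweR_ge0.
apply: (@le_trans _ _ (\int[@lebesgue_measure R]_(t in I k) (((e2 (q / p))%:E * c * (e2 (- k%:~R))%:E)))).
  apply: ge0_le_integral => //; first exact: mI.
  - by move=> t _; rewrite mule_ge0 ?poweR_ge0// lee_fin powR_ge0.
  - exact: measurable_funS mg.
  - move=> t; rewrite /I/= in_itv/= => /andP[t1 t2].
    have t0 : (0 < t)%R by apply: lt_trans t1; exact: e2_gt0.
    apply: lee_pmul; rewrite ?poweR_ge0 ?lee_fin ?powR_ge0//; last first.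
      rewrite powR_inv1 ?(ltW t0)//.
      by rewrite e2N lef_pV2 ?posrE ?e2_gt0// ltW.
    rewrite [(q / p)%R]mulrC e2M /c -[X in _ <= X * _]poweR_EFin -poweRM ?lee_fin ?e2_ge0 ?mule_ge0 ?rearrangement_ge0 ?lee_fin ?e2_ge0//.
    apply: le_poweR; [exact: ltW| by rewrite mule_ge0 ?lee_fin ?powR_ge0 ?rearrangement_ge0|].
    rewrite muleA -EFinM -e2D; apply: lee_pmul; rewrite ?lee_fin ?powR_ge0 ?rearrangement_ge0//.
      rewrite (_ : p^-1 + k%:~R / p = (k + 1)%:~R * p^-1)%R; last by rewrite intrD; ring.
      by rewrite e2M ge0_ler_powR ?nnegrE ?invr_ge0 ?e2_ge0 ?(ltW p_gt0) ?(ltW t0).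
    by apply: rearrangement_antitone => //; exact: ltW.
rewrite integral_I -muleA -EFinM -e2D addNr e20 mule1//.
Qed.

(** On the interval of scale [k] the rearrangement is bounded below by its value at the right
    endpoint, hence the shift by one. The factor 2 comes from bounding [1 / t] below by
    [2 ^ (- (k + 1))] on an interval of length [2 ^ k]. *)
Lemma lorentz_integral_ge :
  seqnorm p q (rearr f) <= (2 * e2 (q / p))%:E * lorentz_integral p q.
Proof.
rewrite lorentz_integral_split -esumZl ?mulr_ge0 ?e2_ge0//; last first.
  by move=> k; apply: integral_ge0 => t _; rewrite mule_ge0 ?poweR_ge0// lee_fin powR_ge0.
rewrite /seqnorm (esum_shift _ 1); apply: le_esum => k _.
pose c := ((e2 (k%:~R / p))%:E * rearr f (k + 1)) `^ q.
have c0 : 0 <= c by exact: poweR_ge0.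
apply: (@le_trans _ _ ((2 * e2 (q / p))%:E * \int[@lebesgue_measure R]_(t in I k) (c * (e2 (- (k + 1)%:~R))%:E))).
  rewrite integral_I -muleA -EFinM -e2D.
  rewrite (_ : - (k + 1)%:~R + k%:~R = - 1)%R; last by rewrite intrD; ring.
  rewrite muleCA -EFinM e2N e21 mulrAC mulfV// mul1r [leRHS]muleC.
  rewrite /c [(q / p)%R]mulrC (e2M p^-1 q) -[X in _ <= X * _]poweR_EFin -poweRM ?lee_fin ?e2_ge0 ?mule_ge0 ?rearrangement_ge0 ?lee_fin ?e2_ge0//.
  by rewrite muleA -EFinM -e2D (_ : p^-1 + k%:~R / p = (k + 1)%:~R / p)%R// intrD; ring.
apply: lee_wpmul2l; first by rewrite lee_fin mulr_ge0 ?e2_ge0.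
apply: ge0_le_integral => //; first exact: mI.
- by move=> t _; rewrite mule_ge0// lee_fin e2_ge0.
- exact: measurable_funS mg.
- move=> t; rewrite /I/= in_itv/= => /andP[t1 t2].
  have t0 : (0 < t)%R by apply: lt_trans t1; exact: e2_gt0.
  apply: lee_pmul; rewrite ?lee_fin ?e2_ge0//; last first.
    by rewrite powR_inv1 ?(ltW t0)// e2N lef_pV2 ?posrE ?e2_gt0.
  apply: le_poweR; [exact: ltW| by rewrite mule_ge0 ?lee_fin ?e2_ge0 ?rearrangement_ge0|].
  apply: lee_pmul; rewrite ?lee_fin ?e2_ge0 ?rearrangement_ge0//.
    by rewrite e2M ge0_ler_powR ?nnegrE ?invr_ge0 ?e2_ge0 ?(ltW p_gt0) ?(ltW t0) ?(ltW t1).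
  by apply: rearrangement_antitone.
Qed.

End Compare.

Section PowerIntegral.
Variables (f : Rn R n -> R) (q : R).
Hypothesis mf : measurable_fun [set: Rn R n] f.
Hypothesis q_gt0 : (0 < q)%R.

(** Discrete layer-cake formula: both sides sum [2 ^ (j q) * 2 ^ k] over the pairs [(j, k)] with
    [2 ^ k] below the distribution function at [2 ^ j], which is the same as [2 ^ j] below the
    rearrangement at [2 ^ k]. *)
Lemma scale_sum_distribution : \esum_(j in [set: int]) ((e2 (j%:~R * q))%:E * scale_sum 1 (distribution_function f (e2 j%:~R))) =
  \esum_(k in [set: int]) ((e2 k%:~R)%:E * scale_sum q (rearr f k)).
Proof.
pose a (j k : int) : \bar R := (e2 (j%:~R * q))%:E * (if (e2 k%:~R)%:E < distribution_function f (e2 j%:~R) then (e2 (k%:~R * 1))%:E else 0).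
transitivity (\esum_(j in [set: int]) \esum_(k in [set: int]) a j k).
  apply: eq_esum => j _; rewrite -esumZl ?e2_ge0// => k; exact: scale_sum_term_ge0.
rewrite esum_exchange; last by move=> j k; rewrite /a mule_ge0 ?lee_fin ?e2_ge0 ?scale_sum_term_ge0.
apply: eq_esum => k _; rewrite -esumZl ?e2_ge0//; last by move=> j; exact: scale_sum_term_ge0.
apply: eq_esum => j _; rewrite /a /rearr -rearrangement_gt ?e2_ge0// mulr1.
by case: ifP => _; rewrite ?mule0// muleC.
Qed.

Lemma scale_sum_layers x : scale_sum q `|f x|%:E =
  \esum_(j in [set: int]) ((e2 (j%:~R * q))%:E * (\1_[set x | (e2 j%:~R < `|f x|)%R] x)%:E).
Proof.
apply: eq_esum => j _; rewrite lte_fin indicE.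
by case: ifPn => h; [rewrite mem_set ?mule1|rewrite memNset ?mule0//=; exact/negP].
Qed.

Lemma measurable_layer (j : int) : measurable_fun [set: Rn R n]
  (fun x => (e2 (j%:~R * q))%:E * (\1_[set x | (e2 j%:~R < `|f x|)%R] x)%:E).
Proof.
apply: emeasurable_funM; [exact: measurable_cst|apply/measurable_EFinP; apply: measurable_indic].
exact: measurable_gt_norm.
Qed.

Lemma layer_ge0 (j : int) x : 0 <= (e2 (j%:~R * q))%:E * (\1_[set x | (e2 j%:~R < `|f x|)%R] x)%:E.
Proof. by rewrite mule_ge0 ?lee_fin ?e2_ge0. Qed.

Lemma integral_scale_sum : \int[mu]_x scale_sum q `|f x|%:E =
  \esum_(j in [set: int]) ((e2 (j%:~R * q))%:E * distribution_function f (e2 j%:~R)).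
Proof.
under eq_integral do rewrite scale_sum_layers.
rewrite (integral_esum _ measurable_layer layer_ge0); apply: eq_esum => j _; rewrite ge0_integralZl_EFin ?e2_ge0//; last first.
  by apply/measurable_EFinP; apply: measurable_indic; exact: measurable_gt_norm.
by rewrite integral_indic ?setIT//; exact: measurable_gt_norm.
Qed.

Lemma measurable_scale_sum : measurable_fun [set: Rn R n] (fun x => scale_sum q `|f x|%:E).
Proof. by under eq_fun do rewrite scale_sum_layers; exact: (measurable_esum measurable_layer layer_ge0). Qed.

Definition power_integral : \bar R := \int[mu]_x (((`|f x| `^ q)%R)%:E).

Lemma seqnorm_diag : seqnorm q q (rearr f) = \esum_(k in [set: int]) ((e2 k%:~R)%:E * rearr f k `^ q).
Proof.
apply: eq_esum => k _; rewrite poweRM ?lee_fin ?e2_ge0 ?rearrangement_ge0// poweR_EFin -e2M.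
by rewrite divfK ?gt_eqF.
Qed.

Let c1 : R := (1 - e2 (- q))^-1.
Let c1_gt0 : (0 < c1)%R. Proof. by rewrite invr_gt0 subr_gt0 e2_lt1// oppr_lt0. Qed.

(** Powers are exchanged for [scale_sum], which passes from the rearrangement to the distribution
    function and then to an integral. The exchange costs [e2 q] on the rearrangement, its inverse 2
    on the distribution function and [c1] on [|f|]. *)
Lemma seqnorm_le_power_integral :
  seqnorm q q (rearr f) <= (e2 q * 2 * c1)%:E * power_integral.
Proof.
have s0 q' y : 0 <= @scale_sum R q' y by apply: esum_ge0 => j _; exact: scale_sum_term_ge0.
rewrite seqnorm_diag.
apply: (@le_trans _ _ (\esum_(k in [set: int]) ((e2 q)%:E * ((e2 k%:~R)%:E * scale_sum q (rearr f k))))).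
  apply: le_esum => k _; rewrite muleCA lee_wpmul2l ?lee_fin ?e2_ge0//.
  by apply: le_scale_sum => //; exact: rearrangement_ge0.
rewrite esumZl ?e2_ge0//; last by move=> k; rewrite mule_ge0 ?lee_fin ?e2_ge0.
rewrite -scale_sum_distribution -mulrA EFinM -muleA lee_wpmul2l ?lee_fin ?e2_ge0//.
apply: (@le_trans _ _ (\esum_(j in [set: int]) (2%:E * ((e2 (j%:~R * q))%:E * distribution_function f (e2 j%:~R))))).
  apply: le_esum => j _; rewrite muleCA lee_wpmul2l ?lee_fin ?e2_ge0//.
  have := @scale_sum_le R 1 _ ltr01 (distribution_ge0 f (e2 j%:~R)).
  rewrite poweRe1 ?distribution_ge0// e2N e21.
  rewrite (_ : (1 - 2^-1)^-1 = 2 :> R)%R//.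
  by apply/eqP; rewrite -(inj_eq invr_inj) invrK; apply/eqP; lra.
rewrite esumZl//; last by move=> k; rewrite mule_ge0 ?lee_fin ?e2_ge0 ?distribution_ge0.
rewrite -integral_scale_sum EFinM -muleA lee_wpmul2l ?lee_fin//.
rewrite /power_integral -ge0_integralZl_EFin ?(ltW c1_gt0)//; last exact: measurable_powR_norm.
apply: ge0_le_integral => //.
- exact: measurable_scale_sum.
- by apply: emeasurable_funM; [exact: measurable_cst|exact: measurable_powR_norm].
- by move=> x _; rewrite -poweR_EFin; apply: scale_sum_le; rewrite ?lee_fin.
Qed.

Lemma power_integral_le_seqnorm :
  power_integral <= (e2 q * 2 * c1)%:E * seqnorm q q (rearr f).
Proof.
have s0 q' y : 0 <= @scale_sum R q' y by apply: esum_ge0 => j _; exact: scale_sum_term_ge0.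
apply: (@le_trans _ _ (\int[mu]_x ((e2 q)%:E * scale_sum q `|f x|%:E))).
  apply: ge0_le_integral => //.
  - exact: measurable_powR_norm.
  - by apply: emeasurable_funM; [exact: measurable_cst|exact: measurable_scale_sum].
  - by move=> x _; rewrite -[X in X <= _]poweR_EFin; apply: le_scale_sum; rewrite ?lee_fin.
rewrite ge0_integralZl_EFin ?e2_ge0//; last exact: measurable_scale_sum.
rewrite -mulrA EFinM -muleA lee_wpmul2l ?lee_fin ?e2_ge0//.
rewrite integral_scale_sum.
apply: (@le_trans _ _ (\esum_(j in [set: int]) (2%:E * ((e2 (j%:~R * q))%:E * scale_sum 1 (distribution_function f (e2 j%:~R)))))).
  apply: le_esum => j _; rewrite muleCA lee_wpmul2l ?lee_fin ?e2_ge0//.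
  have := @le_scale_sum R 1 _ ltr01 (distribution_ge0 f (e2 j%:~R)).
  by rewrite poweRe1 ?distribution_ge0// e21.
rewrite esumZl//; last by move=> k; rewrite mule_ge0 ?lee_fin ?e2_ge0.
rewrite EFinM -muleA lee_wpmul2l ?lee_fin// scale_sum_distribution seqnorm_diag -esumZl ?(ltW c1_gt0)//; last first.
  by move=> k; rewrite mule_ge0 ?lee_fin ?e2_ge0 ?poweR_ge0.
apply: le_esum => k _; rewrite muleCA lee_wpmul2l ?lee_fin ?e2_ge0//.
by apply: scale_sum_le => //; exact: rearrangement_ge0.
Qed.

End PowerIntegral.

(* A discrete Hardy inequality: bounding the power of the supremum by the sum of powers, each [u] only
   contributes a translate of [h], and the factors so obtained are geometric in [u]. *)
Lemma seqnorm_sup_shift (p q al : R) (c : int) (h : int -> \bar R) :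
  (0 < q)%R -> (al < c%:~R / p)%R -> (forall k, 0 <= h k) ->
  seqnorm p q (fun k => ereal_sup (range (fun u : nat => (e2 (u%:R * al))%:E * h (k + c * u%:Z)%R))) <=
  ((1 - e2 (q * (al - c%:~R / p)))^-1)%:E * seqnorm p q h.
Proof.
move=> q0 alc h0; pose x (k : int) (u : nat) : \bar R := (e2 (u%:R * al))%:E * h (k + c * u%:Z)%R.
have x0 k u : 0 <= x k u by rewrite mule_ge0 ?lee_fin ?e2_ge0.
apply: (@le_trans _ _ (\esum_(k in [set: int]) \esum_(u in [set: nat]) ((e2 (k%:~R / p))%:E * x k u) `^ q)).
  apply: le_esum => k _.
  have s0 : 0 <= ereal_sup (range (x k)) by apply: le_ereal_sup_tmp; exists (x k 0%N) => //; exists 0%N.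
  rewrite poweRM ?lee_fin ?e2_ge0// poweR_EFin.
  apply: (@le_trans _ _ ((e2 (k%:~R / p) `^ q)%:E * \esum_(u in [set: nat]) (x k u `^ q))).
    by rewrite lee_wpmul2l ?lee_fin ?powR_ge0//; exact: (@esum_le_sup R nat (x k) q q0 (x0 k)).
  rewrite -esumZl ?powR_ge0//; last by move=> u; exact: poweR_ge0.
  by apply: le_esum => u _; rewrite poweRM ?lee_fin ?e2_ge0// poweR_EFin.
rewrite esum_exchange; last by move=> k u; exact: poweR_ge0.
pose t := (e2 (q * (al - c%:~R / p)))%R.
have t1 : (t < 1)%R by rewrite e2_lt1// pmulr_rlt0// subr_lt0.
apply: (@le_trans _ _ (\esum_(u in [set: nat]) ((1 * t ^+ u)%:E * seqnorm p q h))).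
  apply: le_esum => u _; rewrite (esum_shift _ (- (c * u%:Z))%R) /seqnorm mul1r -esumZl ?exprn_ge0 ?e2_ge0//; last first.
    by move=> k; exact: poweR_ge0.
  apply: le_esum => k _; rewrite /x subrK.
  rewrite muleA -EFinM -e2D !poweRM ?lee_fin ?e2_ge0// muleA.
  rewrite lee_wpmul2r ?poweR_ge0// !poweR_EFin -EFinM lee_fin -!e2M -e2Mn -e2D ler_e2.
  by rewrite intrB intrM -[(u%:Z)%:~R]pmulrn le_eqVlt; apply/orP; left; apply/eqP; ring.
under eq_esum do rewrite muleC.
have [Xy|Xy] := eqVneq (seqnorm p q h) +oo.
  by rewrite Xy gt0_muley ?leey// lte_fin invr_gt0 subr_gt0.
have Xf : seqnorm p q h \is a fin_num by rewrite ge0_fin_numE ?seqnorm_ge0// ltey.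
rewrite -(fineK Xf) esumZl ?fine_ge0 ?seqnorm_ge0//; last first.
  by move=> u; rewrite lee_fin mul1r exprn_ge0 ?e2_ge0.
rewrite muleC lee_wpmul2r ?lee_fin ?fine_ge0 ?seqnorm_ge0//.
by have := @esum_geometric_le R 1 _ ler01; rewrite -[X in _ <= X%:E]div1r; apply; rewrite e2_ge0.
Qed.

(** The shifted supremum with step [c = - 1] and [al = - kap]: going down [u] scales loses
    [2 ^ (u / p)], for which [kap > 1 / p] compensates. *)
Lemma seqnorm_gtail (f : Rn R n -> R) (p q kap : R) : (0 < q)%R -> (p^-1 < kap)%R ->
  seqnorm p q (fun k => gtail f kap k%:~R) <=
  ((1 - e2 (q * (p^-1 - kap)))^-1)%:E * seqnorm p q (rearr f).
Proof.
move=> q0 pk; have -> : (fun k : int => gtail f kap k%:~R) = (fun k => ereal_sup (range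
    (fun u : nat => (e2 (u%:R * - kap))%:E * rearr f (k + - 1 * u%:Z)%R))).
  apply: funext => k; rewrite /gtail; congr (ereal_sup _); apply: eq_imagel => u _.
  by rewrite mulrN /rearr mulN1r intrB pmulrn.
have := @seqnorm_sup_shift p q (- kap) (- 1) (rearr f) q0.
rewrite mulrN1z mulN1r opprK [(- kap + _)%R]addrC ltrN2 => /(_ pk); apply => k.
exact: rearrangement_ge0.
Qed.

End DiscreteNorm.

(** * Sums over sparse families *)

Section Generations.
Context {R : realType} {n : nat}.
Hypothesis n_gt0 : (0 < n)%N.
Local Notation mu := (lebesgue_Rn R n).
Variables (eta : R) (S : set (cube R n)).
Hypothesis eta_lt1 : eta < 1.
Hypothesis gS : grid S.
Hypothesis sparseS : forall Q, S Q ->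
  (mu (\bigcup_(Q' in S `&` [set Q' | cube_set Q' `<` cube_set Q]) cube_set Q')
   <= (1 - eta)%:E * mu (cube_set Q))%E.

(** What is left of [F] after [i] removals of the maximal cubes, so all later generations are
    included; the [i]-th generation proper consists of the maximal cubes of this set. *)
Fixpoint generation (F : set (cube R n)) (i : nat) : set (cube R n) :=
  if i is i'.+1 then generation F i' `\` maxcubes (generation F i') else F.

Lemma generation_sub F i : generation F i `<=` F.
Proof. by elim: i => //= i IH Q [/IH]. Qed.

Variables (F : set (cube R n)) (M : R).
Hypothesis FS : F `<=` S.
Hypothesis FM : forall Q, F Q -> side Q <= M.

Let gG i : grid (generation F i).
Proof. by apply: (grid_sub _ gS) => Q /generation_sub/FS. Qed.
Let GM i Q : generation F i Q -> side Q <= M.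
Proof. by move=> /generation_sub/FM. Qed.

(** A cube surviving a removal lies strictly inside a maximal cube of the previous stage, where
    sparseness leaves only the fraction [1 - eta] of the measure. *)
Lemma measure_generation i :
  (mu (\bigcup_(Q in generation F i) cube_set Q) <=
   ((1 - eta) ^+ i)%:E * mu (\bigcup_(Q in F) cube_set Q))%E.
Proof.
have e0 : 0 <= 1 - eta by rewrite subr_ge0 ltW.
elim: i => [|i IH]; first by rewrite expr0 mul1e.
pose D Q := \bigcup_(Q' in S `&` [set Q' | cube_set Q' `<` cube_set Q]) cube_set Q'.
have mD Q : measurable (D Q).
  by apply: measurable_bigcup_cubes; apply: (grid_sub _ gS) => Q' [].
apply: (@le_trans _ _ (mu (\bigcup_(Q in maxcubes (generation F i)) D Q))).
  apply: le_measure; rewrite ?inE; first exact: measurable_bigcup_cubes.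
    by apply: countable_bigcup_measurable => //; exact: countable_maxcubes.
  move=> x [Q [GQ nmQ] Qx].
  have [Q' mQ' QQ'] := maxcubes_ex n_gt0 (@gG i) (@GM i) GQ.
  exists Q' => //; exists Q => //; split; first by apply: FS; exact: generation_sub GQ.
  rewrite /= properEneq; split=> //; apply/eqP => /(cube_set_inj n_gt0) e.
  by apply: nmQ; rewrite e.
apply: (le_trans (measure_bigcup_le_esum _ _ _)) => //; first exact: countable_maxcubes.
apply: (@le_trans _ _ (\esum_(Q in maxcubes (generation F i)) ((1 - eta)%:E * mu (cube_set Q)))%E).
  apply: le_esum => Q [GQ _]; apply: sparseS; apply: FS; exact: generation_sub GQ.
rewrite esumZl// -(lebesgue_bigcup_maxcubes n_gt0 (@gG i) (@GM i)).
by rewrite exprS EFinM -muleA lee_wpmul2l.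
Qed.

(** A cube surviving every removal would have measure at most [(1 - eta) ^ i] times a fixed finite
    number, for all [i]. *)
Lemma generation_ex Q : 0 < eta -> (mu (\bigcup_(Q in F) cube_set Q) < +oo)%E -> F Q ->
  exists i, maxcubes (generation F i) Q.
Proof.
move=> eta0 finF FQ; apply: contrapT => nex.
have GQ i : generation F i Q.
  by elim: i => // i IH; split=> // mQ; apply: nex; exists i.
pose V := fine (mu (\bigcup_(Q in F) cube_set Q)).
have VE : mu (\bigcup_(Q in F) cube_set Q) = V%:E by rewrite fineK// ge0_fin_numE.
have low i : side Q ^+ n <= (1 - eta) ^+ i * V.
  rewrite -lee_fin -lebesgue_cube EFinM -VE; apply: le_trans (measure_generation i).
  apply: le_measure; rewrite ?inE; [exact: measurable_cube|exact: measurable_bigcup_cubes|].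
  by move=> x Qx; exists Q.
have V0 : 0 < V by have := low 0%N; rewrite expr0 mul1r; apply: lt_le_trans; rewrite exprn_gt0 ?side_gt0.
have [i _ /(_ i (leqnn i)) hi] : \forall i \near \oo, (1 - eta) ^+ i < side Q ^+ n / V.
  apply: (cvgr_lt 0); last by rewrite divr_gt0 ?exprn_gt0 ?side_gt0.
  by apply: cvg_expr; rewrite ger0_norm ?subr_ge0 ?(ltW eta_lt1)// gtrBl.
by move: hi; rewrite ltr_pdivlMr// ltNge low.
Qed.

End Generations.

Lemma measure_bigsetU_le d (T : measurableType d) (R : realType) (mu : {measure set T -> \bar R})
    (I : Type) (r : seq I) (F : I -> set T) : (forall i, measurable (F i)) ->
  (mu (\big[setU/set0]_(i <- r) F i) <= \sum_(i <- r) mu (F i))%E.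
Proof.
move=> mF; elim: r => [|i r IH]; first by rewrite !big_nil measure0.
rewrite !big_cons; apply: (le_trans (measureU2 _ _ _)) => //; last exact: leeD.
exact: bigsetU_measurable.
Qed.

Section Layers.
Context {R : realType} {n : nat}.
Hypothesis n_gt0 : (0 < n)%N.
Local Notation mu := (lebesgue_Rn R n).

Definition tail_weight (A : R) (a : nat) (w : cube R n -> Rn R n -> R) :=
  [/\ (forall Q, measurable_fun [set: Rn R n] (w Q)), (forall Q x, 0 <= w Q x) &
      forall Q s, 0 < s ->
        (mu (cube_set Q `&` [set x | (s < w Q x)%R]) <= (A * s^-1 ^+ a)%:E * mu (cube_set Q))%E].

(* On each layer the cubes are disjoint, so at most one term survives at [x], and it is at most
   [aa u * ss u] once the set where the weight exceeds [ss u] has been discarded. *)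
Lemma layered_sum (U : countType) (A : R) (a : nat) (w : cube R n -> Rn R n -> R)
    (S : set (cube R n)) (D : set (Rn R n)) (Lay : U -> set (cube R n))
    (c : cube R n -> \bar R) (aa ss : U -> R) (v : U -> \bar R) :
  tail_weight A a w -> 0 <= A ->
  (forall Q, 0 <= c Q)%E -> (forall u, 0 <= aa u) -> (forall u, 0 < ss u) ->
  (forall u, grid (Lay u)) ->
  (forall u Q Q' x, Lay u Q -> Lay u Q' -> cube_set Q x -> cube_set Q' x -> Q = Q') ->
  (forall u, mu (\bigcup_(Q in Lay u) cube_set Q) <= v u)%E ->
  (forall Q x, S Q -> D x -> cube_set Q x -> c Q != 0%E ->
     exists2 u, Lay u Q & (c Q <= (aa u)%:E)%E) ->
  exists E, [/\ measurable E,
    (mu E <= \esum_(u in [set: U]) ((A * (ss u)^-1 ^+ a)%:E * v u))%E &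
    forall x, D x -> ~ E x ->
      (\esum_(Q in S) (c Q * (w Q x)%:E * (\1_(cube_set Q) x)%:E)
        <= \esum_(u in [set: U]) (aa u * ss u)%:E)%E].
Proof.
move=> [mw w0 tw] A0 c0 aa0 ss0 gL dL muL cover.
have cL u : countable (Lay u) by exact: grid_countable.
pose Eu u := \bigcup_(Q in Lay u) (cube_set Q `&` [set x | ss u < w Q x]).
have mQw u Q : measurable (cube_set Q `&` [set x | ss u < w Q x]).
  apply: measurableI; first exact: measurable_cube.
  rewrite (_ : mkset _ = w Q @^-1` `]ss u, +oo[); last by apply/seteqP; split=> x /=; rewrite in_itv/= andbT.
  by rewrite -[X in measurable X]setTI; apply: mw => //; exact: measurable_itv.
have mEu u : measurable (Eu u) by exact: countable_bigcup_measurable.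
exists (\bigcup_u Eu u); split.
- by apply: countable_bigcup_measurable => //; exact: countableP.
- apply: (le_trans (measure_bigcup_le_esum _ _ _)) => //; first exact: countableP.
  apply: le_esum => u _.
  have As0 : 0 <= A * (ss u)^-1 ^+ a by rewrite mulr_ge0// exprn_ge0// invr_ge0 ltW.
  apply: (le_trans (measure_bigcup_le_esum _ _ _)) => //.
  apply: (@le_trans _ _ (\esum_(Q in Lay u) ((A * (ss u)^-1 ^+ a)%:E * mu (cube_set Q)))%E).
    by apply: le_esum => Q _; exact: tw.
  rewrite esumZl// lee_wpmul2l ?lee_fin//; apply: le_trans (muL u).
  rewrite measure_bigcup_esum// => [Q _|Q Q' LQ LQ' [x [Qx Q'x]]]; first exact: measurable_cube.
  exact: dL LQ LQ' Qx Q'x.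
- move=> x Dx nE.
  have t0 Q : (0 <= c Q * (w Q x)%:E * (\1_(cube_set Q) x)%:E)%E.
    by rewrite !mule_ge0 ?lee_fin.
  have inQ Q : (c Q * (w Q x)%:E * (\1_(cube_set Q) x)%:E)%E != 0%E -> cube_set Q x /\ c Q != 0%E.
    move=> h; split; last by apply: contraNneq h => ->; rewrite !mul0e.
    by apply: contrapT => nQx; move: h; rewrite indicE memNset// mule0 eqxx.
  apply: (esum_countable_le (L := fun u Q => Lay u Q)) => //.
  + by move=> u; rewrite lee_fin mulr_ge0// ltW.
  + move=> Q SQ /inQ[Qx cQ]; have [u LQ cu] := cover Q x SQ Dx Qx cQ; exists u => //.
    rewrite indicE mem_set// mule1 EFinM; apply: lee_pmul; rewrite ?lee_fin//.
    by rewrite leNgt; apply/negP => h; apply: nE; exists u => //; exists Q.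
  + by move=> u Q Q' _ _ /inQ[Qx _] /inQ[Q'x _] LQ LQ'; exact: dL LQ LQ' Qx Q'x.
Qed.

(** Only the factors with [g s = false] depend on [x]; those with [g s = true] are numbers, to be
    absorbed by power means. *)
Definition osc_weight (l : nat) (b : 'I_l -> Rn R n -> R) (B : 'I_l -> R)
    (g : {ffun 'I_l -> bool}) (Q : cube R n) (x : Rn R n) : R :=
  \prod_(s < l | ~~ g s) (`|b s x - mean Q (b s)| / B s).

(* John-Nirenberg with exponent [l * a]: a product of [l] factors exceeds [s] only if one of them
   exceeds [s ^ (1/l)]. *)
Lemma osc_weight_tail (l a : nat) : (0 < l)%N -> (0 < a)%N ->
  exists2 A : R, 0 < A & forall (b : 'I_l -> Rn R n -> R) (B : 'I_l -> R) g,
    (forall s, BMO (b s)) -> (forall s, 0 < B s) -> (forall s, bmo_norm (b s) <= (B s)%:E)%E ->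
    tail_weight A a (osc_weight b B g).
Proof.
move=> l0 a0; have al0 : (0 < l * a)%N by rewrite muln_gt0 l0.
have [C C0 HC] := bmo_osc_power R n_gt0 al0.
(* The summand 1 serves [s <= 1], where [s^-1 ^+ a] is at least 1 and the whole cube is an
   admissible bound; the other adds up the [l] events, one for each factor. *)
exists (1 + l%:R * C); first by rewrite ltr_wpDr// mulr_ge0// ltW.
move=> b B g bBMO B0 bB.
have mb s : measurable_fun [set: Rn R n] (fun x => b s x) by case: (bBMO s).
have mosc s Q : measurable_fun [set: Rn R n] (fun x => `|b s x - mean Q (b s)| / B s).
  apply: measurable_funM; last exact: measurable_cst.
  by apply: measurableT_comp => //; exact: measurable_osc.
have o0 s Q x : 0 <= `|b s x - mean Q (b s)| / B s by rewrite divr_ge0// ltW.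
have mw Q : measurable_fun [set: Rn R n] (osc_weight b B g Q).
  rewrite /osc_weight; under eq_fun do rewrite big_mkcond/=.
  by apply: measurable_prod => s _; case: (g s) => /=; [exact: measurable_cst|exact: mosc].
have mgt (h : Rn R n -> R) (r : R) Q : measurable_fun [set: Rn R n] h ->
    measurable (cube_set Q `&` [set x | r < h x]).
  move=> mh; apply: measurableI; first exact: measurable_cube.
  rewrite (_ : mkset _ = h @^-1` `]r, +oo[); last by apply/seteqP; split=> x /=; rewrite in_itv/= andbT.
  by rewrite -[X in measurable X]setTI; apply: mh => //; exact: measurable_itv.
split=> [Q|Q x|Q s s0]; [exact: mw|by apply: prodr_ge0 => s _|].
have mQ := measurable_cube Q.
have V0 : 0 <= side Q ^+ n by rewrite exprn_ge0// ltW// side_gt0.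
have sa0 : 0 <= s^-1 ^+ a by rewrite exprn_ge0// invr_ge0 ltW.
have [s1|s1] := leP s 1.
  apply: (@le_trans _ _ (mu (cube_set Q))).
    by apply: le_measure; rewrite ?inE//; exact: mgt.
  rewrite lebesgue_cube -EFinM lee_fin ler_peMl//.
  apply: (@le_trans _ _ (1 * s^-1 ^+ a)); last by rewrite ler_wpM2r// lerDl mulr_ge0// ltW.
  by rewrite mul1r exprn_ege1// -[leLHS]invr1 lef_pV2 ?posrE.
pose E (j : 'I_l) := cube_set Q `&` [set x | s < (`|b j x - mean Q (b j)| / B j) ^+ l].
have mE j : measurable (E j) by apply: mgt; apply: measurable_funX; exact: mosc.
have muE j : (mu (E j) <= (C * s^-1 ^+ a * side Q ^+ n)%:E)%E.
  have ib (Q' : cube R n) : mu.-integrable (cube_set Q') (EFin \o b j) by case: (bBMO j).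
  have avg Q' : (average_abs Q' (fun x => (b j x - mean Q' (b j))%R) <= (B j)%:E)%E.
    by apply: le_trans (bB j); apply: ereal_sup_ubound; exists Q'.
  have := HC (b j) (B j) (mb j) ib (B0 j) avg Q.
  set h := fun x => _; move=> hC.
  have mh : measurable_fun [set: Rn R n] h.
    by apply/measurable_EFinP; apply: measurable_funX; exact: mosc.
  have h0 x : (0 <= h x)%E by rewrite lee_fin exprn_ge0.
  have : ((s ^+ a)%:E * mu (E j) <= C%:E * mu (cube_set Q))%E.
    apply: le_trans hC; apply: (@le_trans _ _ (\int[mu]_(x in E j) h x)%E).
      rewrite -integral_cst//; apply: ge0_le_integral => //.
      - by move=> x _; rewrite lee_fin exprn_ge0// ltW.
      - exact: measurable_funS mh.
      - move=> x [_ /= sx]; rewrite lee_fin exprM lerXn2r ?nnegrE ?exprn_ge0//; exact: ltW.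
    by apply: ge0_subset_integral => //; [exact: measurable_funS mh|move=> x []].
  rewrite -lee_pdivlMl ?exprn_gt0// => /le_trans; apply.
  by rewrite lebesgue_cube -!EFinM lee_fin exprVn mulrA [_ * C]mulrC.
apply: (@le_trans _ _ (mu (\big[setU/set0]_(j < l) E j))).
  apply: le_measure; rewrite ?inE; [exact: mgt|exact: bigsetU_measurable|].
  move=> x [Qx /= sx]; apply: contrapT => nE.
  have bl j : (`|b j x - mean Q (b j)| / B j) ^+ l <= s.
    rewrite leNgt; apply/negP => h; apply: nE; rewrite -bigcup_seq; exists j => //=.
    by rewrite mem_index_enum.
  move: sx; rewrite ltNge => /negP; apply.
  rewrite -(ler_pXn2r l0) ?nnegrE ?prodr_ge0 ?(ltW s0)// -prodrXl.
  apply: (@le_trans _ _ (\prod_(j < l) s)); last by rewrite prodr_const card_ord.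
  rewrite big_mkcond/=; apply: ler_prod => j _; case: (g j) => /=; first by rewrite ler01 ltW.
  by rewrite exprn_ge0//= bl.
apply: (le_trans (measure_bigsetU_le _ _ _)) => //.
apply: (@le_trans _ _ (\sum_(j < l) (C * s^-1 ^+ a * side Q ^+ n)%:E)%E).
  by apply: lee_sum => j _; exact: muE.
rewrite sumEFin sumr_const card_ord lebesgue_cube -EFinM lee_fin -[_ *+ l]mulr_natl.
by have := mulr_ge0 sa0 V0; lra.
Qed.

End Layers.

Lemma esum_geometric2_le (R : realType) (c x y : R) : 0 <= c -> 0 <= x < 1 -> 0 <= y < 1 ->
  (\esum_(z in [set: nat * nat]) (c * x ^+ z.1 * y ^+ z.2)%:E <= (c / (1 - x) / (1 - y))%:E)%E.
Proof.
move=> c0 /andP[x0 x1] /andP[y0 y1].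
have -> : (\esum_(z in [set: nat * nat]) (c * x ^+ z.1 * y ^+ z.2)%:E =
    \esum_(i in [set: nat]) \esum_(j in [set: nat]) (c * x ^+ i * y ^+ j)%:E)%E.
  rewrite esum_esum; last by move=> i j _ _; rewrite lee_fin !mulr_ge0 ?exprn_ge0.
  by congr (esum _ _); apply/seteqP; split=> // -[].
apply: (@le_trans _ _ (\esum_(i in [set: nat]) (c / (1 - y) * x ^+ i)%:E)%E).
  apply: le_esum => i _; apply: (le_trans (esum_geometric_le _ _)).
  - by rewrite mulr_ge0 ?exprn_ge0.
  - by apply/andP.
  - by rewrite lee_fin mulrAC.
apply: (le_trans (esum_geometric_le _ _)); last by rewrite lee_fin mulrAC.
- by rewrite divr_ge0// subr_ge0 ltW.
- by apply/andP.
Qed.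

(** * Small cubes: layers by size of the means and by generation *)

Section LocalPart.
Context {R : realType} {n m : nat}.
Hypothesis n_gt0 : (0 < n)%N.
Local Notation mu := (lebesgue_Rn R n).
Variables (rho kap eta A : R) (a N : nat).
Hypotheses (rho_gt0 : 0 < rho) (kr : kap * rho < 1).
Hypotheses (eta_gt0 : 0 < eta) (eta_lt1 : eta < 1) (A_ge0 : 0 <= A).
Hypothesis aN : (2 * N < a)%N.

Definition mean_product (f : 'I_m -> Rn R n -> R) (Q : cube R n) : \bar R :=
  (\prod_(i < m) power_mean rho (f i) Q)%E.

Lemma mean_product_ge0 f Q : (0 <= mean_product f Q)%E.
Proof. by apply: prode_ge0 => i _; exact: power_mean_ge0. Qed.

Definition gtail_product (f : 'I_m -> Rn R n -> R) (k : R) : \bar R :=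
  (\prod_(i < m) ((mean_const rho kap)%:E * gtail (f i) kap k))%E.

(* The generations of a sparse family decay in measure like [xi ^ (2 i)]; raising the threshold at
   generation [i] to [theta ^ i], with [theta ^ a = xi], still leaves a summable measure [xi ^ i]. *)
Let xi : R := Num.sqrt (1 - eta).
Let theta : R := xi `^ (a%:R^-1).

(** The first entry bounds the sum of the heights of the layers in units of [L], the second the
    measure of the exceptional set in units of [2 ^ k]. *)
Definition local_const : R :=
  Num.max ((1 - e2 (- 2^-1))^-1 / (1 - theta))
    (m%:R + A * m%:R * e2 N%:R / (1 - e2 (N%:R - a%:R / 2)) / (1 - xi)).

(** Each cube is charged to one factor with a large mean, so the weak-type estimate is used [m]
    times. *)
Lemma mean_product_level (f : 'I_m -> Rn R n -> R) (F : set (cube R n)) (M k : R) (L : \bar R) :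
  (forall i, measurable_fun [set: Rn R n] (f i)) ->
  grid F -> (forall Q, F Q -> side Q <= M) ->
  (forall Q, F Q -> exists i, ((mean_const rho kap)%:E * gtail (f i) kap k < power_mean rho (f i) Q)%E) ->
  (mu (\bigcup_(Q in F) cube_set Q) <= (m%:R * e2 k)%:E)%E.
Proof.
move=> mf gF FM Fex.
pose G i := F `&` [set Q | ((mean_const rho kap)%:E * gtail (f i) kap k < power_mean rho (f i) Q)%E].
have gG i : grid (G i) by apply: (grid_sub _ gF) => Q [].
pose H i := \bigcup_(Q in G i) cube_set Q.
have mH i : measurable (H i) by exact: measurable_bigcup_cubes.
apply: (@le_trans _ _ (mu (\big[setU/set0]_(i < m) H i))).
  apply: le_measure; rewrite ?inE; [exact: measurable_bigcup_cubes|exact: bigsetU_measurable|].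
  move=> x [Q FQ Qx]; have [i hi] := Fex _ FQ.
  rewrite -bigcup_seq; exists i => /=; first by rewrite mem_index_enum.
  by exists Q.
apply: (le_trans (measure_bigsetU_le _ _ _)) => //.
apply: (@le_trans _ _ (\sum_(i < m) (e2 k)%:E)%E).
  apply: lee_sum => i _; apply: (@power_mean_maximal _ _ n_gt0 _ _ _ (mf i) rho_gt0 kr _ M) => //.
  - by move=> Q [FQ _]; exact: FM.
  - by move=> Q [].
by rewrite sumEFin sumr_const card_ord mulr_natl.
Qed.

Lemma lt_prod_ex (x y : 'I_m -> \bar R) :
  (forall i, 0 <= x i)%E -> (\prod_(i < m) y i < \prod_(i < m) x i)%E -> exists i, (y i < x i)%E.
Proof.
move=> x0 h; apply: contrapT => ne; move: h; rewrite ltNge => /negP; apply.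
apply: lee_prod => // i _; rewrite leNgt; apply/negP => hi; apply: ne; by exists i.
Qed.

(* The layers are indexed by [(j, i)]: the cubes with [mean_product] of size about [L * 2 ^ (-j)] that are
   maximal in generation [i], with threshold [2 ^ (j / 2) * theta ^ i]. *)
Lemma local_part (f : 'I_m -> Rn R n -> R) (S : set (cube R n)) (M k L : R)
    (w : cube R n -> Rn R n -> R) :
  (forall i, measurable_fun [set: Rn R n] (f i)) ->
  grid S ->
  (forall Q, S Q ->
    (mu (\bigcup_(Q' in S `&` [set Q' | cube_set Q' `<` cube_set Q]) cube_set Q')
     <= (1 - eta)%:E * mu (cube_set Q))%E) ->
  (forall Q, S Q -> side Q <= M) ->
  (mu (\bigcup_(Q in S) cube_set Q) < +oo)%E ->
  tail_weight A a w ->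
  0 < L ->
  (forall j : nat, (gtail_product f (k + N%:R * j%:R) <= (L * e2 (- j%:R))%:E)%E) ->
  exists E, [/\ measurable E, (mu E <= (local_const * e2 k)%:E)%E &
    forall x, ~ E x ->
      (\esum_(Q in S) (mean_product f Q * (w Q x)%:E * (\1_(cube_set Q) x)%:E)
        <= (local_const * L)%:E)%E].
Proof.
move=> mf gS spS SM finS tw L0 HL.
have e1 : 0 < 1 - eta by rewrite subr_gt0.
have xi0 : 0 < xi by rewrite sqrtr_gt0.
have xi1 : xi < 1 by rewrite -[ltRHS]sqrtr1 ltr_sqrt// gtrBl.
have a0 : (0 < a)%N by exact: leq_ltn_trans aN.
have aR : (0 : R) < a%:R by rewrite ltr0n.
have th0 : 0 < theta by rewrite powR_gt0.
have tha : theta ^+ a = xi.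
  by rewrite -powR_mulrn ?powR_ge0// -powRrM mulVf ?gt_eqF// powRr1// ltW.
have th1 : theta < 1.
  by rewrite -(ltr_pXn2r a0) ?nnegrE ?(ltW th0)// tha expr1n.
pose c := mean_product f.
have c0 Q : (0 <= c Q)%E by exact: mean_product_ge0.
have bigc Q j : ((L * e2 (- j%:R))%:E < c Q)%E ->
    exists i, ((mean_const rho kap)%:E * gtail (f i) kap (k + N%:R * j%:R) < power_mean rho (f i) Q)%E.
  move=> h; apply: lt_prod_ex => [i|]; first exact: power_mean_ge0.
  by apply: le_lt_trans h; exact: HL.
(* Cubes with product above [L] are not summed at all: their union joins the exceptional set. *)
pose F0 := S `&` [set Q | (L%:E < c Q)%E].
have gF0 : grid F0 by apply: (grid_sub _ gS) => Q [].
pose E0 := \bigcup_(Q in F0) cube_set Q.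
have muE0 : (mu E0 <= (m%:R * e2 k)%:E)%E.
  apply: (@mean_product_level f F0 M k 0%E) => //; first by move=> Q [/SM].
  move=> Q [SQ /= h]; have := @bigc Q 0%N; rewrite mulr0 addr0 oppr0 e20 mulr1; exact.
(* The lower threshold, of index [j + 1], governs the measure of the union of [F j]; the upper one
   governs the height. *)
pose F j := S `&` [set Q | ((L * e2 (- j.+1%:R))%:E < c Q <= (L * e2 (- j%:R))%:E)%E].
have FS j : F j `<=` S by move=> Q [].
have FM j Q : F j Q -> side Q <= M by move=> [/SM].
have gF j : grid (F j) by exact: grid_sub (FS j) gS.
have muF j : (mu (\bigcup_(Q in F j) cube_set Q) <= (m%:R * e2 (k + N%:R * j.+1%:R))%:E)%E.
  apply: (@mean_product_level f (F j) M _ 0%E) => //; first exact: FM.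
  by move=> Q [SQ /= /andP[h _]]; exact: bigc.
pose Lay (z : nat * nat) := maxcubes (generation (F z.1) z.2).
have gGen z : grid (generation (F z.1) z.2).
  by apply: (grid_sub _ (gF z.1)) => Q; exact: generation_sub.
pose aa (z : nat * nat) := L * e2 (- z.1%:R).
pose ss (z : nat * nat) := e2 (z.1%:R / 2) * theta ^+ z.2.
pose v (z : nat * nat) := ((xi ^+ 2) ^+ z.2 * (m%:R * e2 (k + N%:R * z.1.+1%:R)))%:E.
have xi2 : xi ^+ 2 = 1 - eta by rewrite sqr_sqrtr// ltW.
have [||||||E [mE muE HE]] := @layered_sum R n (nat * nat)%type A a w S (~` E0) Lay c aa ss v tw A_ge0 c0.
- by move=> z; rewrite /aa mulr_ge0 ?e2_ge0// ltW.
- by move=> z; rewrite /ss mulr_gt0 ?e2_gt0 ?exprn_gt0.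
- by move=> z; apply: (grid_sub _ (gGen z)); exact: maxcubes_sub.
- by move=> z Q Q' x LQ LQ'; exact: (maxcubes_eq (gGen z) LQ LQ').
- move=> [j i] /=; rewrite /Lay/= (bigcup_maxcubes n_gt0 (gGen (j, i)) (M := M)); last first.
    by move=> Q /= /generation_sub/FM.
  apply: (le_trans (measure_generation n_gt0 eta_lt1 gS spS (FS j) (@FM j) i)).
  rewrite /v/= xi2 EFinM lee_wpmul2l ?lee_fin ?exprn_ge0 ?(ltW e1)//.
- move=> Q x SQ nE0 Qx cQ.
  have cL : (c Q <= L%:E)%E.
    by rewrite leNgt; apply/negP => h; apply: nE0; exists Q.
  have cf : c Q \is a fin_num by rewrite ge0_fin_numE// (le_lt_trans cL)// ltry.
  pose t := fine (c Q).
  have t0 : 0 < t by rewrite fine_gt0// lt_neqAle eq_sym cQ c0/= -ge0_fin_numE.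
  have tL : t <= L by rewrite -lee_fin fineK.
  have exj : exists j : nat, L * e2 (- j.+1%:R) < t.
    exists (Num.bound (L / t)); rewrite e2N ltr_pdivrMr ?e2_gt0// mulrC -ltr_pdivrMr//.
    have Lt0 : 0 <= L / t by rewrite divr_ge0// ltW.
    apply: (lt_trans (archi_boundP Lt0)); rewrite -[X in e2 X]mul1r e2Mn e21 -natrX ltr_nat.
    by apply: (leq_trans (ltn_expl _ (ltnSn 1))); rewrite leq_exp2l.
  have [j hj jmin] := ex_minnP exj.
  have FjQ : F j Q.
    split=> //=; rewrite -(fineK cf) !lee_fin lte_fin hj/=.
    case: j hj jmin => [|j] hj jmin; first by rewrite oppr0 e20 mulr1.
    by rewrite leNgt; apply/negP => /jmin; rewrite ltnn.
  have finF : (mu (\bigcup_(Q in F j) cube_set Q) < +oo)%E by apply: le_lt_trans (muF j) _; exact: ltry.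
  have [i mi] := generation_ex n_gt0 eta_lt1 gS spS (FS j) (@FM j) eta_gt0 finF FjQ.
  exists (j, i) => //=; by case: FjQ => _ /andP[].
have mE0 : measurable E0 by exact: measurable_bigcup_cubes.
exists (E0 `|` E); split; first exact: measurableU.
- apply: (le_trans (measureU2 _ mE0 mE)).
  apply: (@le_trans _ _ ((m%:R * e2 k)%:E + (A * m%:R * e2 (k + N%:R) / (1 - e2 (N%:R - a%:R / 2)) / (1 - xi))%:E)%E).
    apply: leeD => //; apply: (le_trans muE).
    (* In the layer [(j, i)] a measure of order [2 ^ (N j) * xi ^ (2 i)] is multiplied by the
       threshold to the power [- a], that is by [2 ^ (- a j / 2) * xi ^ (- i)]. The series in [j]
       converges because [2 N < a], the one in [i] because [xi < 1]. *)
    apply: (@le_trans _ _ (\esum_(z in [set: nat * nat]) (A * m%:R * e2 (k + N%:R) * (e2 (N%:R - a%:R / 2)) ^+ z.1 * xi ^+ z.2)%:E)%E).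
      apply: le_esum => -[j i] _; rewrite /v/ss/= -EFinM lee_fin.
      rewrite exprVn exprMn -!exprM [(i * a)%N]mulnC exprM tha -e2Mn -e2Mn.
      rewrite invfM -e2N -[j.+1%:R]natr1 mulrDr mulr1.
      rewrite (_ : k + (N%:R * j%:R + N%:R) = (k + N%:R) + N%:R * j%:R); last by ring.
      rewrite (_ : (N%:R - a%:R / 2) * j%:R = N%:R * j%:R + - (j%:R / 2 * a%:R)); last by ring.
      rewrite !e2D mulnC exprM expr2.
      have xii : 0 < xi ^+ i by rewrite exprn_gt0.
      by rewrite le_eqVlt; apply/orP; left; apply/eqP; field; rewrite gt_eqF.
    apply: esum_geometric2_le.
    + by rewrite !mulr_ge0 ?e2_ge0.
    + rewrite e2_ge0/= e2_lt1// subr_lt0 ltr_pdivlMr// -natrM ltr_nat mulnC//.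
    + by rewrite ltW.
  rewrite -EFinD lee_fin e2D.
  apply: (@le_trans _ _ ((m%:R + A * m%:R * e2 N%:R / (1 - e2 (N%:R - a%:R / 2)) / (1 - xi)) * e2 k)).
    by rewrite le_eqVlt; apply/orP; left; apply/eqP; ring.
  by rewrite ler_wpM2r ?e2_ge0// /local_const le_max lexx orbT.
- move=> x nE; have nE0 : (~` E0) x by move=> h; apply: nE; left.
  have nE1 : ~ E x by move=> h; apply: nE; right.
  apply: (le_trans (HE x nE0 nE1)).
  apply: (@le_trans _ _ (\esum_(z in [set: nat * nat]) (L * (e2 (- 2^-1)) ^+ z.1 * theta ^+ z.2)%:E)%E).
    apply: le_esum => -[j i] _; rewrite /aa/ss/= lee_fin -e2Mn mulrA -[L * _ * e2 _]mulrA -e2D.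
    by rewrite (_ : - j%:R + j%:R / 2 = - 2^-1 * j%:R)//; field.
  apply: (le_trans (esum_geometric2_le _ _ _)).
  + exact: ltW.
  + by rewrite e2_ge0/= e2_lt1// oppr_lt0.
  + by rewrite ltW.
  rewrite lee_fin -mulrA mulrC ler_wpM2r ?(ltW L0)// /local_const le_max lexx//.
Qed.

End LocalPart.

(** * Large cubes: layers by side *)

Section LargePart.
Context {R : realType} {n : nat}.
Hypothesis n_gt0 : (0 < n)%N.
Local Notation mu := (lebesgue_Rn R n).
Variables (A delta : R) (a : nat).
Hypotheses (A_ge0 : 0 <= A) (delta_gt0 : 0 < delta) (aD : n%:R < a%:R * delta / 2).

(** The first entry serves the height of the sum, the second the measure of the exceptional set. *)
Definition large_const : R :=
  Num.max ((1 - e2 (- (delta / 2)))^-1) (A * 8 ^+ n / (1 - e2 (n%:R - a%:R * delta / 2))).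

(* Layer [k] consists of the cubes of side about [2 ^ k * r], with threshold [sigma * 2 ^ (k delta / 2)]. *)
Lemma large_part (S : set (cube R n)) (x0 : Rn R n) (r D sigma : R)
    (c : cube R n -> \bar R) (w : cube R n -> Rn R n -> R) :
  0 < r -> 0 <= D -> 0 < sigma ->
  grid S ->
  (forall Q, S Q -> r < side Q) ->
  (forall Q, S Q -> exists2 y, cube_set Q y & forall i, `|(tnth y i : R) - tnth x0 i| < r) ->
  tail_weight A a w ->
  (forall Q, 0 <= c Q)%E ->
  (forall Q, S Q -> c Q <= (D * (side Q / r) `^ (- delta))%:E)%E ->
  exists E, [/\ measurable E, (mu E <= (large_const * sigma^-1 ^+ a * r ^+ n)%:E)%E &
    forall x, ~ E x ->
      (\esum_(Q in S) (c Q * (w Q x)%:E * (\1_(cube_set Q) x)%:E)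
        <= (large_const * D * sigma)%:E)%E].
Proof.
move=> r0 D0 s0 gS Sr Sx0 tw c0 cD.
pose Lay (k : nat) := S `&` [set Q | e2 k%:R * r < side Q <= e2 k.+1%:R * r].
pose aa (k : nat) := D * e2 (- (k%:R * delta)).
pose ss (k : nat) := sigma * e2 (k%:R * delta / 2).
pose v (k : nat) := ((8 * r) ^+ n * e2 (k%:R * n%:R))%:E.
have gL k : grid (Lay k) by apply: (grid_sub _ gS) => Q [].
have e2S (k : nat) : e2 k.+1%:R = 2 * e2 k%:R :> R by rewrite -natr1 e2D e21 mulrC.
have dL k Q Q' x : Lay k Q -> Lay k Q' -> cube_set Q x -> cube_set Q' x -> Q = Q'.
  (* Sides of cubes in a grid differ by powers of 2, and within a layer by a factor less than 2. So
     they agree, and intersecting cubes of a layer coincide. *)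
  have key P P' : Lay k P -> Lay k P' -> side P <= side P' -> side P = side P'.
    move=> [SP /= /andP[h1 h2]] [SP' /= /andP[h3 h4]] PP'.
    have [i hi] := grid_side gS SP SP' PP'.
    case: i hi => [|i] hi; first by rewrite hi expr0 mulr1.
    have : 2 * side P <= side P'.
      by rewrite hi mulrC ler_wpM2l ?(ltW (side_gt0 _))// exprS ler_peMr// exprn_ege1// ler1n.
    have h1' : 2 * (e2 k%:R * r) < 2 * side P by rewrite ltr_pM2l.
    by move: h4; rewrite e2S -mulrA => h4; lra.
  move=> LQ LQ' Qx Q'x; apply: cube_set_inj => //.
  have e : side Q = side Q'.
    by have [h|/ltW h] := leP (side Q) (side Q'); [exact: key|apply/esym; exact: key].
  apply/seteqP; split.
    by apply: (grid_nested gS LQ.1 LQ'.1 Qx Q'x); rewrite e.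
  by apply: (grid_nested gS LQ'.1 LQ.1 Q'x Qx); rewrite e.
have [||||E [mE muE HE]] := @layered_sum R n nat A a w S [set: _] Lay c aa ss v tw A_ge0 c0 _ _ gL dL.
- by move=> k; rewrite mulr_ge0// e2_ge0.
- by move=> k; rewrite mulr_gt0// e2_gt0.
(* A cube of the layer has side at most [2 ^ (k + 1) * r] and comes within [r] of [x0], so it lies
   in the sup-ball of radius [4 * 2 ^ k * r]; hence the factor 8. *)
- move=> k; apply: (@le_trans _ _ ((2 * (4 * (e2 k%:R * r))) ^+ n)%:E).
    apply: (@lebesgue_supball_le _ _ x0).
    + by rewrite !mulr_gt0// e2_gt0.
    + exact: measurable_bigcup_cubes.
    + move=> z i [Q [SQ /= /andP[h1 h2]] Qz]; have [y Qy hy] := Sx0 _ SQ.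
      have h3 := cube_coord i Qz Qy; have h4 := hy i.
      have -> : (tnth z i : R) - tnth x0 i = ((tnth z i : R) - tnth y i) + ((tnth y i : R) - tnth x0 i) by ring.
      apply: (le_lt_trans (ler_normD _ _)).
      have k1 : r <= e2 k%:R * r by rewrite ler_peMl ?(ltW r0)// -[leLHS]e20 ler_e2.
      by move: h2; rewrite e2S -mulrA => h2; lra.
  rewrite /v lee_fin e2Mn -exprMn; apply: lerXn2r; rewrite ?nnegrE ?mulr_ge0 ?e2_ge0 ?(ltW r0)//.
  by rewrite le_eqVlt; apply/orP; left; apply/eqP; ring.
- move=> Q x SQ _ Qx cQ.
  have sr : 1 < side Q / r by rewrite ltr_pdivlMr// mul1r; exact: Sr.
  have [k /andP[h1 h2]] := dyadic_scale (lt_trans ltr01 sr).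
  have k0 : (0 <= k)%R.
    have : (0 < k + 1)%R by rewrite -(ltr_int R) -ltr_e2 e20; exact: lt_le_trans h2.
    by rewrite ltzD1.
  case: k k0 h1 h2 => // k _ h1 h2.
  have h2' : side Q / r <= e2 k.+1%:R by move: h2; rewrite intrD -!pmulrn natr1.
  exists k.
    by split=> //=; rewrite -ltr_pdivlMr// -ler_pdivrMr// h2' andbT.
  apply: (le_trans (cD Q SQ)); rewrite lee_fin ler_wpM2l//.
  rewrite e2N e2M powRN lef_pV2 ?posrE ?powR_gt0 ?e2_gt0//; last by rewrite (lt_trans _ sr).
  by rewrite ge0_ler_powR ?nnegrE ?(ltW delta_gt0) ?e2_ge0 ?(ltW h1)// (le_trans _ (ltW sr)).
exists E; split => //.
- apply: (le_trans muE).
  apply: (@le_trans _ _ (\esum_(k in [set: nat]) (A * 8 ^+ n * sigma^-1 ^+ a * r ^+ n * (e2 (n%:R - a%:R * delta / 2)) ^+ k)%:E)%E).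
    apply: le_esum => k _; rewrite /ss /v -EFinM lee_fin -e2Mn.
    rewrite invfM exprMn -e2N -e2Mn exprMn.
    rewrite (_ : (n%:R - a%:R * delta / 2) * k%:R = k%:R * n%:R + - (k%:R * delta / 2) * a%:R); last by ring.
    by rewrite e2D le_eqVlt; apply/orP; left; apply/eqP; ring.
  apply: (le_trans (esum_geometric_le _ _)).
  + by rewrite !mulr_ge0 ?exprn_ge0 ?invr_ge0 ?(ltW r0) ?(ltW s0).
  + by rewrite e2_ge0/= e2_lt1// subr_lt0.
  rewrite lee_fin.
  apply: (@le_trans _ _ (A * 8 ^+ n / (1 - e2 (n%:R - a%:R * delta / 2)) * sigma^-1 ^+ a * r ^+ n)).
    by rewrite le_eqVlt; apply/orP; left; apply/eqP; ring.
  rewrite !ler_wpM2r ?exprn_ge0 ?invr_ge0 ?(ltW r0) ?(ltW s0)// /large_const le_max lexx orbT//.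
- move=> x nE; apply: (le_trans (HE x Logic.I nE)).
  apply: (@le_trans _ _ (\esum_(k in [set: nat]) (D * sigma * (e2 (- (delta / 2))) ^+ k)%:E)%E).
    apply: le_esum => k _; rewrite /aa/ss lee_fin -e2Mn.
    rewrite (_ : - (delta / 2) * k%:R = - (k%:R * delta) + k%:R * delta / 2); last by field.
    by rewrite e2D le_eqVlt; apply/orP; left; apply/eqP; ring.
  apply: (le_trans (esum_geometric_le _ _)).
  + by rewrite mulr_ge0// ltW.
  + by rewrite e2_ge0/= e2_lt1// oppr_lt0 divr_gt0.
  rewrite lee_fin mulrC -mulrA ler_wpM2r ?mulr_ge0 ?(ltW s0)// /large_const le_max lexx//.
Qed.

End LargePart.

Section SparseTerm.
Context {R : realType} {n m l : nat}.
Local Notation mu := (lebesgue_Rn R n).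
Variables (hlm : (l <= m)%N) (a0 : nat) (Cj : R) (b : 'I_l -> Rn R n -> R) (B : 'I_l -> R).
Variable f : 'I_m -> Rn R n -> R.
Hypotheses (a0_gt0 : (0 < a0)%N) (Cj_gt0 : 0 < Cj) (B_gt0 : forall s, 0 < B s).
Hypothesis mb : forall s, measurable_fun [set: Rn R n] (b s).
Hypothesis mf : forall i, measurable_fun [set: Rn R n] (f i).
Hypothesis osc : forall s (Q : cube R n),
  (\int[mu]_(x in cube_set Q) ((`|b s x - mean Q (b s)| / B s) ^+ a0.+1)%:E <= Cj%:E * mu (cube_set Q))%E.

Lemma average_abs_ge0 (Q : cube R n) (h : Rn R n -> R) : (0 <= average_abs Q h)%E.
Proof. by rewrite /average_abs mule_ge0 ?integral_ge0// lee_fin invr_ge0 fine_ge0. Qed.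

(** An average of [|f_s|] costs 2 times the power mean, an average with an oscillation costs
    [(Cj + 1) * B s] times it by Hoelder's inequality, and a pointwise oscillation leaves [B s]
    times the normalized one. The factor [Cj + 2] covers all cases. *)
Lemma sparse_term_le (g : {ffun 'I_l -> bool}) (Q : cube R n) x :
  ((\prod_(s < l) sparse_factor (b s) (f (widen_ord hlm s)) Q (g s) x) *
   (\prod_(s < m | (l <= s)%N) average_abs Q (f s)) <=
   ((Cj + 2) ^+ m * \prod_(s < l) B s)%:E *
     (mean_product (1 + a0%:R^-1) f Q * (osc_weight b B g Q x)%:E))%E.
Proof.
pose cc : R := Cj + 2; have cc0 : 0 < cc by rewrite addr_gt0.
pose pm i := power_mean (1 + a0%:R^-1) (f i) Q.
have pm0 i : (0 <= pm i)%E by exact: power_mean_ge0.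
pose w s : R := if ~~ g s then `|b s x - mean Q (b s)| / B s else 1.
have w0 s : 0 <= w s by rewrite /w; case: ifP => // _; rewrite divr_ge0// ltW.
have avg0 := average_abs_ge0 Q.
have avg i : (average_abs Q (f i) <= cc%:E * pm i)%E.
  apply: (le_trans (average_abs_le_power_mean Q a0_gt0 (mf i))).
  by apply: lee_wpmul2r; [exact: pm0|by rewrite lee_fin /cc lerDr ltW].
have fac s : (0 <= sparse_factor (b s) (f (widen_ord hlm s)) Q (g s) x <=
    (cc * B s * w s)%:E * pm (widen_ord hlm s))%E.
  rewrite /sparse_factor /w; case: (g s) => /=.
    rewrite avg0/= mulr1.
    apply: (le_trans (average_abs_mul_le a0_gt0 (mf _) _ (B_gt0 s) Cj_gt0 (osc s Q))).
      exact: measurable_funB.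
    by apply: lee_wpmul2r; [exact: pm0|rewrite lee_fin ler_wpM2r ?(ltW (B_gt0 s))// /cc; lra].
  rewrite mule_ge0//= (_ : cc * B s * (`|b s x - mean Q (b s)| / B s) = `|b s x - mean Q (b s)| * cc); last first.
    by field; rewrite gt_eqF.
  by rewrite EFinM -muleA lee_wpmul2l// lee_fin.
apply: (@le_trans _ _ (\prod_(s < l) ((cc * B s * w s)%:E * pm (widen_ord hlm s)) * \prod_(s < m | (l <= s)%N) (cc%:E * pm s))%E).
  apply: lee_pmul.
  - by apply: prode_ge0 => s _; case/andP: (fac s).
  - by apply: prode_ge0 => s _; exact: avg0.
  - by apply: lee_prod => s _; case/andP: (fac s).
  - by apply: lee_prod => s _; [exact: avg0|exact: avg].
rewrite !big_split/= !prodEFin muleACA.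
rewrite /mean_product -/pm [X in (_ <= _ * (X * _))%E](bigID (fun i : 'I_m => (i < l)%N))/= big_ord_narrow.
under [X in (_ <= _ * (_ * X * _))%E]eq_bigl do rewrite -leqNgt.
rewrite -!EFinM [X in (_ <= _ * X)%E]muleC [leRHS]muleA -EFinM -?[leLHS]muleA.
rewrite (_ : (Cj + 2) ^+ m * _ * osc_weight b B g Q x = \prod_(i < l) (cc * B i * w i) * \prod_(i < m | (l <= i)%N) cc)//.
rewrite /osc_weight [X in _ * X = _]big_mkcond/= -/w !big_split/= -/cc.
have -> : cc ^+ m = \prod_(i < l) cc * \prod_(i < m | (l <= i)%N) cc.
  rewrite -[in LHS](card_ord m) -prodr_const (bigID (fun i : 'I_m => (i < l)%N))/= (big_ord_narrow hlm).
  by congr (_ * _); apply: eq_bigl => i; rewrite -leqNgt.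
ring.
Qed.

End SparseTerm.

(** * Small and large cubes together, at a fixed ball and level *)

Section LevelEstimate.
Context {R : realType} {n m : nat}.
Hypothesis n_gt0 : (0 < n)%N.
Local Notation mu := (lebesgue_Rn R n).

Lemma rearrangement_le_ae (f : Rn R n -> R) (E : set (Rn R n)) (s t : R) :
  measurable_fun [set: Rn R n] f -> measurable E -> (mu E <= t%:E)%E -> 0 <= s ->
  {ae mu, forall x, ~ E x -> `|f x| <= s} -> (rearrangement f t <= s%:E)%E.
Proof.
move=> mf mE Et s0 [Z [mZ Z0 HZ]].
rewrite rearrangement_le//; apply: le_trans Et.
apply: (@le_trans _ _ (mu (E `|` Z))).
  apply: le_measure; rewrite ?inE; [exact: measurable_gt_norm|exact: measurableU|].
  move=> x /= sx; have [Ex|nEx] := pselect (E x); [by left|right].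
  by apply: HZ => /(_ nEx); rewrite leNgt sx.
by apply: (le_trans (measureU2 _ mE mZ)); by rewrite [X in (_ + X)%E](_ : _ = 0%E) ?adde0.
Qed.

Lemma power_mean_eq (rho : R) (f f' : Rn R n -> R) Q :
  (forall x, cube_set Q x -> f x = f' x) -> power_mean rho f Q = power_mean rho f' Q.
Proof.
by move=> ff'; rewrite /power_mean; under eq_integral => x /[!inE] Qx do rewrite ff'//.
Qed.

Definition cutoff (x0 : Rn R n) (r : R) (f : Rn R n -> R) : Rn R n -> R :=
  fun y => f y * \1_(eball x0 r) y.

Lemma measurable_cutoff x0 r f : measurable_fun [set: Rn R n] f ->
  measurable_fun [set: Rn R n] (cutoff x0 r f).
Proof. by move=> mf; apply: measurable_funM => //; apply: measurable_indic; exact: measurable_eball. Qed.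

Lemma cutoffE x0 r f y : eball x0 r y -> cutoff x0 r f y = f y.
Proof. by move=> By; rewrite /cutoff indicE mem_set// mulr1. Qed.

Lemma esum_le_cover (U : choiceType) (S S1 S2 : set U) (a : U -> \bar R) :
  (forall u, 0 <= a u)%E -> (forall u, S u -> a u != 0%E -> S1 u \/ S2 u) ->
  (\esum_(u in S) a u <= \esum_(u in S1) a u + \esum_(u in S2) a u)%E.
Proof.
move=> a0 cov; rewrite esum_mkcond [in X in (_ <= X + _)%E]esum_mkcond [in X in (_ <= _ + X)%E]esum_mkcond.
rewrite -esumD; [|by move=> u _; case: ifP..]; apply: le_esum => u _.
case: ifPn => [/[!inE] Su|_]; last by rewrite adde_ge0//; case: ifP.
have [->|au] := eqVneq (a u) 0%E; first by rewrite adde_ge0//; case: ifP.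
have [S1u|S2u] := cov _ Su au; first by rewrite [in X in (_ <= X + _)%E]mem_set// leeDl//; case: ifP.
by rewrite [in X in (_ <= _ + X)%E]mem_set// leeDr//; case: ifP.
Qed.

(** Cubes that miss the ball contribute nothing at its points. A cube of side at most [r] that meets
    it lies within [2 r] of [x0] in each coordinate, hence in the Euclidean ball of radius
    [n.+1 * (2 * r)], so cutting off the [f i] there does not change its means. *)
Lemma level_estimate (rho kap eta A delta : R) (a N : nat) (f : 'I_m -> Rn R n -> R)
    (S : set (cube R n)) (w : cube R n -> Rn R n -> R) (x0 : Rn R n) (r D k L : R) :
  0 < rho -> kap * rho < 1 -> 0 < eta -> eta < 1 -> 0 <= A -> (2 * N < a)%N ->
  0 < delta -> n%:R < a%:R * delta / 2 ->
  (forall i, measurable_fun [set: Rn R n] (f i)) ->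
  grid S ->
  (forall Q, S Q ->
    (mu (\bigcup_(Q' in S `&` [set Q' | cube_set Q' `<` cube_set Q]) cube_set Q')
     <= (1 - eta)%:E * mu (cube_set Q))%E) ->
  tail_weight A a w ->
  0 < r -> 0 <= D -> 0 < L ->
  (forall Q, r < side Q -> (mean_product rho f Q <= (D * (side Q / r) `^ (- delta))%:E)%E) ->
  (forall j : nat, (gtail_product rho kap (fun i => cutoff x0 (n.+1%:R * (2 * r)) (f i)) (k + N%:R * j%:R)
     <= (L * e2 (- j%:R))%:E)%E) ->
  exists E, [/\ measurable E,
    (mu E <= ((@local_const R m eta A a N + @large_const R n A delta a) * e2 k)%:E)%E &
    forall x, eball x0 r x -> ~ E x ->
      (\esum_(Q in S) (mean_product rho f Q * (w Q x)%:E * (\1_(cube_set Q) x)%:E)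
        <= (@local_const R m eta A a N * L + @large_const R n A delta a * D * (r ^+ n / e2 k) `^ (a%:R^-1))%:E)%E].
Proof.
move=> rho0 kr eta0 eta1 A0 aN delta0 aD mf gS spS tw r0 D0 L0 HD HL.
have a0 : (0 < a)%N by exact: leq_ltn_trans aN.
pose meets Q := exists2 y, cube_set Q y & forall i, `|(tnth y i : R) - tnth x0 i| < r.
pose S1 := S `&` [set Q | meets Q /\ side Q <= r].
pose S2 := S `&` [set Q | meets Q /\ r < side Q].
have gS1 : grid S1 by apply: (grid_sub _ gS) => Q [].
have gS2 : grid S2 by apply: (grid_sub _ gS) => Q [].
pose fs i := cutoff x0 (n.+1%:R * (2 * r)) (f i).
have mfs i : measurable_fun [set: Rn R n] (fs i) by exact: measurable_cutoff.
have near Q z : S1 Q -> cube_set Q z -> forall i, `|(tnth z i : R) - tnth x0 i| < 2 * r.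
  move=> [_ [[y Qy hy] Qr]] Qz i; have h := cube_coord i Qz Qy.
  rewrite (_ : (tnth z i : R) - tnth x0 i = ((tnth z i : R) - tnth y i) + ((tnth y i : R) - tnth x0 i)); last by ring.
  by apply: (le_lt_trans (ler_normD _ _)); have := hy i; lra.
have r20 : 0 < 2 * r by rewrite mulr_gt0.
have [|||E1 [mE1 muE1 HE1]] := @local_part R n m n_gt0 rho kap eta A a N rho0 kr eta0 eta1 A0 aN fs S1 r k L w mfs gS1 _ _ _ tw L0 HL.
- move=> Q [SQ _]; apply: le_trans (spS Q SQ).
  apply: le_measure; rewrite ?inE; [| |by move=> x [Q' [[SQ' _] QQ'] Q'x]; exists Q'].
    by apply: measurable_bigcup_cubes; apply: (grid_sub _ gS) => Q' [[]].
  by apply: measurable_bigcup_cubes; apply: (grid_sub _ gS) => Q' [].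
- by move=> Q [_ []].
- apply: le_lt_trans (_ : ((2 * (2 * r)) ^+ n)%:E < +oo)%E; last exact: ltry.
  apply: (@lebesgue_supball_le _ _ x0) => //; first exact: measurable_bigcup_cubes.
  by move=> y i [Q S1Q Qy]; exact: near S1Q Qy i.
(* Chosen so that [sigma ^ (- a) * r ^ n = 2 ^ k], the measure allowed for the exceptional set of
   the large cubes. *)
pose sigma := (r ^+ n / e2 k) `^ (a%:R^-1).
have rn0 : 0 < r ^+ n / e2 k by rewrite divr_gt0 ?exprn_gt0 ?e2_gt0.
have sigma0 : 0 < sigma by rewrite powR_gt0.
have [|||E2 [mE2 muE2 HE2]] := @large_part R n n_gt0 A delta a A0 delta0 aD S2 x0 r D sigma (mean_product rho f) w r0 D0 sigma0 gS2 _ _ tw (mean_product_ge0 rho f).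
- by move=> Q [_ []].
- by move=> Q [_ []].
- by move=> Q [_ [_]]; exact: HD.
exists (E1 `|` E2); split; first exact: measurableU.
- apply: (le_trans (measureU2 _ mE1 mE2)); rewrite mulrDl EFinD; apply: leeD => //.
  apply: (le_trans muE2); rewrite lee_fin -mulrA.
  have sa : sigma ^+ a = r ^+ n / e2 k.
    by rewrite -powR_mulrn ?(ltW sigma0)// -powRrM mulVf ?pnatr_eq0 -?lt0n// powRr1 ?(ltW rn0).
  by rewrite exprVn sa invf_div -mulrA mulVf ?mulr1// gt_eqF// exprn_gt0.
- move=> x Bx nE.
  have meetsx Q : cube_set Q x -> meets Q by move=> Qx; exists x => // i; exact: eball_coord.
  apply: (le_trans (@esum_le_cover _ S S1 S2 _ _ _)).
  + by move=> Q; rewrite !mule_ge0 ?mean_product_ge0 ?lee_fin//; case: tw.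
  + move=> Q SQ; have [Qx _|nQx] := pselect (cube_set Q x); last by rewrite indicE memNset// mule0 eqxx.
    by have [h|h] := leP (side Q) r; [left|right]; split=> //; split=> //; exact: meetsx.
  rewrite EFinD; apply: leeD; last by apply: HE2 => h; apply: nE; right.
  have nE1 : ~ E1 x by move=> h; apply: nE; left.
  apply: le_trans (HE1 x nE1); apply: le_esum => Q S1Q.
  have -> : mean_product rho f Q = mean_product rho fs Q; last by [].
  apply: eq_bigr => i _; apply: power_mean_eq => z Qz; rewrite /fs cutoffE//.
  by apply: coord_eball => // j; rewrite ltW//; exact: near S1Q Qz j.
Qed.

End LevelEstimate.

(** * Discretized Morrey-Lorentz norms *)

Section PowerTools.
Context {R : realType}.
Local Open Scope ereal_scope.

Lemma poweR_le_cancel (q : R) (x y : \bar R) : (0 < q)%R -> 0 <= x -> 0 <= y ->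
  x `^ q <= y `^ q -> x <= y.
Proof.
move=> q0 x0 y0 h; have Kr (z : \bar R) : 0 <= z -> (z `^ q) `^ q^-1 = z.
  by move=> z0; rewrite -poweRrM mulfV ?gt_eqF// poweRe1.
rewrite -(Kr x)// -(Kr y)//; apply: le_poweR => //; [by rewrite invr_ge0 ltW|exact: poweR_ge0].
Qed.

Lemma poweRD_le (q : R) (x y : \bar R) : (0 < q)%R -> 0 <= x -> 0 <= y ->
  (x + y) `^ q <= (e2 q)%:E * (x `^ q + y `^ q).
Proof.
move=> q0; wlog xy : x y / x <= y => [H|] x0 y0.
  have [|/ltW] := leP x y => h; first exact: H.
  by rewrite addeC [X in _ <= _ * X]addeC; exact: H.
apply: (@le_trans _ _ ((2%:E * y) `^ q)).
  apply: le_poweR; [exact: ltW|exact: adde_ge0|].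
  by rewrite -[2%R]/(1 + 1)%R EFinD ge0_muleDl// mul1e leeD2r.
rewrite poweRM ?lee_fin// poweR_EFin lee_wpmul2l ?lee_fin ?powR_ge0//.
by rewrite leeDr// poweR_ge0.
Qed.

Lemma prod_EFinM (I : Type) (s : seq I) (c : I -> R) (x : I -> \bar R) :
  \prod_(i <- s) ((c i)%:E * x i) = (\prod_(i <- s) c i)%:E * \prod_(i <- s) x i.
Proof. by rewrite big_split/= prodEFin. Qed.

End PowerTools.

Section SequenceProducts.
Context {R : realType}.
Local Open Scope ereal_scope.

Lemma seqnorm_le (p q : R) (h h' : int -> \bar R) : (0 <= q)%R ->
  (forall k, 0 <= h k) -> (forall k, h k <= h' k) -> seqnorm p q h <= seqnorm p q h'.
Proof.
move=> q0 h0 hh'; apply: le_esum => k _; apply: le_poweR => //.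
  by rewrite mule_ge0 ?lee_fin ?e2_ge0.
by rewrite lee_wpmul2l ?lee_fin ?e2_ge0.
Qed.

Lemma seqnormZ (p q c : R) (h : int -> \bar R) : (0 <= c)%R ->
  (forall k, 0 <= h k) -> seqnorm p q (fun k => c%:E * h k) = (c `^ q)%:E * seqnorm p q h.
Proof.
move=> c0 h0; rewrite /seqnorm -esumZl ?powR_ge0//; last by move=> k; exact: poweR_ge0.
apply: eq_esum => k _; by rewrite muleCA [LHS]poweRM ?poweR_EFin// ?lee_fin// mule_ge0 ?lee_fin ?e2_ge0.
Qed.

(** Hoelder's inequality over the scales with weights [q / qs i]; the factors [2 ^ (k / p)]
    distribute because the [1 / ps i] add up to [1 / p]. *)
Lemma seqnorm_prod (m : nat) (p q : R) (ps qs : 'I_m -> R) (h : 'I_m -> int -> \bar R) :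
  (0 < q)%R -> (forall i, 0 < qs i)%R ->
  (p^-1 = \sum_(i < m) (ps i)^-1)%R -> (q^-1 = \sum_(i < m) (qs i)^-1)%R ->
  (forall i k, 0 <= h i k) ->
  seqnorm p q (fun k => \prod_(i < m) h i k) <=
  \prod_(i < m) (seqnorm (ps i) (qs i) (h i)) `^ (q / qs i).
Proof.
move=> q0 qs0 hp hq h0.
have e0 i k : 0 <= (e2 (k%:~R / ps i))%:E * h i k by rewrite mule_ge0 ?lee_fin ?e2_ge0.
apply: le_trans (esum_hoelder _ _ _) => [|i||i u].
- apply: le_esum => k _.
  have -> : (e2 (k%:~R / p))%:E * \prod_(i < m) h i k = \prod_(i < m) ((e2 (k%:~R / ps i))%:E * h i k).
    rewrite prod_EFinM hp mulr_sumr; congr (_%:E * _).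
    by elim/big_rec2: _ => [|i x y _ <-]; rewrite ?e20// e2D.
  rewrite prode_poweR//; apply: lee_prod => i _; first exact: poweR_ge0.
  by rewrite -poweRrM [(qs i * _)%R]mulrC divfK// gt_eqF.
- by rewrite divr_gt0.
- by rewrite -mulr_sumr -hq mulfV// gt_eqF.
- exact: poweR_ge0.
Qed.

(** The shifted supremum with step [N] and [al = 1]: advancing by [N] scales gains [2 ^ (N / p)],
    which beats the factor 2 because [p < N]. *)
Lemma seqnorm_scales (p q : R) (N : nat) (h : int -> \bar R) :
  (0 < p)%R -> (0 < q)%R -> (p < N%:R)%R -> (forall k, 0 <= h k) ->
  seqnorm p q (fun k => ereal_sup (range (fun j : nat => (e2 j%:R)%:E * h (k + (N * j)%:Z)%R))) <=
  ((1 - e2 (q * (1 - N%:R / p)))^-1)%:E * seqnorm p q h.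
Proof.
move=> p0 q0 pN h0; have := @seqnorm_sup_shift R p q 1 N%:Z h q0 _ h0.
rewrite -pmulrn ltr_pdivlMr// mul1r => /(_ pN); apply: le_trans; apply: seqnorm_le; first exact: ltW.
  by move=> k; apply: le_ereal_sup_tmp; exists ((e2 0%:R)%:E * h (k + (N * 0)%:Z)%R); [exists 0%N|rewrite mule_ge0 ?lee_fin ?e2_ge0].
move=> k; apply: ge_ereal_sup => _ [j _ <-]; apply: ereal_sup_ubound; exists j => //.
by rewrite mulr1 -PoszM.
Qed.

(** As [p < a], the terms grow geometrically in [k], so the last one, at the scale [2 ^ J <= rn],
    controls the sum. *)
Lemma seqnorm_tail (p q a D rn : R) (J : int) : (0 < p)%R -> (0 < q)%R -> (p < a)%R ->
  (0 <= D)%R -> (0 < rn)%R -> (e2 J%:~R <= rn)%R ->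
  seqnorm p q (fun k => if (k <= J)%R then (D * (rn / e2 k%:~R) `^ a^-1)%:E else 0) <=
  ((1 - e2 (- (q * (p^-1 - a^-1))))^-1 * (D * rn `^ p^-1) `^ q)%:E.
Proof.
move=> p0 q0 pa D0 rn0 Jrn.
have a0 : (0 < a)%R by exact: lt_trans pa.
have d0 : (0 < p^-1 - a^-1)%R by rewrite subr_gt0 ltf_pV2.
have qd0 : (0 < q * (p^-1 - a^-1))%R by rewrite mulr_gt0.
pose c := ((D * rn `^ a^-1) `^ q)%R; have c0 : (0 <= c)%R by exact: powR_ge0.
apply: (@le_trans _ _ (c%:E * \esum_(k in [set: int]) (if (k <= J)%R then (e2 (k%:~R * (q * (p^-1 - a^-1)))%R)%:E else 0))).
  rewrite -esumZl//; last by move=> k; case: ifP; rewrite ?lee_fin ?e2_ge0.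
  apply: le_esum => k _; case: ifP => _; last by rewrite !mule0 poweR0r// gt_eqF.
  rewrite -EFinM poweR_EFin -EFinM lee_fin /c.
  move: (k%:~R : R) => x; rewrite (_ : x * (q * (p^-1 - a^-1)) = x * (p^-1 - a^-1) * q)%R; last by ring.
  rewrite (e2M (x * (p^-1 - a^-1)) q) -(powRM q (mulr_ge0 D0 (powR_ge0 _ _)) (e2_ge0 _)).
  have -> : ((rn / e2 x) `^ a^-1 = rn `^ a^-1 * e2 (- (x * a^-1)))%R.
    by rewrite powRM ?invr_ge0 ?e2_ge0 ?(ltW rn0)// -e2N -e2M mulNr.
  rewrite mulrBr e2D (_ : e2 _ * (D * _) = D * rn `^ a^-1 * (e2 (x / p) * e2 (- (x * a^-1))))%R//; ring.
apply: (@le_trans _ _ (c%:E * ((1 - e2 (- (q * (p^-1 - a^-1))))^-1 * e2 (J%:~R * (q * (p^-1 - a^-1))))%R%:E)).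
  by rewrite lee_wpmul2l// esum_int_below.
have c1 : (0 <= (1 - e2 (- (q * (p^-1 - a^-1))))^-1)%R.
  by rewrite invr_ge0 subr_ge0 ltW// e2_lt1// oppr_lt0.
rewrite -EFinM lee_fin [(c * _)%R]mulrC -mulrA [(_ * c)%R]mulrC; apply: ler_wpM2l; first exact: c1.
rewrite (_ : J%:~R * (q * _) = J%:~R * (p^-1 - a^-1) * q)%R; last by ring.
rewrite (e2M (J%:~R * _) q) /c -(powRM q (mulr_ge0 D0 (powR_ge0 _ _)) (e2_ge0 _)) ge0_ler_powR ?nnegrE ?mulr_ge0 ?powR_ge0 ?e2_ge0 ?(ltW q0)//.
have -> : (rn `^ p^-1 = rn `^ a^-1 * rn `^ (p^-1 - a^-1))%R.
  by rewrite -powRD ?(gt_eqF rn0) ?implybT// addrC subrK.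
rewrite mulrA (e2M J%:~R); apply: ler_wpM2l; first by rewrite mulr_ge0 ?powR_ge0.
by rewrite ge0_ler_powR ?nnegrE ?e2_ge0 ?(ltW d0) ?(ltW rn0).
Qed.

End SequenceProducts.

Section DiscreteMorrey.
Context {R : realType} {n : nat}.
Hypothesis n_gt0 : (0 < n)%N.
Local Notation mu := (lebesgue_Rn R n).
Local Open Scope ereal_scope.

(** A Morrey-Lorentz norm of at most [N], up to constants. As a family of inequalities in [seqnorm]
    it serves the classical Morrey norm as well when [p = q]. *)
Definition discrete_morrey (p q lam : R) (f : Rn R n -> R) (N : \bar R) :=
  forall x s, (0 < s)%R -> seqnorm p q (rearr (cutoff x s f)) <= ((s `^ (lam / q))%:E * N) `^ q.

Definition gtail_const (p q kap : R) : R := ((1 - e2 (q * (p^-1 - kap)))^-1 `^ q^-1)%R.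

Variables (p q lam kap rho : R) (f : Rn R n -> R) (N : \bar R).
Hypotheses (p_gt0 : (0 < p)%R) (q_gt0 : (0 < q)%R) (pk : (p^-1 < kap)%R).
Hypotheses (rho_gt0 : (0 < rho)%R) (kr : (kap * rho < 1)%R).
Hypothesis mf : measurable_fun [set: Rn R n] f.
Hypotheses (N_ge0 : 0 <= N) (fN : discrete_morrey p q lam f N).

Lemma gtail_morrey x s : (0 < s)%R ->
  seqnorm p q (fun k => gtail (cutoff x s f) kap k%:~R) <=
  ((gtail_const p q kap)%:E * ((s `^ (lam / q))%:E * N)) `^ q.
Proof.
move=> s0; apply: (le_trans (seqnorm_gtail _ q_gt0 pk)).
have c0 : (0 <= (1 - e2 (q * (p^-1 - kap)))^-1)%R.
  by rewrite invr_ge0 subr_ge0 ltW// e2_lt1// pmulr_rlt0// subr_lt0.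
rewrite poweRM ?lee_fin ?powR_ge0 ?mule_ge0 ?lee_fin ?powR_ge0// poweR_EFin.
rewrite /gtail_const -powRrM mulVf ?gt_eqF// powRr1//.
by rewrite lee_wpmul2l ?lee_fin// fN.
Qed.

(** [Q] lies in the ball of radius [n.+1 * side Q] about its corner. At the scale [k] with [2 ^ k]
    about the volume of [Q], a single term of the sequence norm bounds [gtail] and hence the mean;
    [2 ^ (- k / p)] becomes [side Q ^ (- n / p)]. *)
Lemma power_mean_morrey (Q : cube R n) :
  power_mean rho f Q <=
  (mean_const rho kap * e2 p^-1 * gtail_const p q kap * n.+1%:R `^ (lam / q) *
   side Q `^ (lam / q - n%:R / p))%:E * N.
Proof.
have sQ := side_gt0 Q.
have [k /andP[k1 k2]] := dyadic_scale_lt (cube_vol_gt0 Q).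
pose s := (n.+1%:R * side Q)%R.
have s0 : (0 < s)%R by rewrite mulr_gt0.
pose f' := cutoff (corner Q) s f.
have -> : power_mean rho f Q = power_mean rho f' Q.
  apply: power_mean_eq => x Qx; rewrite /f' cutoffE//; apply: coord_eball => // i.
  by rewrite ltW//; exact: cube_coord i Qx (corner_in Q).
have mf' : measurable_fun [set: Rn R n] f' by exact: measurable_cutoff.
apply: (le_trans (power_mean_large mf' rho_gt0 kr (k := k%:~R) _)).
  by rewrite lebesgue_cube -EFinM lee_fin (le_trans k1)// ler_peMl ?(ltW (cube_vol_gt0 Q))// ler1n.
set G := gtail f' kap k%:~R.
have G0 : 0 <= G by exact: gtail_ge0.
have g0 : (0 <= gtail_const p q kap)%R by exact: powR_ge0.
have : (e2 (k%:~R / p))%:E * G <= (gtail_const p q kap)%:E * ((s `^ (lam / q))%:E * N).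
  apply: (poweR_le_cancel q_gt0); rewrite ?mule_ge0 ?lee_fin ?e2_ge0 ?powR_ge0//.
  apply: le_trans (gtail_morrey (corner Q) s0).
  apply: (@esum_ge_term _ _ _ (fun k : int => ((e2 (k%:~R / p))%:E * gtail f' kap k%:~R) `^ q)) => // i.
  exact: poweR_ge0.
rewrite -lee_pdivlMl ?e2_gt0// => h.
apply: (@le_trans _ _ ((mean_const rho kap)%:E * ((e2 (k%:~R / p))^-1%:E * ((gtail_const p q kap)%:E * ((s `^ (lam / q))%:E * N))))).
  by rewrite lee_wpmul2l ?lee_fin ?(ltW (mean_const_gt0 kr)).
have k3 : ((e2 (k%:~R / p))^-1 <= e2 p^-1 * side Q `^ (- (n%:R / p)))%R.
  rewrite powRN (powRrM (side Q)) powR_mulrn ?(ltW sQ)//.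
  rewrite ler_pdivlMr ?powR_gt0 ?cube_vol_gt0// mulrC ler_pdivrMr ?e2_gt0//.
  rewrite -e2D (_ : p^-1 + k%:~R / p = (k + 1)%:~R * p^-1)%R; last by rewrite intrD; ring.
  by rewrite (e2M (k + 1)%:~R) ge0_ler_powR ?nnegrE ?e2_ge0 ?invr_ge0 ?(ltW p_gt0) ?(ltW (cube_vol_gt0 Q)) ?(ltW k2).
rewrite !muleA -!EFinM lee_wpmul2r// lee_fin.
rewrite powRD ?(gt_eqF sQ) ?implybT//.
have -> : (s `^ (lam / q) = n.+1%:R `^ (lam / q) * side Q `^ (lam / q))%R.
  by rewrite powRM ?(ltW sQ).
have M0 := ltW (mean_const_gt0 kr).
set u := (_ `^ _)%R; set v := (_ `^ _)%R; set w := (side Q `^ - _)%R.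
have -> : (mean_const rho kap * (e2 (k%:~R / p))^-1 * gtail_const p q kap * (u * v) =
   mean_const rho kap * gtail_const p q kap * u * v * (e2 (k%:~R / p))^-1)%R by ring.
have -> : (mean_const rho kap * e2 p^-1 * gtail_const p q kap * u * (v * w) =
   mean_const rho kap * gtail_const p q kap * u * v * (e2 p^-1 * w))%R by ring.
by apply: ler_wpM2l => //; rewrite !mulr_ge0// powR_ge0.
Qed.

End DiscreteMorrey.

Section SparseBound.
Context {R : realType} {n m l : nat}.
Hypothesis n_gt0 : (0 < n)%N.
Local Notation mu := (lebesgue_Rn R n).
Variables (hlm : (l <= m)%N) (a0 a N : nat) (kap eta A delta Cj C0 : R).
Let rho : R := 1 + a0%:R^-1.
Hypotheses (a0_gt0 : (0 < a0)%N) (kr : kap * rho < 1) (eta_gt0 : 0 < eta) (eta_lt1 : eta < 1).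
Hypotheses (A_ge0 : 0 <= A) (aN : (2 * N < a)%N) (delta_gt0 : 0 < delta) (Cj_gt0 : 0 < Cj).
Hypothesis aD : n%:R < a%:R * delta / 2.

Variables (b : 'I_l -> Rn R n -> R) (B : 'I_l -> R) (f : 'I_m -> Rn R n -> R) (F : Rn R n -> R).
Hypothesis B_gt0 : forall s, 0 < B s.
Hypothesis mb : forall s, measurable_fun [set: Rn R n] (b s).
Hypothesis mf : forall i, measurable_fun [set: Rn R n] (f i).
Hypothesis osc : forall s (Q : cube R n),
  (\int[mu]_(x in cube_set Q) ((`|b s x - mean Q (b s)| / B s) ^+ a0.+1)%:E <= Cj%:E * mu (cube_set Q))%E.
Hypothesis tw : forall g, tail_weight A a (osc_weight b B g).
Hypothesis mF : measurable_fun [set: Rn R n] F.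

Definition sparse_sum (S : set (cube R n)) (g : {ffun 'I_l -> bool}) (x : Rn R n) : \bar R :=
  (\esum_(Q in S)
    ((\prod_(s < l) sparse_factor (b s) (f (widen_ord hlm s)) Q (g s) x)
     * (\prod_(s < m | (l <= s)%N) average_abs Q (f s)) * (\1_(cube_set Q) x)%:E))%E.

Variable S : 'I_(3 ^ n) -> set (cube R n).
Hypothesis spS : forall j, sparse eta (S j).
Hypothesis domF : {ae mu, forall x, (`|(F x)%:E| <=
  C0%:E * \sum_(j < 3 ^ n) \sum_(g : {ffun 'I_l -> bool}) sparse_sum (S j) g x)%E}.

Definition families : R := #|{: 'I_(3 ^ n) * {ffun 'I_l -> bool}}|%:R.
Definition level_bound : R := `|@local_const R m eta A a N| + `|@large_const R n A delta a|.
Definition sparse_bound : R := (`|C0| + 1) * families * (Cj + 2) ^+ m * level_bound.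

Lemma sparse_factor_ge0 (b' f' : Rn R n -> R) Q g x : (0 <= sparse_factor b' f' Q g x)%E.
Proof.
rewrite /sparse_factor; case: g; first exact: average_abs_ge0.
by apply: mule_ge0; [exact: abse_ge0|exact: average_abs_ge0].
Qed.

Lemma sparse_sum_le (S' : set (cube R n)) g x :
  (sparse_sum S' g x <= ((Cj + 2) ^+ m * \prod_(s < l) B s)%:E *
    \esum_(Q in S') (mean_product rho f Q * (osc_weight b B g Q x)%:E * (\1_(cube_set Q) x)%:E))%E.
Proof.
have [_ w0 _] := tw g.
rewrite -esumZl.
- apply: le_esum => Q _; rewrite [leRHS]muleA lee_wpmul2r ?lee_fin//.
  exact: sparse_term_le.
- by rewrite mulr_ge0 ?exprn_ge0 ?addr_ge0 ?(ltW Cj_gt0)// prodr_ge0// => s _; exact: ltW.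
- by move=> Q; rewrite !mule_ge0 ?mean_product_ge0 ?lee_fin.
Qed.

(** The exceptional sets of all pairs of a sparse family and a choice [g] are united; their number
    is [families], whence the argument of the rearrangement. *)
Lemma sparse_rearrangement_le (x0 : Rn R n) (r D k L : R) :
  0 < r -> 0 <= D -> 0 < L ->
  (forall Q, r < side Q -> (mean_product rho f Q <= (D * (side Q / r) `^ (- delta))%:E)%E) ->
  (forall j : nat, (gtail_product rho kap (fun i => cutoff x0 (n.+1%:R * (2 * r)) (f i)) (k + N%:R * j%:R)
     <= (L * e2 (- j%:R))%:E)%E) ->
  (rearrangement (cutoff x0 r F) (families * level_bound * e2 k) <=
   (sparse_bound * \prod_(s < l) B s * (L + D * (r ^+ n / e2 k) `^ (a%:R^-1)))%:E)%E.
Proof.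
move=> r0 D0 L0 HD HL.
have rho0 : 0 < rho by rewrite addr_gt0// invr_gt0 ltr0n.
have PB0 : 0 <= \prod_(s < l) B s by apply: prodr_ge0 => s _; exact: ltW.
pose I : finType := ('I_(3 ^ n) * {ffun 'I_l -> bool})%type.
pose X : R := L + D * (r ^+ n / e2 k) `^ (a%:R^-1).
have X0 : 0 <= X by rewrite addr_ge0 ?(ltW L0)// mulr_ge0// powR_ge0.
have lb0 : 0 <= level_bound by rewrite addr_ge0.
have h (z : I) : exists E, [/\ measurable E, (mu E <= (level_bound * e2 k)%:E)%E &
    forall x, eball x0 r x -> ~ E x ->
      (sparse_sum (S z.1) z.2 x <= ((Cj + 2) ^+ m * \prod_(s < l) B s * level_bound * X)%:E)%E].
  have [Dl [lD SD spz]] := spS z.1.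
  have gS : grid (S z.1) by apply: grid_sub SD _; exact: grid_lattice.
  have [E [mE muE HE]] := level_estimate n_gt0 rho0 kr eta_gt0 eta_lt1 A_ge0 aN delta_gt0 aD mf gS spz (tw z.2) r0 D0 L0 HD HL.
  exists E; split=> //.
  - by apply: (le_trans muE); rewrite lee_fin ler_wpM2r ?e2_ge0// lerD// ler_norm.
  - move=> x Bx nE; apply: (le_trans (sparse_sum_le _ _ _)).
    rewrite -[_ * level_bound * X]mulrA [leRHS]EFinM lee_wpmul2l ?lee_fin ?mulr_ge0 ?exprn_ge0 ?addr_ge0 ?(ltW Cj_gt0)//.
    apply: (le_trans (HE x Bx nE)); rewrite lee_fin /X mulrDr -[@large_const R n A delta a * D * _]mulrA; apply: lerD.
      by apply: ler_wpM2r; [exact: ltW|rewrite (le_trans (ler_norm _))// lerDl].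
    apply: ler_wpM2r; first by rewrite mulr_ge0// powR_ge0.
    by rewrite (le_trans (ler_norm _))// lerDr.
have [E HE] := choice h.
have mE z : measurable (E z) by case: (HE z).
pose U := \big[setU/set0]_(z : I) E z.
have mU : measurable U by exact: bigsetU_measurable.
apply: (@rearrangement_le_ae _ _ _ U) => //.
- exact: measurable_cutoff.
- apply: (le_trans (measure_bigsetU_le _ _ _)) => //.
  apply: (@le_trans _ _ (\sum_(z : I) (level_bound * e2 k)%:E)%E).
    by apply: lee_sum => z _; case: (HE z).
  by rewrite sumEFin sumr_const lee_fin -[_ *+ _]mulr_natl mulrA.
- rewrite mulr_ge0// mulr_ge0// /sparse_bound !mulr_ge0 ?exprn_ge0 ?addr_ge0 ?(ltW Cj_gt0)//.
apply: filterS domF => x domx nU.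
have s0 : 0 <= sparse_bound * \prod_(s < l) B s * X.
  by rewrite mulr_ge0// mulr_ge0// /sparse_bound !mulr_ge0 ?exprn_ge0 ?addr_ge0 ?(ltW Cj_gt0).
have [Bx|nBx] := pselect (eball x0 r x); last first.
  by rewrite /cutoff indicE memNset// mulr0 normr0.
rewrite cutoffE// -lee_fin; apply: (le_trans domx).
have ss0 j g : (0 <= sparse_sum (S j) g x)%E.
  apply: esum_ge0 => Q _; rewrite !mule_ge0 ?lee_fin//; apply: prode_ge0 => s _.
    exact: sparse_factor_ge0.
  exact: average_abs_ge0.
rewrite pair_big/=.
apply: (@le_trans _ _ ((`|C0| + 1)%:E * \sum_(z : I) sparse_sum (S z.1) z.2 x)%E).
  apply: lee_wpmul2r; first by apply: sume_ge0 => z _.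
  by rewrite lee_fin (le_trans (ler_norm _))// lerDl.
apply: (@le_trans _ _ ((`|C0| + 1)%:E * \sum_(z : I) ((Cj + 2) ^+ m * \prod_(s < l) B s * level_bound * X)%:E)%E).
  apply: lee_wpmul2l; first by rewrite lee_fin addr_ge0.
  apply: lee_sum => z _; case: (HE z) => _ _; apply => // Ezx; apply: nU.
  by rewrite /U -bigcup_seq; exists z => //=; rewrite mem_index_enum.
rewrite sumEFin sumr_const -EFinM lee_fin -[_ *+ _]mulr_natl /sparse_bound -/families -/X.
by rewrite le_eqVlt; apply/orP; left; apply/eqP; ring.
Qed.

Lemma rearrangement_cutoff0 (x0 : Rn R n) (r t : R) : 0 < r -> (2 * r) ^+ n <= t ->
  rearrangement (cutoff x0 r F) t = 0%E.
Proof.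
move=> r0 rt; apply/eqP; rewrite eq_le rearrangement_ge0 andbT rearrangement_le//; last exact: measurable_cutoff.
apply: (@le_trans _ _ (mu (eball x0 r))).
  apply: le_measure; rewrite ?inE.
  - by apply: measurable_gt_norm; exact: measurable_cutoff.
  - exact: measurable_eball.
  - move=> x /=; have [//|nBx] := pselect (eball x0 r x).
    by rewrite /cutoff indicE memNset// mulr0 normr0 ltxx.
apply: (@le_trans _ _ ((2 * r) ^+ n)%:E); last by rewrite lee_fin.
apply: (@lebesgue_supball_le _ _ x0) => //; first exact: measurable_eball.
by move=> y i; exact: eball_coord.
Qed.

End SparseBound.

Section MorreyProducts.
Context {R : realType} {n m : nat}.
Hypothesis n_gt0 : (0 < n)%N.
Variables (p q lam kap rho : R) (ps qs : 'I_m -> R).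
Hypotheses (p_gt0 : 0 < p) (q_gt0 : 0 < q) (ps_gt0 : forall i, 0 < ps i) (qs_gt0 : forall i, 0 < qs i).
Hypotheses (hp : p^-1 = \sum_(i < m) (ps i)^-1) (hq : q^-1 = \sum_(i < m) (qs i)^-1).
Hypotheses (pk : forall i, (ps i)^-1 < kap) (rho_gt0 : 0 < rho) (kr : kap * rho < 1).
Variables (f : 'I_m -> Rn R n -> R) (M : 'I_m -> \bar R).
Hypothesis mf : forall i, measurable_fun [set: Rn R n] (f i).
Hypothesis M_ge0 : forall i, (0 <= M i)%E.
Hypothesis fM : forall i, discrete_morrey (ps i) (qs i) lam (f i) (M i).

Definition mean_morrey_const : R :=
  \prod_(i < m) (mean_const rho kap * e2 (ps i)^-1 * gtail_const (ps i) (qs i) kap * n.+1%:R `^ (lam / qs i)).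

Definition gtail_morrey_const : R :=
  \prod_(i < m) (mean_const rho kap * gtail_const (ps i) (qs i) kap).

Lemma mean_morrey_const_ge0 : 0 <= mean_morrey_const.
Proof.
by apply: prodr_ge0 => i _; rewrite !mulr_ge0 ?powR_ge0// ltW// mean_const_gt0.
Qed.

Lemma gtail_morrey_const_ge0 : 0 <= gtail_morrey_const.
Proof. by apply: prodr_ge0 => i _; rewrite mulr_ge0 ?powR_ge0// ltW// mean_const_gt0. Qed.

Lemma prod_powR (x : R) (a : 'I_m -> R) : 0 < x -> \prod_(i < m) x `^ a i = x `^ (\sum_(i < m) a i).
Proof.
by move=> x0; elim/big_rec2: _ => [|i u v _ ->]; rewrite ?powRr0// powRD// (gt_eqF x0) implybT.
Qed.

Lemma mean_product_morrey (Q : cube R n) :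
  (mean_product rho f Q <= (mean_morrey_const * side Q `^ (lam / q - n%:R / p))%:E * \prod_(i < m) M i)%E.
Proof.
rewrite /mean_morrey_const.
have -> : lam / q - n%:R / p = \sum_(i < m) (lam / qs i - n%:R / ps i).
  by rewrite hp hq !mulr_sumr sumrB.
rewrite -prod_powR ?side_gt0// -big_split/= -prod_EFinM.
apply: lee_prod => i _; first exact: power_mean_ge0.
exact: power_mean_morrey.
Qed.

Lemma gtail_product_morrey x s : 0 < s ->
  (seqnorm p q (fun k => gtail_product rho kap (fun i => cutoff x s (f i)) k%:~R) <=
   ((gtail_morrey_const * s `^ (lam / q))%:E * \prod_(i < m) M i) `^ q)%E.
Proof.
move=> s0; have mc0 := ltW (mean_const_gt0 kr).
have gt0 i k : (0 <= (mean_const rho kap)%:E * gtail (cutoff x s (f i)) kap k)%E.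
  by rewrite mule_ge0 ?gtail_ge0.
apply: (le_trans (seqnorm_prod q_gt0 qs_gt0 hp hq _)) => [i k|]; first exact: gt0.
pose c i := mean_const rho kap * gtail_const (ps i) (qs i) kap * s `^ (lam / qs i).
have c0 i : 0 <= c i by rewrite !mulr_ge0 ?powR_ge0.
apply: (@le_trans _ _ (\prod_(i < m) (((c i)%:E * M i) `^ q))%E).
  apply: lee_prod => i _; first exact: poweR_ge0.
  rewrite [X in (_ <= _ `^ X)%E](_ : q = qs i * (q / qs i)); last by rewrite mulrC divfK ?gt_eqF.
  rewrite [leRHS]poweRrM; apply: le_poweR; [by rewrite divr_ge0 ?(ltW q_gt0) ?(ltW (qs_gt0 i))|exact: seqnorm_ge0|].
  rewrite seqnormZ//; last by move=> k; exact: gtail_ge0.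
  rewrite /c -mulrA 2!EFinM -!muleA [leRHS]poweRM ?mule_ge0 ?lee_fin ?powR_ge0//.
  by rewrite poweR_EFin lee_wpmul2l ?lee_fin ?powR_ge0// gtail_morrey.
rewrite -prode_poweR; last by move=> i; rewrite mule_ge0 ?lee_fin.
rewrite prod_EFinM /c big_split/= prod_powR// -/gtail_morrey_const.
by rewrite hq mulr_sumr.
Qed.

End MorreyProducts.

Lemma seqnormD_le (R : realType) (p q : R) (h h' : int -> \bar R) : 0 < q ->
  (forall k, 0 <= h k)%E -> (forall k, 0 <= h' k)%E ->
  (seqnorm p q (fun k => h k + h' k) <= (e2 q)%:E * (seqnorm p q h + seqnorm p q h'))%E.
Proof.
move=> q0 h0 h'0.
have e0 (x : int -> \bar R) k : (forall k, 0 <= x k)%E -> (0 <= (e2 (k%:~R / p))%:E * x k)%E.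
  by move=> x0; rewrite mule_ge0 ?lee_fin ?e2_ge0.
rewrite /seqnorm -esumD; [|by move=> k _; exact: poweR_ge0..].
rewrite -esumZl ?e2_ge0//; last by move=> k; rewrite adde_ge0 ?poweR_ge0.
apply: le_esum => k _; rewrite ge0_muleDr//.
by apply: poweRD_le; rewrite ?e0.
Qed.

Section Core.
Context {R : realType} {n m l : nat}.
Hypothesis n_gt0 : (0 < n)%N.
Local Notation mu := (lebesgue_Rn R n).
Variables (hlm : (l <= m)%N) (p q lam : R) (ps qs : 'I_m -> R).
Hypotheses (p_gt0 : 0 < p) (q_gt0 : 0 < q) (ps_gt0 : forall i, 0 < ps i) (qs_gt0 : forall i, 0 < qs i).
Hypotheses (hp : p^-1 = \sum_(i < m) (ps i)^-1) (hq : q^-1 = \sum_(i < m) (qs i)^-1).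
Variables (a0 a N k0 : nat) (kap eta A Cj C0 : R).
Let rho : R := 1 + a0%:R^-1.
Let delta : R := n%:R / p - lam / q.
Hypotheses (a0_gt0 : (0 < a0)%N) (kr : kap * rho < 1) (eta_gt0 : 0 < eta) (eta_lt1 : eta < 1).
Hypotheses (A_ge0 : 0 <= A) (pN : p < N%:R) (aN : (2 * N < a)%N) (delta_gt0 : 0 < delta).
Hypotheses (Cj_gt0 : 0 < Cj) (aD : n%:R < a%:R * delta / 2) (pk : forall i, (ps i)^-1 < kap).
Hypothesis k0_large : @families R n l * @level_bound R n m a N eta A delta + 2 ^+ n <= e2 k0%:R.

Let Cd : R := @mean_morrey_const R n m lam kap rho ps qs.
Let Cg : R := @gtail_morrey_const R m kap rho ps qs.
Let SB : R := @sparse_bound R n m l a N eta A delta Cj C0 + 1.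
Let c2 : R := (1 - e2 (q * (1 - N%:R / p)))^-1.
Let c4 : R := (1 - e2 (- (q * (p^-1 - a%:R^-1))))^-1.
Let Z : R := e2 q * (c2 * (Cg * (n.+1%:R * 2) `^ (lam / q)) `^ q + c4 * Cd `^ q) + 1.

(** [e2 (k0%:R / p)] is the price of a shift by [k0] scales; [c2] and [c4] are the constants of
    [seqnorm_scales] and [seqnorm_tail]. [SB] and [Z] contain a summand 1 to be positive. *)
Definition core_const : R := e2 (k0%:R / p) * SB * Z `^ q^-1.

Let rho0 : 0 < rho. Proof. by rewrite addr_gt0// invr_gt0 ltr0n. Qed.
Let Cd0 : 0 <= Cd. Proof. exact: mean_morrey_const_ge0. Qed.
Let Cg0 : 0 <= Cg. Proof. exact: gtail_morrey_const_ge0. Qed.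
Let pa : p < a%:R.
Proof. by apply: (lt_trans pN); rewrite ltr_nat (leq_ltn_trans _ aN)// leq_pmull. Qed.
Let c20 : 0 <= c2.
Proof.
rewrite invr_ge0 subr_ge0 ltW// e2_lt1// pmulr_rlt0// subr_lt0 ltr_pdivlMr// mul1r.
exact: pN.
Qed.
Let c40 : 0 <= c4.
Proof.
rewrite invr_ge0 subr_ge0 ltW// e2_lt1// oppr_lt0 mulr_gt0// subr_gt0 ltf_pV2 ?posrE//.
exact: lt_trans pa.
Qed.
Let Z0 : 0 < Z.
Proof. by rewrite ltr_wpDl// !(mulr_ge0, addr_ge0, e2_ge0, powR_ge0). Qed.
Let SB0 : 0 < SB.
Proof.
by rewrite ltr_wpDl// /sparse_bound !mulr_ge0 ?addr_ge0 ?exprn_ge0 ?addr_ge0 ?(ltW Cj_gt0)//.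
Qed.

Lemma core_const_gt0 : 0 < core_const.
Proof. by rewrite !mulr_gt0 ?e2_gt0 ?powR_gt0. Qed.

Variables (b : 'I_l -> Rn R n -> R) (B : 'I_l -> R) (f : 'I_m -> Rn R n -> R) (F : Rn R n -> R).
Variable M : 'I_m -> \bar R.
Hypothesis B_gt0 : forall s, 0 < B s.
Hypothesis mb : forall s, measurable_fun [set: Rn R n] (b s).
Hypothesis mf : forall i, measurable_fun [set: Rn R n] (f i).
Hypothesis osc : forall s (Q : cube R n),
  (\int[mu]_(x in cube_set Q) ((`|b s x - mean Q (b s)| / B s) ^+ a0.+1)%:E <= Cj%:E * mu (cube_set Q))%E.
Hypothesis tw : forall g, tail_weight A a (osc_weight b B g).
Hypothesis mF : measurable_fun [set: Rn R n] F.
Variable S : 'I_(3 ^ n) -> set (cube R n).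
Hypothesis spS : forall j, sparse eta (S j).
Hypothesis domF : {ae mu, forall x, (`|(F x)%:E| <=
  C0%:E * \sum_(j < 3 ^ n) \sum_(g : {ffun 'I_l -> bool}) sparse_sum hlm b f (S j) g x)%E}.
Hypothesis M_ge0 : forall i, (0 <= M i)%E.
Hypothesis fM : forall i, discrete_morrey (ps i) (qs i) lam (f i) (M i).

Let PB := \prod_(s < l) B s.
Let PB0 : 0 < PB. Proof. by apply: prodr_gt0 => s _. Qed.

Let H (x0 : Rn R n) (r : R) (k : int) : \bar R :=
  gtail_product rho kap (fun i => cutoff x0 (n.+1%:R * (2 * r)) (f i)) k%:~R.
Let Lam (x0 : Rn R n) (r : R) (k : int) : \bar R :=
  ereal_sup (range (fun j : nat => (e2 j%:R)%:E * H x0 r (k + (N * j)%:Z)%R)%E).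

Let H_ge0 x0 r k : (0 <= H x0 r k)%E.
Proof.
by apply: prode_ge0 => i _; rewrite mule_ge0 ?gtail_ge0 ?lee_fin ?(ltW (mean_const_gt0 kr)).
Qed.

Let Lam_ge0 x0 r k : (0 <= Lam x0 r k)%E.
Proof.
apply: le_ereal_sup_tmp; exists ((e2 0%:R)%:E * H x0 r (k + (N * 0)%:Z)%R)%E; first by exists 0%N.
by rewrite mule_ge0 ?lee_fin ?e2_ge0.
Qed.

(** The shift [k0] serves twice: [2 ^ (k + k0)] exceeds the bound on the measure of the exceptional
    sets and, for [k > J], also the bound [(2 r) ^ n] on the measure of the ball, so that the
    rearrangement of the cut-off function vanishes there. *)
Lemma sparse_dominated_rearr (x0 : Rn R n) (r pm : R) (J k : int) : 0 < r -> 0 <= pm ->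
  (\prod_(i < m) M i)%E = pm%:E -> r ^+ n < e2 (J + 1)%:~R ->
  (rearr (cutoff x0 r F) (k + k0%:Z)%R <= (SB * PB)%:E * (Lam x0 r k +
    if (k <= J)%R then (Cd * r `^ (- delta) * pm * (r ^+ n / e2 k%:~R) `^ a%:R^-1)%:E else 0))%E.
Proof.
move=> r0 pm0 PM Jr; set D := Cd * _ * pm; set T : \bar R := if _ then _ else _.
have D0 : 0 <= D by rewrite !mulr_ge0 ?powR_ge0.
have T0 : (0 <= T)%E by rewrite /T; case: ifP => // _; rewrite lee_fin mulr_ge0 ?powR_ge0.
have K0 : 0 < SB * PB by rewrite mulr_gt0.
have k0E : e2 (k + k0%:Z)%:~R = e2 k%:~R * e2 k0%:R :> R by rewrite intrD e2D -pmulrn.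
have fl0 : 0 <= @families R n l * @level_bound R n m a N eta A delta by rewrite mulr_ge0// addr_ge0.
have [Jk|kJ] := leP (J + 1)%R k.
  rewrite /rearr (rearrangement_cutoff0 mF)//; first by rewrite mule_ge0 ?adde_ge0// lee_fin ltW.
  rewrite k0E exprMn mulrC; apply: ler_pM; rewrite ?exprn_ge0 ?(ltW r0)//.
    by rewrite (le_trans (ltW Jr))// ler_e2 ler_int.
  by apply: le_trans k0_large; rewrite lerDr.
have {}kJ : (k <= J)%R by rewrite -ltzD1.
have [Ly|Ly] := eqVneq (Lam x0 r k) +oo%E.
  by rewrite Ly addye ?gt0_muley ?leey ?lte_fin// -ltNye (lt_le_trans _ T0)// ltNyr.
have Lf : Lam x0 r k \is a fin_num by rewrite ge0_fin_numE// ltey.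
apply/lee_addgt0Pr => e e0.
(* [Lam] may vanish, whereas the level estimate wants a positive [L]; the surplus is the allowed
   error [e] divided by the final factor. *)
pose L := fine (Lam x0 r k) + e / (SB * PB).
have L0 : 0 < L by rewrite ltr_wpDl ?fine_ge0// divr_gt0.
have HD Q : r < side Q -> (mean_product rho f Q <= (D * (side Q / r) `^ (- delta))%:E)%E.
  move=> rQ; apply: (le_trans (mean_product_morrey ps_gt0 qs_gt0 hp hq pk rho0 kr mf M_ge0 fM Q)).
  rewrite PM -EFinM lee_fin -/Cd /D (_ : lam / q - n%:R / p = - delta); last by rewrite opprB.
  have -> : side Q `^ (- delta) = r `^ (- delta) * (side Q / r) `^ (- delta).
    by rewrite -powRM ?divr_ge0 ?(ltW r0) ?(ltW (side_gt0 Q))// mulrC divfK ?gt_eqF.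
  by rewrite le_eqVlt; apply/orP; left; apply/eqP; ring.
have HL (j : nat) : (gtail_product rho kap (fun i => cutoff x0 (n.+1%:R * (2 * r)) (f i)) (k%:~R + N%:R * j%:R)
    <= (L * e2 (- j%:R))%:E)%E.
  have -> : k%:~R + N%:R * j%:R = (k + (N * j)%:Z)%:~R :> R by rewrite intrD -pmulrn natrM.
  rewrite -/(H x0 r _) e2N mulrC EFinM -lee_pdivrMl ?invr_gt0 ?e2_gt0// invrK.
  apply: (@le_trans _ _ (Lam x0 r k)); first by apply: ereal_sup_ubound; exists j.
  by rewrite -(fineK Lf) lee_fin lerDl divr_ge0// ltW.
have key := sparse_rearrangement_le n_gt0 a0_gt0 kr eta_gt0 eta_lt1 A_ge0 aN delta_gt0 Cj_gt0 aD
  B_gt0 mb mf osc tw mF spS domF r0 D0 L0 HD HL.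
apply: (@le_trans _ _ (rearrangement (cutoff x0 r F) (@families R n l * @level_bound R n m a N eta A delta * e2 k%:~R))).
  apply: rearrangement_antitone; first exact: measurable_cutoff.
  rewrite k0E mulrC ler_wpM2l ?e2_ge0// (le_trans _ k0_large)// lerDl exprn_ge0//.
set t := _ `^ _ in key.
have TE : T = (D * t)%:E by rewrite /T kJ.
apply: (le_trans key); have -> : (Lam x0 r k + T)%E = (fine (Lam x0 r k) + D * t)%:E by rewrite TE EFinD fineK.
rewrite -EFinM -EFinD lee_fin.
apply: (@le_trans _ _ (SB * PB * (L + D * t))).
  apply: ler_wpM2r; first by rewrite addr_ge0 ?(ltW L0)// mulr_ge0// powR_ge0.
  by apply: ler_wpM2r; [exact: ltW|rewrite lerDl].
rewrite /L le_eqVlt; apply/orP; left; apply/eqP; field.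
by rewrite !gt_eqF.
Qed.

Lemma sparse_dominated_morrey :
  discrete_morrey p q lam F ((core_const * PB)%:E * \prod_(i < m) M i)%E.
Proof.
move=> x0 r r0.
have PM0 : (0 <= \prod_(i < m) M i)%E by exact: prode_ge0.
have [My|My] := eqVneq (\prod_(i < m) M i)%E +oo%E.
  rewrite My muleA -EFinM gt0_muley ?poweRyr ?leey ?gt_eqF// lte_fin.
  by rewrite !mulr_gt0 ?powR_gt0 ?core_const_gt0.
pose pm := fine (\prod_(i < m) M i)%E.
have PM : (\prod_(i < m) M i)%E = pm%:E by rewrite fineK// ge0_fin_numE// ltey.
have pm0 : 0 <= pm by rewrite fine_ge0.
have [J /andP[J1 J2]] : exists J : int, e2 J%:~R <= r ^+ n < e2 (J + 1)%:~R.
  by apply: dyadic_scale_lt; rewrite exprn_gt0.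
pose T (k : int) : \bar R :=
  if (k <= J)%R then (Cd * r `^ (- delta) * pm * (r ^+ n / e2 k%:~R) `^ a%:R^-1)%:E else 0%E.
have D0 : 0 <= Cd * r `^ (- delta) * pm by rewrite !mulr_ge0 ?powR_ge0.
have T0 k : (0 <= T k)%E by rewrite /T; case: ifP => // _; rewrite lee_fin mulr_ge0 ?powR_ge0.
pose c1 := e2 (k0%:R / p) * SB * PB.
have c10 : 0 <= c1 by rewrite !mulr_ge0 ?e2_ge0 ?(ltW SB0) ?(ltW PB0).
apply: (@le_trans _ _ (seqnorm p q (fun k => c1%:E * (Lam x0 r k + T k))))%E.
  rewrite /seqnorm (esum_shift _ k0%:Z); apply: le_esum => k _.
  apply: le_poweR; [exact: ltW|by rewrite mule_ge0 ?lee_fin ?e2_ge0 ?rearrangement_ge0|].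
  rewrite intrD -pmulrn mulrDl e2D EFinM -muleA lee_wpmul2l ?lee_fin ?e2_ge0//.
  rewrite /c1 -mulrA EFinM -muleA lee_wpmul2l ?lee_fin ?e2_ge0//.
  exact: sparse_dominated_rearr.
rewrite seqnormZ//; last by move=> k; rewrite adde_ge0.
set y := r `^ (lam / q) * pm.
have y0 : 0 <= y by rewrite mulr_ge0 ?powR_ge0.
have hL : (seqnorm p q (Lam x0 r) <= (c2 * (Cg * (n.+1%:R * 2) `^ (lam / q)) `^ q * y `^ q)%:E)%E.
  apply: (le_trans (seqnorm_scales p_gt0 q_gt0 pN (H_ge0 x0 r))).
  rewrite -mulrA EFinM lee_wpmul2l ?lee_fin//.
  have r1 : 0 < n.+1%:R * (2 * r) by rewrite !mulr_gt0.
  apply: (le_trans (gtail_product_morrey q_gt0 qs_gt0 hp hq pk kr M_ge0 fM x0 r1)).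
  rewrite PM -EFinM poweR_EFin lee_fin -/Cg.
  have -> : Cg * (n.+1%:R * (2 * r)) `^ (lam / q) * pm = Cg * (n.+1%:R * 2) `^ (lam / q) * y.
    by rewrite mulrA (powRM _ _ (ltW r0)) ?mulr_ge0// /y; ring.
  by rewrite [leLHS]powRM// mulr_ge0 ?powR_ge0.
have hT : (seqnorm p q T <= (c4 * Cd `^ q * y `^ q)%:E)%E.
  have rn0 : 0 < r ^+ n by rewrite exprn_gt0.
  apply: (le_trans (seqnorm_tail p_gt0 q_gt0 pa D0 rn0 J1)).
  (* The powers of [r] balance: [- delta + n / p = lam / q], the power already found for the small
     cubes. *)
  have -> : Cd * r `^ (- delta) * pm * (r ^+ n) `^ p^-1 = Cd * y.
    have -> : (r ^+ n) `^ p^-1 = r `^ (n%:R / p) by rewrite powRrM powR_mulrn// ltW.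
    have -> : r `^ (n%:R / p) = r `^ delta * r `^ (lam / q).
      by rewrite -powRD ?(gt_eqF r0) ?implybT// /delta subrK.
    by rewrite powRN /y; field; rewrite gt_eqF// powR_gt0.
  by rewrite lee_fin [in leLHS]powRM// mulrA.
apply: (@le_trans _ _ ((c1 `^ q)%:E * (Z * y `^ q)%:E))%E.
  rewrite lee_wpmul2l ?lee_fin ?powR_ge0//.
  apply: (le_trans (seqnormD_le _ q_gt0 (Lam_ge0 x0 r) T0)).
  apply: (@le_trans _ _ ((e2 q)%:E * ((c2 * (Cg * (n.+1%:R * 2) `^ (lam / q)) `^ q * y `^ q)%:E + (c4 * Cd `^ q * y `^ q)%:E)))%E.
    by rewrite lee_wpmul2l ?lee_fin ?e2_ge0// leeD.
  rewrite -EFinD -EFinM lee_fin -mulrDl mulrA ler_wpM2r ?powR_ge0// /Z lerDl//.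
rewrite PM -!EFinM poweR_EFin lee_fin .
rewrite (_ : r `^ (lam / q) * _ = c1 * Z `^ q^-1 * y); last by rewrite /c1 /y /core_const -/PB; ring.
rewrite (powRM q (mulr_ge0 c10 (powR_ge0 _ _)) y0) (powRM q c10 (powR_ge0 _ _)) -powRrM mulVf ?gt_eqF// powRr1 ?(ltW Z0)//.
by rewrite mulrA.
Qed.

End Core.

(** * Commutators *)

Section ZeroOscillation.
Context {R : realType} {n m l : nat}.
Hypothesis n_gt0 : (0 < n)%N.
Local Notation mu := (lebesgue_Rn R n).

Lemma bmo_norm_ge0 (b : Rn R n -> R) : (0 <= bmo_norm b)%E.
Proof.
pose Q := cube_around [tuple (0 : R) | i < n] (PosNum ltr01).
apply: le_ereal_sup_tmp; exists (average_abs Q (fun x => b x - mean Q b)); first by exists Q.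
exact: average_abs_ge0.
Qed.

Lemma rearr_ae0 (F : Rn R n -> R) k : measurable_fun [set: Rn R n] F ->
  {ae mu, forall x, F x = 0} -> rearr F k = 0%E.
Proof.
move=> mF F0; apply/eqP; rewrite eq_le rearrangement_ge0 andbT.
apply: (@rearrangement_le_ae _ _ _ set0) => //; first by rewrite measure0 lee_fin e2_ge0.
by apply: filterS F0 => x -> _; rewrite normr0.
Qed.

Lemma average_abs_eq0 (b f : Rn R n -> R) (Q : cube R n) :
  measurable_fun [set: Rn R n] b -> measurable_fun [set: Rn R n] f ->
  (average_abs Q b <= 0)%E ->
  {ae mu, forall x, cube_set Q x -> b x = 0} /\ average_abs Q (fun x => b x * f x) = 0%E.
Proof.
move=> mb mf /average_abs_le; rewrite mul0e => b0.
have mQ := measurable_cube Q.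
have mbE : measurable_fun (cube_set Q) (EFin \o b).
  by apply/measurable_EFinP; exact: measurable_funS mb.
have ae : {ae mu, forall x, cube_set Q x -> b x = 0}.
  have : (\int[mu]_(x in cube_set Q) `|(EFin \o b) x| = 0)%E.
    by apply/eqP; rewrite eq_le b0 integral_ge0.
  move/(ae_eq_integral_abs mu mQ mbE).1; apply: filterS => x /= h Qx.
  by have := h Qx; case.
split=> //; rewrite /average_abs (_ : integral _ _ _ = 0%E) ?mule0//.
have mbf : measurable_fun (cube_set Q) (EFin \o (fun x => b x * f x)).
  by apply/measurable_EFinP; apply: measurable_funS (_ : measurable_fun [set: Rn R n] _) => //; exact: measurable_funM.
apply: (ae_eq_integral_abs mu mQ mbf).2; apply: filterS ae => x /= h Qx.
by rewrite h// mul0r.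
Qed.

(** On every cube [b s] equals its mean almost everywhere, so the factor of index [s] vanishes in
    both of its forms; countably many cubes produce a single null set. *)
Lemma sparse_sum_ae0 (hlm : (l <= m)%N) (b : 'I_l -> Rn R n -> R) (f : 'I_m -> Rn R n -> R)
    (S : set (cube R n)) (s : 'I_l) :
  BMO (b s) -> bmo_norm (b s) = 0%E -> (forall i, measurable_fun [set: Rn R n] (f i)) ->
  countable S ->
  {ae mu, forall x, forall g, sparse_sum hlm b f S g x = 0%E}.
Proof.
move=> [mb _ _] b0 mf cS.
have osc0 Q : {ae mu, forall x, cube_set Q x -> b s x - mean Q (b s) = 0} /\
    average_abs Q (fun x => (b s x - mean Q (b s)) * f (widen_ord hlm s) x) = 0%E.
  apply: average_abs_eq0 => //; first exact: measurable_osc.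
  by rewrite -b0; apply: ereal_sup_ubound; exists Q.
pose E Q := cube_set Q `&` [set x | 0 < `|b s x - mean Q (b s)|].
have mE Q : measurable (E Q).
  by apply: measurableI; [exact: measurable_cube|apply: measurable_gt_norm; exact: measurable_osc].
have E0 Q : mu (E Q) = 0%E.
  have [[Z [mZ Z0 HZ]] _] := osc0 Q; apply/eqP; rewrite eq_le measure_ge0 andbT.
  apply: (@le_trans _ _ (mu Z)); last by rewrite [X in (X <= _)%E](_ : _ = 0%E).
  apply: le_measure; rewrite ?inE// => x [Qx /= xE]; apply: HZ => /= /(_ Qx) e.
  by move: xE; rewrite e normr0 ltxx.
exists (\bigcup_(Q in S) E Q); split.
- exact: countable_bigcup_measurable.
- apply/eqP; rewrite eq_le measure_ge0 andbT.
  apply: (le_trans (measure_bigcup_le_esum _ _ _)) => //.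
  by rewrite esum1// => Q _; exact: E0.
move=> x /= nx; apply: contrapT => nE; apply: nx => g; apply: esum1 => Q SQ.
have [Qx|nQx] := pselect (cube_set Q x); last by rewrite indicE memNset// mule0.
have bx : b s x - mean Q (b s) = 0.
  apply/eqP; rewrite -normr_le0 leNgt; apply/negP => h; apply: nE; exists Q => //.
rewrite (bigD1 s)//= (_ : sparse_factor _ _ _ _ _ = 0%E) ?mul0e//.
rewrite /sparse_factor; case: (g s); first by case: (osc0 Q).
by rewrite bx abse0 mul0e.
Qed.

End ZeroOscillation.

Section Measurability.
Context {R : realType} {n m : nat}.

(** Induction on the remaining indices. As these are distinct, a slot is multiplied by its [b s] at
    most once: until then it holds a bounded function with compact support, and afterwards an
    element of [V]. *)
Lemma measurable_iterated_commutator (l : nat) (hlm : (l <= m)%N) (V : set (Rn R n -> R))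
    (T : operator R n m) (b : 'I_l -> Rn R n -> R) (fs : 'I_m -> Rn R n -> R) :
  multilinear_operator V T -> (forall s, measurable_fun [set: Rn R n] (b s)) ->
  (forall s f, bounded_compact_support f -> V (fun x => b s x * f x)) ->
  (forall i, bounded_compact_support (fs i)) ->
  measurable_fun [set: Rn R n] (iterated_commutator hlm b T fs).
Proof.
move=> [_ bV _ mT _] mb Vb bfs; rewrite /iterated_commutator.
have : uniq (enum 'I_l) by exact: enum_uniq.
have : forall s, s \in enum 'I_l -> bounded_compact_support (fs (widen_ord hlm s)) by [].
have : forall i, V (fs i) by move=> i; exact: bV.
move: (enum 'I_l) {bfs} => r; elim: r fs => [|s r IH] fs Vfs bfs /=; first by move=> _; exact: mT.
move=> /andP[sr ur]; rewrite /commutator.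
have bfs' s' : s' \in r -> bounded_compact_support (fs (widen_ord hlm s')).
  by move=> h; apply: bfs; rewrite inE h orbT.
apply: measurable_funB.
  by apply: measurable_funM => //; exact: IH.
apply: IH => //.
- by move=> i /=; case: eqP => // _; apply: Vb; apply: bfs; rewrite inE eqxx.
- move=> s' s'r /=; case: eqP => [/(congr1 val)/= e|_]; last exact: bfs'.
  by move: sr; rewrite (_ : s = s') ?s'r//; apply: val_inj.
Qed.

End Measurability.

Section CommutatorEstimate.
Context {R : realType} {n m l : nat}.
Local Notation mu := (lebesgue_Rn R n).
Variables (p q lam : R) (ps qs : 'I_m -> R).
Hypotheses (l_gt0 : (0 < l)%N) (hlm : (l <= m)%N).
Hypotheses (p_gt1 : 1 < p) (q_gt0 : 0 < q) (ps_gt0 : forall i, 0 < ps i) (qs_gt0 : forall i, 0 < qs i).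
Hypotheses (hp : p^-1 = \sum_(i < m) (ps i)^-1) (hq : q^-1 = \sum_(i < m) (qs i)^-1).
Hypotheses (lam_ge0 : 0 <= lam) (lam_ltn : lam < n%:R) (lam_lt : lam / n%:R < q / p).

Lemma sparse_commutator_morrey (C0 eta : R) : 0 < eta -> eta < 1 ->
  exists2 C : R, 0 < C & forall (b : 'I_l -> Rn R n -> R) (f : 'I_m -> Rn R n -> R)
    (F : Rn R n -> R) (M : 'I_m -> \bar R) (S : 'I_(3 ^ n) -> set (cube R n)),
  (forall s, BMO (b s)) -> (forall i, measurable_fun [set: Rn R n] (f i)) ->
  measurable_fun [set: Rn R n] F -> (forall j, sparse eta (S j)) ->
  {ae mu, forall x, (`|(F x)%:E| <=
    C0%:E * \sum_(j < 3 ^ n) \sum_(g : {ffun 'I_l -> bool}) sparse_sum hlm b f (S j) g x)%E} ->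
  (forall i, 0 <= M i)%E -> (forall i, discrete_morrey (ps i) (qs i) lam (f i) (M i)) ->
  discrete_morrey p q lam F (C%:E * (\prod_(s < l) bmo_norm (b s)) * \prod_(i < m) M i)%E.
Proof.
move=> eta0 eta1.
have p_gt0 : 0 < p by exact: lt_trans p_gt1.
have n_gt0 : (0 < n)%N by rewrite -(ltr_nat R); exact: le_lt_trans lam_ltn.
have nR : (0 : R) < n%:R by rewrite ltr0n.
pose delta := n%:R / p - lam / q.
have delta0 : 0 < delta.
  move: lam_lt; rewrite subr_gt0 ltr_pdivrMr// ltr_pdivrMr// => h.
  by rewrite mulrAC [X in X / p]mulrC mulrAC in h.
(* Midway between [1 / p] and 1: above every [1 / ps i], with room left for some [rho > 1]. *)
pose kap := (1 + p^-1) / 2.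
have ip1 : p^-1 < 1 by rewrite invf_lt1.
have ip0 : 0 < p^-1 by rewrite invr_gt0.
have kap1 : kap < 1 by rewrite /kap; lra.
have kap0 : 0 < kap by rewrite /kap; lra.
have pk i : (ps i)^-1 < kap.
  apply: (@le_lt_trans _ _ p^-1); last by rewrite /kap; lra.
  rewrite hp (bigD1 i)//= lerDl sumr_ge0// => j _; by rewrite invr_ge0 ltW.
(* Large enough for [kap * rho < 1], where [rho = 1 + 1 / a0]. *)
pose a0 := Num.bound (kap / (1 - kap)).
have a0P : kap / (1 - kap) < a0%:R by apply: archi_boundP; rewrite divr_ge0 ?subr_ge0 ?(ltW kap0) ?(ltW kap1).
have a0_gt0 : (0 < a0)%N.
  by rewrite -(ltr_nat R); apply: le_lt_trans a0P; rewrite divr_ge0 ?subr_ge0 ?(ltW kap0) ?(ltW kap1).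
have kr : kap * (1 + a0%:R^-1) < 1.
  have a0R : (0 : R) < a0%:R by rewrite ltr0n.
  move: a0P; rewrite ltr_pdivrMr ?subr_gt0// => a0P.
  by rewrite mulrDr mulr1 -ltrBrDl ltr_pdivrMr// mulrC.
pose N := Num.bound p.
have pN : p < N%:R by apply: archi_boundP; exact: ltW.
(* The first summand exceeds [2 N], as the small cubes require; the second exceeds [2 n / delta], as
   the large ones do. *)
pose a := ((2 * N).+1 + Num.bound (2 * n%:R / delta))%N.
have aN : (2 * N < a)%N by rewrite /a addSn ltnS leq_addr.
have aD : n%:R < a%:R * delta / 2.
  have : 2 * n%:R / delta < a%:R.
    apply: (lt_le_trans (archi_boundP _)); first by rewrite divr_ge0 ?mulr_ge0// ltW.
    by rewrite ler_nat leq_addl.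
  by rewrite ltr_pdivrMr// => h; lra.
have [A A0 HA] := @osc_weight_tail R n n_gt0 l a l_gt0 (leq_ltn_trans (leq0n _) aN).
have [Cj Cj0 HC] := bmo_osc_power R n_gt0 (ltn0Sn a0).
pose k0 := Num.bound (@families R n l * @level_bound R n m a N eta A delta + 2 ^+ n).
have k0P : @families R n l * @level_bound R n m a N eta A delta + 2 ^+ n <= e2 k0%:R.
  apply: (@le_trans _ _ k0%:R).
    by apply/ltW/archi_boundP; rewrite addr_ge0 ?exprn_ge0// mulr_ge0// addr_ge0.
  by rewrite -[X in e2 X]mul1r e2Mn e21 -natrX ler_nat ltnW// ltn_expl.
pose C := @core_const R n m l p q lam ps qs a0 a N k0 kap eta A Cj C0.
exists C; first exact: core_const_gt0.
move=> b f F M S bB mf mF spS domF M0 fM.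
(* The oscillations cannot be normalized by a BMO norm equal to zero, but the domination then forces
   [F = 0] almost everywhere. *)
have [[s bs0]|nbs] := pselect (exists s, bmo_norm (b s) = 0%E).
  have F0 : {ae mu, forall x, F x = 0}.
    have cS j : countable (S j).
      have [D [lD SD _]] := spS j; apply: grid_countable.
      by apply: grid_sub SD _; exact: grid_lattice.
    have : {ae mu, forall x, forall j g, sparse_sum hlm b f (S j) g x = 0%E}.
      apply: (@filter_forall _ _ (fun j x => forall g, sparse_sum hlm b f (S j) g x = 0%E) (almost_everywhere mu)) => j.
      exact: (sparse_sum_ae0 hlm (bB s) bs0 mf (cS j)).
    apply: filterS2 domF => x domx h; move: domx; rewrite big1 ?mule0; last first.
      by move=> j _; rewrite big1.
    by rewrite lee_fin normr_le0 => /eqP.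
  rewrite (bigD1 s)//= bs0 mul0e mule0 mul0e => x r r0.
  rewrite mule0 poweR0r ?gt_eqF// /seqnorm esum1// => k _.
  rewrite rearr_ae0 ?mule0 ?poweR0r ?gt_eqF//; first exact: measurable_cutoff.
  by apply: filterS F0 => y Fy; rewrite /cutoff Fy mul0r.
pose B s := fine (bmo_norm (b s)).
have BE s : bmo_norm (b s) = (B s)%:E by rewrite fineK// ge0_fin_numE ?bmo_norm_ge0//; case: (bB s).
have B0 s : 0 < B s.
  by rewrite -lte_fin -BE lt_neqAle bmo_norm_ge0 andbT; apply/eqP => e; apply: nbs; exists s.
have Ble s : (bmo_norm (b s) <= (B s)%:E)%E by rewrite BE.
under eq_bigr do rewrite BE; rewrite prodEFin -EFinM.
apply: (sparse_dominated_morrey n_gt0 p_gt0 q_gt0 ps_gt0 qs_gt0 hp hq a0_gt0 kr eta0 eta1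
  (ltW A0) pN aN delta0 Cj0 aD pk k0P B0 _ mf _ _ mF spS domF M0 fM).
- by move=> s; case: (bB s).
- move=> s Q; case: (bB s) => mb ib _; apply: HC => // Q'.
  by apply: le_trans (Ble s); apply: ereal_sup_ubound; exists Q'.
- by move=> g; exact: HA.
Qed.

End CommutatorEstimate.

(** * Return from sequence norms to Morrey-Lorentz and Morrey norms *)

Section NormTransfer.
Context {R : realType} {n : nat}.
Implicit Types (nrm : (Rn R n -> R) -> \bar R).

(** Both the Morrey-Lorentz norm and the Morrey norm are of this form by definition, so one transfer
    lemma yields both conclusions. *)
Definition morrey_sup (a : R) nrm (f : Rn R n -> R) : \bar R :=
  ereal_sup [set ((z.2 `^ a)^-1)%:E * nrm (cutoff z.1 z.2 f) | z in [set z : Rn R n * R | (0 < z.2)%R]]%E.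

Lemma morrey_sup_ge0 a nrm f : (forall g, 0 <= nrm g)%E -> (0 <= morrey_sup a nrm f)%E.
Proof.
move=> n0; apply: le_ereal_sup_tmp.
exists (((1 `^ a)^-1)%:E * nrm (cutoff [tuple (0 : R)%R | i < n] 1%R f))%E.
  by exists ([tuple (0 : R) | i < n], 1) => /=.
by rewrite mule_ge0// lee_fin invr_ge0 powR_ge0.
Qed.

Lemma discrete_morrey_sup (p q lam c : R) nrm f : 0 < q -> 0 <= c ->
  measurable_fun [set: Rn R n] f -> (forall g, 0 <= nrm g)%E ->
  (forall g, measurable_fun [set: Rn R n] g -> seqnorm p q (rearr g) <= (c%:E * nrm g) `^ q)%E ->
  discrete_morrey p q lam f (c%:E * morrey_sup (lam / q) nrm f)%E.
Proof.
move=> q0 c0 mf n0 H x s s0; apply: (le_trans (H _ (measurable_cutoff x s mf))).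
apply: le_poweR; [exact: ltW|by rewrite mule_ge0 ?lee_fin|].
rewrite muleCA lee_wpmul2l ?lee_fin// -lee_pdivrMl ?powR_gt0//.
by apply: ereal_sup_ubound; exists (x, s).
Qed.

Lemma morrey_sup_discrete (p q lam c : R) nrm f (M : \bar R) : 0 <= c ->
  measurable_fun [set: Rn R n] f -> (0 <= M)%E ->
  (forall g y, measurable_fun [set: Rn R n] g -> (0 <= y -> seqnorm p q (rearr g) <= y `^ q -> nrm g <= c%:E * y)%E) ->
  discrete_morrey p q lam f M -> (morrey_sup (lam / q) nrm f <= c%:E * M)%E.
Proof.
move=> c0 mf M0 H fM; apply: ge_ereal_sup => _ [[x s] /= s0 <-].
rewrite lee_pdivrMl ?powR_gt0// muleCA; apply: H; [exact: measurable_cutoff| |exact: fM].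
by rewrite mule_ge0 ?lee_fin ?powR_ge0.
Qed.

Lemma poweR_root_le (q c : R) (x y : \bar R) : 0 < q -> 0 <= c -> (0 <= x)%E ->
  (x <= c%:E * y)%E -> (0 <= y)%E -> (x `^ q^-1 <= (c `^ q^-1)%:E * y `^ q^-1)%E.
Proof.
move=> q0 c0 x0 h y0; rewrite -poweR_EFin -poweRM ?lee_fin//.
by apply: le_poweR => //; rewrite invr_ge0 ltW.
Qed.

(* Both norms are [q]-th roots of a quantity comparable with [seqnorm]. *)
Lemma seqnorm_le_root (p q c : R) (I : \bar R) (g : Rn R n -> R) : 0 < q -> 0 <= c -> (0 <= I)%E ->
  (seqnorm p q (rearr g) <= c%:E * I)%E ->
  (seqnorm p q (rearr g) <= ((c `^ q^-1)%:E * I `^ q^-1) `^ q)%E.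
Proof.
move=> q0 c0 I0 h; rewrite poweRM ?lee_fin ?powR_ge0 ?poweR_ge0// poweR_EFin -powRrM -poweRrM.
by rewrite mulVf ?gt_eqF// powRr1// poweRe1.
Qed.

Lemma root_le_seqnorm (p q c : R) (I y : \bar R) (g : Rn R n -> R) : 0 < q -> 0 <= c -> (0 <= I)%E ->
  (I <= c%:E * seqnorm p q (rearr g))%E -> (0 <= y)%E -> (seqnorm p q (rearr g) <= y `^ q)%E ->
  (I `^ q^-1 <= (c `^ q^-1)%:E * y)%E.
Proof.
move=> q0 c0 I0 h y0 hy.
have -> : y = ((y `^ q) `^ q^-1)%E by rewrite -poweRrM mulfV ?gt_eqF// poweRe1.
apply: poweR_root_le; rewrite ?poweR_ge0//.
by apply: (le_trans h); rewrite lee_wpmul2l ?lee_fin.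
Qed.

Lemma seqnorm_le_lorentz (p q : R) g : 0 < p -> 0 < q -> measurable_fun [set: Rn R n] g ->
  (seqnorm p q (rearr g) <= (((2 * e2 (q / p)) `^ q^-1)%:E * lorentz_norm p q g) `^ q)%E.
Proof.
move=> p0 q0 mg; apply: seqnorm_le_root => //; first by rewrite mulr_ge0 ?e2_ge0.
- by apply: integral_ge0 => t /=; rewrite in_itv/= andbT => /ltW t0; rewrite mule_ge0 ?poweR_ge0// lee_fin invr_ge0.
- exact: lorentz_integral_ge.
Qed.

Lemma lorentz_le_seqnorm (p q : R) g (y : \bar R) : 0 < p -> 0 < q -> measurable_fun [set: Rn R n] g ->
  (0 <= y -> seqnorm p q (rearr g) <= y `^ q -> lorentz_norm p q g <= (e2 (q / p) `^ q^-1)%:E * y)%E.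
Proof.
move=> p0 q0 mg; apply: root_le_seqnorm => //; first exact: e2_ge0.
- by apply: integral_ge0 => t /=; rewrite in_itv/= andbT => /ltW t0; rewrite mule_ge0 ?poweR_ge0// lee_fin invr_ge0.
- exact: lorentz_integral_le.
Qed.

Definition lebesgue_norm (q : R) (g : Rn R n -> R) : \bar R :=
  Lnorm (lebesgue_Rn R n) q%:E (EFin \o g).

Lemma lebesgue_normE (q : R) g : lebesgue_norm q g = (power_integral g q `^ q^-1)%E.
Proof.
by rewrite /lebesgue_norm unlock; congr (_ `^ _)%E; apply: eq_integral => x _; rewrite -poweR_EFin.
Qed.

Lemma morrey_lorentz_normE (p q lam : R) f :
  morrey_lorentz_norm p q lam f = morrey_sup (lam / q) (lorentz_norm p q) f.
Proof. by []. Qed.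

Lemma morrey_normE (q lam : R) f : morrey_norm q lam f = morrey_sup (lam / q) (lebesgue_norm q) f.
Proof. by []. Qed.

Definition power_const (q : R) : R := (e2 q * 2 / (1 - e2 (- q))) `^ q^-1.

Let power_const_base (q : R) : 0 < q -> 0 <= e2 q * 2 / (1 - e2 (- q)).
Proof. by move=> q0; rewrite !mulr_ge0 ?e2_ge0// invr_ge0 subr_ge0 ltW// e2_lt1// oppr_lt0. Qed.

Let power_integral_ge0 (q : R) (g : Rn R n -> R) : (0 <= power_integral g q)%E.
Proof. by apply: integral_ge0 => x _; rewrite lee_fin powR_ge0. Qed.

Lemma seqnorm_le_lebesgue (q : R) g : 0 < q -> measurable_fun [set: Rn R n] g ->
  (seqnorm q q (rearr g) <= ((power_const q)%:E * lebesgue_norm q g) `^ q)%E.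
Proof.
move=> q0 mg; rewrite lebesgue_normE; apply: seqnorm_le_root => //; first exact: power_const_base.
exact: seqnorm_le_power_integral.
Qed.

Lemma lebesgue_le_seqnorm (q : R) g (y : \bar R) : 0 < q -> measurable_fun [set: Rn R n] g ->
  (0 <= y -> seqnorm q q (rearr g) <= y `^ q -> lebesgue_norm q g <= (power_const q)%:E * y)%E.
Proof.
move=> q0 mg; rewrite lebesgue_normE; apply: root_le_seqnorm => //; first exact: power_const_base.
exact: power_integral_le_seqnorm.
Qed.

Lemma morrey_sup_transfer (m : nat) (p q lam C c' : R) (ps qs c : 'I_m -> R) nrm
    (nrms : 'I_m -> (Rn R n -> R) -> \bar R) (f : 'I_m -> Rn R n -> R) F (P : \bar R) :
  0 < q -> (forall i, 0 < qs i) -> 0 <= C -> 0 <= c' -> (forall i, 0 <= c i) -> (0 <= P)%E ->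
  (forall i, measurable_fun [set: Rn R n] (f i)) -> measurable_fun [set: Rn R n] F ->
  (forall i g, 0 <= nrms i g)%E ->
  (forall i g, measurable_fun [set: Rn R n] g ->
     (seqnorm (ps i) (qs i) (rearr g) <= ((c i)%:E * nrms i g) `^ qs i)%E) ->
  (forall g y, measurable_fun [set: Rn R n] g ->
     (0 <= y -> seqnorm p q (rearr g) <= y `^ q -> nrm g <= c'%:E * y)%E) ->
  (forall M : 'I_m -> \bar R, (forall i, 0 <= M i)%E ->
     (forall i, discrete_morrey (ps i) (qs i) lam (f i) (M i)) ->
     discrete_morrey p q lam F (C%:E * P * \prod_(i < m) M i)%E) ->
  (morrey_sup (lam / q) nrm F <=
   (c' * C * \prod_(i < m) c i)%:E * P * \prod_(i < m) morrey_sup (lam / qs i) (nrms i) (f i))%E.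
Proof.
move=> q0 qs0 C0 c'0 c0 P0 mf mF n0 Hi H main.
(* The constants [c i] enter through the bounds fed to [main], and [c'] on the way back to the norm
   of [F]. *)
pose M i := ((c i)%:E * morrey_sup (lam / qs i) (nrms i) (f i))%E.
have M0 i : (0 <= M i)%E by rewrite mule_ge0 ?lee_fin// morrey_sup_ge0.
have fM i : discrete_morrey (ps i) (qs i) lam (f i) (M i).
  by apply: discrete_morrey_sup => //; exact: Hi.
apply: (le_trans (morrey_sup_discrete c'0 mF _ H (main M M0 fM))).
  by rewrite !mule_ge0 ?lee_fin// prode_ge0.
rewrite /M prod_EFinM !EFinM.
by rewrite le_eqVlt; apply/orP; left; apply/eqP; rewrite !muleA; congr (_ * _)%E; rewrite -!muleA; congr (_ * (_ * _))%E; rewrite muleC.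
Qed.

End NormTransfer.

Theorem corollary5p2 (R : realType) (n m l : nat)
  (l_ge1 : (1 <= l)%N) (hlm : (l <= m)%N)
  (p q : R) (ps qs : 'I_m -> R) (lam : R)
  (p_gt1 : 1 < p) (ps_gt1 : forall i, 1 < ps i)
  (q_ge1 : 1 <= q) (qs_ge1 : forall i, 1 <= qs i)
  (hp : p^-1 = \sum_(i < m) (ps i)^-1)
  (hq : q^-1 = \sum_(i < m) (qs i)^-1)
  (lam_ge0 : 0 <= lam) (lam_ltn : lam < n%:R)
  (lam_lti : forall i, lam / n%:R < qs i / ps i)
  (lam_lt : lam / n%:R < q / p)
  (V : set (Rn R n -> R)) (T : operator R n m)
  (hT : multilinear_operator V T)
  (C0 eta : R) (eta_gt0 : 0 < eta) (eta_lt1 : eta < 1) :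
  exists C : R,
  forall b : 'I_l -> Rn R n -> R,
    (forall s, BMO (b s)) ->
    (forall s f, bounded_compact_support f -> V (fun x => b s x * f x)) ->
    sparse_domination C0 eta hlm b (iterated_commutator hlm b T) ->
  forall fs : 'I_m -> Rn R n -> R,
    (forall i, bounded_compact_support (fs i)) ->
    (morrey_lorentz_norm p q lam (iterated_commutator hlm b T fs)
     <= C%:E * (\prod_(s < l) bmo_norm (b s))
            * \prod_(i < m) morrey_lorentz_norm (ps i) (qs i) lam (fs i))%E
    /\
    ((forall i, ps i = qs i) ->
     (morrey_norm q lam (iterated_commutator hlm b T fs)
      <= C%:E * (\prod_(s < l) bmo_norm (b s))
             * \prod_(i < m) morrey_norm (qs i) lam (fs i))%E).
Proof.
have p_gt0 : 0 < p by exact: lt_trans p_gt1.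
have q_gt0 : 0 < q by exact: lt_le_trans q_ge1.
have ps_gt0 i : 0 < ps i by exact: lt_trans (ps_gt1 i).
have qs_gt0 i : 0 < qs i by exact: lt_le_trans (qs_ge1 i).
have [C Cpos HC] := sparse_commutator_morrey l_ge1 hlm p_gt1 q_gt0 ps_gt0 qs_gt0 hp hq
  lam_ge0 lam_ltn lam_lt C0 eta_gt0 eta_lt1.
pose C1 := e2 (q / p) `^ q^-1 * C * \prod_(i < m) (2 * e2 (qs i / ps i)) `^ (qs i)^-1.
pose C2 := power_const q * C * \prod_(i < m) power_const (qs i).
(* One constant must serve both conclusions; [C1] and [C2] differ only by the comparison constants
   of the two kinds of norm. *)
exists (Num.max C1 C2) => b bB bV dom fs bfs.
have mfs i : measurable_fun [set: Rn R n] (fs i) by case: (bfs i).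
set F := iterated_commutator hlm b T fs.
have mF : measurable_fun [set: Rn R n] F.
  have mb s : measurable_fun [set: Rn R n] (b s) by case: (bB s).
  exact: measurable_iterated_commutator hT mb bV bfs.
have [S [spS domF]] := dom fs bfs.
set P := (\prod_(s < l) bmo_norm (b s))%E.
have P0 : (0 <= P)%E by apply: prode_ge0 => s _; exact: bmo_norm_ge0.
have main (M : 'I_m -> \bar R) : (forall i, 0 <= M i)%E ->
    (forall i, discrete_morrey (ps i) (qs i) lam (fs i) (M i)) ->
    discrete_morrey p q lam F (C%:E * P * \prod_(i < m) M i)%E.
  exact: HC bB mfs mF spS domF.
have lor0 p' q' (g : Rn R n -> R) : (0 <= lorentz_norm p' q' g)%E by exact: poweR_ge0.
have leb0 q' (g : Rn R n -> R) : (0 <= lebesgue_norm q' g)%E by rewrite lebesgue_normE poweR_ge0.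
have raise c (X Y : \bar R) : (0 <= Y)%E -> c <= Num.max C1 C2 ->
    (X <= c%:E * P * Y)%E -> (X <= (Num.max C1 C2)%:E * P * Y)%E.
  by move=> Y0 h /le_trans; apply; rewrite !lee_wpmul2r ?lee_fin.
split=> [|psqs].
- rewrite morrey_lorentz_normE; under [X in (_ * X)%E]eq_bigr do rewrite morrey_lorentz_normE.
  apply: (@raise C1); first by apply: prode_ge0 => i _; exact: morrey_sup_ge0.
    by rewrite le_max lexx.
  apply: (@morrey_sup_transfer R n m p q lam C _ ps qs (fun i => (2 * e2 (qs i / ps i)) `^ (qs i)^-1)
    (lorentz_norm p q) (fun i => lorentz_norm (ps i) (qs i)) fs F P
    q_gt0 qs_gt0 (ltW Cpos) (powR_ge0 _ _) (fun i => powR_ge0 _ _) P0 mfs mF _ _ _ main) => //.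
  + by move=> i g mg; exact: seqnorm_le_lorentz.
  + by move=> g y mg; exact: lorentz_le_seqnorm.
- have pq : p = q by apply: invr_inj; rewrite hp hq; apply: eq_bigr => i _; rewrite psqs.
  have main' (M : 'I_m -> \bar R) : (forall i, 0 <= M i)%E ->
      (forall i, discrete_morrey (qs i) (qs i) lam (fs i) (M i)) ->
      discrete_morrey q q lam F (C%:E * P * \prod_(i < m) M i)%E.
    have psE : ps = qs by exact/funext.
    by move: (main M); rewrite psE pq.
  rewrite morrey_normE; under [X in (_ * X)%E]eq_bigr do rewrite morrey_normE.
  apply: (@raise C2); first by apply: prode_ge0 => i _; exact: morrey_sup_ge0.
    by rewrite le_max lexx orbT.
  apply: (@morrey_sup_transfer R n m q q lam C (power_const q) qs qs (fun i => power_const (qs i))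
    (lebesgue_norm q) (fun i => lebesgue_norm (qs i)) fs F P
    q_gt0 qs_gt0 (ltW Cpos) (powR_ge0 _ _) (fun i => powR_ge0 _ _) P0 mfs mF _ _ _ main') => //.
  + by move=> i g mg; exact: seqnorm_le_lebesgue.
  + by move=> g y mg; exact: lebesgue_le_seqnorm.
Qed.
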